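(* Consider a Galton-Watson tree with offspring variable $\xi$ and factorial moments $m_k:=\mathbf{E}\big[\prod_{i=0}^{k-1}(\xi-i)\big]$, and assume $m_1>1$ and $m_3<\infty$. Let $p_c=1/m_1$. For $p>p_c$ let $(X_n)_{n\ge0}$ be the simple random walk with $X_0=\varrho$ on the $p$-percolated Galton-Watson tree conditioned to be infinite, and let $v(p)$ be its effective speed. Then $$\lim_{p\searrow p_c}\frac{v(p)}{(p-p_c)^2}=\frac{m_1^4}{3m_2}.$$
   Context: $\mathcal{T}$ is a Galton-Watson tree rooted at $\varrho$ with offspring variable $\xi$. For $p\in(0,1)$, each edge of $\mathcal{T}$ is deleted with probability $1-p$, independently of every other edge and of $\mathcal{T}$, and $\mathcal{T}_p$ is the connected component of $\varrho$; it is a Galton-Watson tree whose offspring variable $\xi_p$, conditionally on $\{\xi=n\}$, is binomial with parameters $n,p$. Its law is $\mathbf{P}_p$, and for $p>p_c$ its law conditioned on being infinite is $\bar{\mathbf{P}}_p$. $\mathbb{P}_p:=\bar{\mathbf{P}}_p\times P_{\mathcal{T}}$ is the annealed law of the simple random walk started at $\varrho$ (sample the infinite tree from $\bar{\mathbf{P}}_p$, then run simple random walk on it). For a vertex $v$, $|v|$ denotes its graph distance to the root. The effective speed is $v(p):=\lim_{n\to\infty}|X_n|/n$; it is known that for $p>p_c$ this limit exists $\mathbb{P}_p$-almost surely and is a deterministic non-zero constant. *)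

(* Defs.v *)
From HB Require Import structures.
From mathcomp Require Import all_boot all_order all_algebra.
From mathcomp Require Import finmap.
From mathcomp Require Import all_classical all_reals all_analysis.
Set Implicit Arguments.
Unset Strict Implicit.
Unset Printing Implicit Defensive.
Import Order.TTheory GRing.Theory Num.Theory.
Import numFieldNormedType.Exports.
Local Open Scope classical_set_scope.
Local Open Scope ring_scope.

(* Ulam-Harris words, written from the vertex back to the root: the root is
   [::], the i-th child of u (counted from 0) is i :: u, and |u| is size u. *)
Notation vertex := (seq nat).

Definition root : vertex := [::].

Definition is_child (u v : vertex) : bool :=
  if v is _ :: u' then u' == u else false.

(* N u is the number of children of u. *)
Fixpoint gw_tree (N : vertex -> nat) (v : vertex) : bool :=
  if v is i :: u then gw_tree N u && (i < N u)%N else true.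

(* B v tells whether the edge between v and its parent is kept; B root is
   irrelevant. *)
Definition open_edge (N : vertex -> nat) (B : vertex -> bool) : rel vertex :=
  fun u v => [&& is_child u v, gw_tree N v & B v]
          || [&& is_child v u, gw_tree N u & B u].

Definition component (e : rel vertex) (x : vertex) : set vertex :=
  [set y | exists2 s : seq vertex, path e x s & y = last x s].

Definition percolated_tree (N : vertex -> nat) (B : vertex -> bool) :
    set vertex :=
  component (open_edge N B) root.

(* The size of a vertex of the percolated tree is its graph distance to the
   root: no open path to it is shorter, and some open path has that length. *)
Lemma size_le_path N B (s : seq vertex) :
  path (open_edge N B) root s -> (size (last root s) <= size s)%N.
Proof.
suff H x : path (open_edge N B) x s ->
    (size (last x s) <= size x + size s)%N by move=> /H.
elim: s x => [|y s IH] x /=; first by rewrite addn0.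
case/andP=> xy /IH {}IH; apply: leq_trans IH _; rewrite addnS -addSn leq_add2r.
case/orP: xy => /and3P[].
  by case: y => // i y /= /eqP ->.
by case: x => // i x /= /eqP -> _ _; rewrite ltnW.
Qed.

Lemma percolated_tree_path N B (v : vertex) : percolated_tree N B v ->
  exists s, [/\ path (open_edge N B) root s, last root s = v &
    size s = size v].
Proof.
suff H u : percolated_tree N B u -> forall k,
    exists s, [/\ path (open_edge N B) root s, last root s = drop k u &
      size s = size (drop k u)].
  by move=> /H/(_ 0%N); rewrite drop0.
move=> [t + ->]; elim/last_ind: t => [_ k|t y IH]; first by exists [::].
rewrite rcons_path last_rcons => /andP[/IH{}IH].
move: (last root t) IH => x IH /orP[] e; case/and3P: (e).
  case: y e => // i y e /= /eqP xy _ _ [|k]; last by rewrite xy; exact: IH.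
  have [s []] := IH 0%N; rewrite drop0 => ps ls ss.
  exists (rcons s (i :: y)); rewrite rcons_path ps last_rcons size_rcons ls ss.
  by split=> //; [rewrite /open_edge e | rewrite xy].
by case: x IH e => // i x IH e /= /eqP <- _ _ k; exact: (IH k.+1).
Qed.

Section probability.
Local Open Scope ereal_scope.

Definition mutually_independent d (T : measurableType d) (R : realType)
    (P : probability T R) (I : eqType) (F : I -> set (set T)) : Prop :=
  forall (s : seq I) (E : I -> set T), uniq s ->
    (forall i, i \in s -> F i (E i)) ->
    P (\bigcap_(i in [set` s]) E i) = \prod_(i <- s) P (E i).

(* The offspring numbers (tagged inl) and the edge states (tagged inr) form one
   mutually independent family, so that every edge is kept or deleted
   independently of the other edges and of the tree. *)
Definition gw_percolation (R : realType) (mu : probability nat R) (p : R)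
    d (Omega : measurableType d) (P : probability Omega R)
    (N : vertex -> {RV P >-> nat}) (B : vertex -> {RV P >-> bool}) : Prop :=
  [/\ forall u, distribution P (N u) = mu :> (set nat -> \bar R),
      forall u, distribution P (B u) = bernoulli_prob p
                  :> (set bool -> \bar R) &
      @mutually_independent _ Omega R P (vertex + vertex)%type
        (fun i => match i with
                  | inl u => preimage_set_system setT (N u) measurable
                  | inr u => preimage_set_system setT (B u) measurable
                  end)].

Definition srw_step (R : realType) (e : rel vertex) (x y : vertex) : R :=
  if e x y then (#|` fset_set [set z | e x z]|%fset%:R)^-1%R else 0%R.

(* Under Q, X is the Markov chain started at x0 which jumps to a uniformly
   chosen e-neighbour. *)
Definition simple_random_walk (R : realType) (e : rel vertex) (x0 : vertex)
    d (W : measurableType d) (Q : {measure set W -> \bar R})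
    (X : nat -> W -> vertex) : Prop :=
  forall (n : nat) (x : nat -> vertex),
    Q [set w | forall i, (i <= n)%N -> X i w = x i] =
    ((x 0%N == x0)%:R * \prod_(i < n) srw_step R e (x i) (x i.+1))%R%:E.

(* The law of (omega, w) when omega is sampled from P conditioned on S, that is
   from A |-> P (A `&` S) / P S, and then w is sampled from K omega. *)
Definition annealed_law (R : realType) d (Omega : measurableType d)
    (P : probability Omega R) (S : set Omega) d' (W : measurableType d')
    (K : R.-pker Omega ~> W) (E : set (Omega * W)) : \bar R :=
  (\int[P]_(omega in S) K omega (xsection E omega)) * ((fine (P S))^-1)%:E.

(* v is the almost sure limit of |X_n| / n under the annealed law of the simple
   random walk on the p-percolated Galton-Watson tree conditioned to be
   infinite. The law of (tree, walk) is determined by mu and p, so v does not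
   depend on the probability spaces on which they are realized. *)
Definition effective_speed (R : realType) (mu : probability nat R) (p v : R) :
    Prop :=
  exists (d : measure_display) (Omega : measurableType d)
    (P : probability Omega R)
    (N : vertex -> {RV P >-> nat}) (B : vertex -> {RV P >-> bool})
    (d' : measure_display) (W : measurableType d')
    (K : R.-pker Omega ~> W) (X : nat -> W -> vertex),
  let tree omega := percolated_tree (N ^~ omega) (B ^~ omega) in
  let infinite_tree := [set omega | infinite_set (tree omega)] in
  [/\ gw_percolation mu p N B,
      forall n x, measurable (X n @^-1` [set x]),
      forall omega, infinite_tree omega ->
        simple_random_walk (open_edge (N ^~ omega) (B ^~ omega)) root
          (K omega) X &
      {ae annealed_law P infinite_tree K, forall z : Omega * W,
        ((size (X n z.2))%:R / n%:R)%R @[n --> \oo] --> v}].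

(* m_k = E [xi (xi - 1) ... (xi - k + 1)] *)
Definition factorial_moment (R : realType) d (T : measurableType d)
    (P : probability T R) (xi : {RV P >-> nat}) (k : nat) : \bar R :=
  'E_P[fun w => (\prod_(i < k) ((xi w)%:R - i%:R))%R].

End probability.

(* Main.v *)
Require Import Defs.
From HB Require Import structures.
From mathcomp Require Import finmap.
From mathcomp Require Import all_boot all_order all_algebra.
From mathcomp Require Import all_classical all_reals all_analysis.
From mathcomp Require Import measurable_realfun.
From mathcomp Require Import ring lra zify.
Set Implicit Arguments.
Unset Strict Implicit.
Unset Printing Implicit Defensive.
Import Order.TTheory GRing.Theory Num.Theory.
Import numFieldNormedType.Exports.
Local Open Scope classical_set_scope.
Local Open Scope ring_scope.

(** The proof never conditions a Galton-Watson tree on anything. It works on a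
    pair of independent copies of the percolated tree, with an edge joining the
    two roots, and restricts the integrals to the pairs that are infinite.

    Seen from the first root, which is the origin of the walk, the branches
    behind its [s] children and the one behind the joining edge are [s + 1]
    independent copies of the tree. Hence the law of the pair seen from the walker
    does not change in time ([stationary]), and neither does its restriction to
    the infinite pairs. A walker with [s] children around it gets away from
    the origin by [1 - 2 / (s + 1)] on average, unless it sits at the origin. So
    the mean distance to the origin grows at each step by the integral of
    [1 - 2 / (s + 1)] over the infinite pairs, up to the returns to the origin
    ([drift_identity]). A return at time [n] deviates by [n * v] from the
    expected distance, therefore the returns cannot matter when the walk on
    the pair has speed [v], and the speed is the drift ([speed_from_drift],
    [speed_is_drift]).

    The speed [v] is given for the walk on one infinite tree. By bounded
    convergence the mean deviation from [n * v] is then negligible in front of [n]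
    ([vanishing_tree_error]), and this is what has to be transferred to the pair
    of trees ([pair_vanishing]). If the origin has a free slot, that is a closed
    edge to a potential child, hanging the second tree there gives a single tree
    with an absolutely continuous law ([good_free_slot]). If there is a free slot
    elsewhere, it is brought to the origin by moving along finitely many edges
    ([good_move]), and the sets of pairs on which the deviation is negligible are
    stable under countable unions ([vanishing_bigcup]). Finally an infinite tree
    almost surely has a free slot, because [p < 1] ([full_finite_null]).

    Let [theta] be the survival probability, so that
    [E (1 - p * theta) ^ xi = 1 - theta], and let [q = 1 - theta]. As [s + 1]
    branches hang around the origin, the pair is infinite with probability
    [1 - q ^ (s + 1)] given [s], which turns the identity of the speed and of the
    drift into
    [v * (1 - q ^ 2) = E ((1 - 2 / (s + 1)) * (1 - q ^ (s + 1)))].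
    By the equation of [theta] the terms of order one and two in [theta] cancel
    ([excessE]), and there remains
    [v * (2 - theta) = theta ^ 2 * E (excess q s)] ([speed_formula],
    [effective_speed_formula]), where [s] is a binomial thinning of [xi] and
    [excess q s] is a polynomial in [q], at most [s ^ 2] on the unit interval, with
    value [s * (s - 1) / 6] at [q = 1]. The equation of [theta] itself reads
    [m1 - 1 / p = p * theta * E (geom_sum (1 - p * theta) xi)]
    ([survival_relation]), with [geom_sum 1 k = k * (k - 1) / 2].

    When [p] decreases to [p_c] the left-hand side tends to [0], hence so does
    [theta], and by dominated convergence, with [xi ^ 2] as an integrable bound,
    [theta] is equivalent to [2 * m1 ^ 3 / m2 * (p - p_c)] and
    [E (excess q s)] tends to [p_c ^ 2 * m2 / 6]. Thus [v] is equivalent to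
    [theta ^ 2 / 2 * p_c ^ 2 * m2 / 6], which gives the constant
    [m1 ^ 4 / (3 * m2)]. *)

(** * Measurability through a countable observation *)

Section countable_fibers.
Context d (T : measurableType d) (C : countType) (h : T -> C).
Hypothesis mh : forall c, measurable [set t | h t = c].

Lemma measurable_fibers (E : set C) : measurable [set t | E (h t)].
Proof.
rewrite (_ : [set t | E (h t)] = \bigcup_c ([set t | h t = c] `&` [set _ | E c])).
  apply: countable_bigcupT_measurable => [|c]; first exact: countableP.
  apply: measurableI => //.
  have [Ec|Ec] := pselect (E c).
    by rewrite (_ : [set _ | _] = setT)//; apply/seteqP; split.
  by rewrite (_ : [set _ | _] = set0)//; apply/seteqP; split.
apply/seteqP; split => [t Et|t [c _ [/= <-]]//]; by exists (h t).
Qed.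

Lemma measurable_fun_fibers d' (U : measurableType d') (G : C -> T -> U) :
  (forall c, measurable_fun setT (G c)) -> measurable_fun setT (fun t => G (h t) t).
Proof.
move=> mG _ Y mY; rewrite setTI.
rewrite (_ : _ @^-1` Y = \bigcup_c ([set t | h t = c] `&` G c @^-1` Y)).
  apply: countable_bigcupT_measurable => [|c]; first exact: countableP.
  by apply: measurableI => //; rewrite -[X in measurable X]setTI; exact: mG.
apply/seteqP; split => [t Yt|t [c _ [/= <-]]//]; by exists (h t).
Qed.

Lemma ge0_integral_fibers (R : realType) (m : {measure set T -> \bar R})
    (F : T -> \bar R) :
  measurable_fun setT F -> (forall t, 0 <= F t)%E ->
  (\int[m]_t F t =
   \sum_(0 <= k <oo) \int[m]_(t in [set t | pickle (h t) = k]) F t)%E.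
Proof.
move=> mF F0.
rewrite -ge0_integral_bigcup//=; last 3 first.
- by move=> k; apply: (measurable_fibers [set c | pickle c = k]).
- exact: measurable_funS mF.
- by apply/trivIsetP => i j _ _ ij; apply/seteqP; split => // t [/= -> /eqP]; rewrite (negbTE ij).
by congr (integral _ _ _); apply/seteqP; split => // t _; exists (pickle (h t)).
Qed.

(** Two integrands are compared without any disintegration theorem, because the
    conditioning is always on a countable observation. *)
Lemma ge0_le_integral_fibers (R : realType) (m : {measure set T -> \bar R})
    (F G : T -> \bar R) :
  measurable_fun setT F -> (forall t, 0 <= F t)%E ->
  measurable_fun setT G -> (forall t, 0 <= G t)%E ->
  (forall c, \int[m]_(t in [set t | h t = c]) F t <=
             \int[m]_(t in [set t | h t = c]) G t)%E ->
  (\int[m]_t F t <= \int[m]_t G t)%E.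
Proof.
move=> mF F0 mG G0 FG; rewrite !ge0_integral_fibers//.
apply: lee_nneseries => k _ //; first by move=> _; apply: integral_ge0.
have [[c ck]|nk] := pselect (exists c, @pickle C c = k).
  rewrite (_ : [set t | pickle (h t) = k] = [set t | h t = c]) ?FG//.
  apply/seteqP; split => t /= => [|->//].
  by rewrite -ck => /(pcan_inj pickleK).
rewrite (_ : [set t | pickle (h t) = k] = set0) ?integral_set0//.
by apply/seteqP; split => // t /= e; apply: nk; exists (h t).
Qed.

Lemma eq_ge0_integral_fibers (R : realType) (m : {measure set T -> \bar R})
    (F G : T -> \bar R) :
  measurable_fun setT F -> (forall t, 0 <= F t)%E ->
  measurable_fun setT G -> (forall t, 0 <= G t)%E ->
  (forall c, \int[m]_(t in [set t | h t = c]) F t =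
             \int[m]_(t in [set t | h t = c]) G t)%E ->
  (\int[m]_t F t = \int[m]_t G t)%E.
Proof.
move=> mF F0 mG G0 FG; apply/eqP; rewrite eq_le; apply/andP; split;
by apply: ge0_le_integral_fibers => // c; rewrite FG.
Qed.

End countable_fibers.

(** * Independent marks *)

Section cylinder.
Context {I : eqType}.
Implicit Types (a : I -> bitseq) (c : seq (I * bitseq)).

Definition cylinder c : set (I -> bitseq) :=
  [set a | all (fun x => a x.1 == x.2) c].

Lemma cylinder_nil : cylinder [::] = setT.
Proof. by apply/seteqP; split. Qed.

Lemma cylinder_cat c c' : cylinder (c ++ c') = cylinder c `&` cylinder c'.
Proof. by apply/seteqP; split=> a; rewrite /cylinder/= all_cat => /andP. Qed.

Lemma cylinder_cons x c :
  cylinder (x :: c) = [set a | a x.1 = x.2] `&` cylinder c.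
Proof.
apply/seteqP; split=> a; rewrite /cylinder/=; first by case/andP=> /eqP.
by case=> -> ->; rewrite eqxx.
Qed.

(** A cylinder prescribing two marks of the same index is empty or redundant, so
    that product formulas are only needed for distinct indices. *)
Lemma cylinder_uniq c :
  cylinder c = set0 \/ exists2 c', uniq (unzip1 c') & cylinder c = cylinder c'.
Proof.
elim: c => [|x c]; first by right; exists [::].
rewrite cylinder_cons => -[->|[c' uc' ->]]; first by left; rewrite setI0.
have [xc'|xc'] := boolP (x.1 \in unzip1 c'); last first.
  by right; exists (x :: c'); rewrite ?cylinder_cons//= xc'.
have [y yc' xy] := mapP xc'; have [e|ne] := eqVneq x.2 y.2.
  right; exists c' => //; apply/setIidPr => a /allP/(_ _ yc')/= /eqP.
  by rewrite xy e.
left; apply/seteqP; split=> // a [/= ax /allP/(_ _ yc')/= /eqP].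
by rewrite -xy ax => /eqP; rewrite (negbTE ne).
Qed.

Lemma setI_closed_cylinder : setI_closed (range cylinder).
Proof.
by move=> _ _ [c _ <-] [c' _ <-]; exists (c ++ c') => //; rewrite cylinder_cat.
Qed.

End cylinder.

HB.instance Definition _ := isPointed.Build (seq bool) [::].

Definition env (I : eqType) : Type := g_sigma_algebraType (range (@cylinder I)).
HB.instance Definition _ (I : eqType) := Measurable.on (env I).

Section env.
Context {I : eqType}.

Lemma measurable_cylinder (c : seq (I * bitseq)) :
  measurable (cylinder c : set (env I)).
Proof. by apply: sub_sigma_algebra; exists c. Qed.

Lemma measurable_mark (i : I) (b : bitseq) : measurable [set a : env I | a i = b].
Proof.
rewrite (_ : [set a : env I | a i = b] = cylinder [:: (i, b)]).
  exact: measurable_cylinder.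
by rewrite cylinder_cons cylinder_nil setIT.
Qed.

Lemma measurable_env d (T : measurableType d) (f : T -> env I) :
  (forall i b, measurable [set t | f t i = b]) -> measurable_fun setT f.
Proof.
move=> mf; apply: (@measurability _ _ _ (env I) _ _ (range (@cylinder I))) => // _ [_ [c _ <-] <-].
rewrite setTI; elim: c => [|x c IH].
  by rewrite cylinder_nil preimage_setT.
by rewrite cylinder_cons preimage_setI; apply: measurableI => //; exact: mf.
Qed.

(** Cylinders are stable under intersection and generate the sigma-algebra. *)
Lemma env_measure_unique (R : realType) (m1 m2 : {measure set (env I) -> \bar R}) :
  (m1 setT < +oo)%E ->
  (forall c, uniq (unzip1 c) -> m1 (cylinder c) = m2 (cylinder c)) ->
  forall A, measurable A -> m1 A = m2 A.
Proof.
move=> m1oo m12 A mA.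
have mG : (range (@cylinder I) : set (set (env I))) `<=` measurable.
  by move=> _ [c _ <-]; exact: measurable_cylinder.
apply: (@g_sigma_algebra_measure_unique _ R (env I) _ mG (fun=> setT)) => //.
- by move=> _; exists [::] => //; exact: cylinder_nil.
- by rewrite bigcup_const.
- exact: setI_closed_cylinder.
- move=> _ [c _ <-]; have [->|[c' uc' ->]] := cylinder_uniq c; last exact: m12.
  by rewrite !measure0.
Qed.

End env.

Lemma measurable_reindex (I J : eqType) (f : J -> I) :
  measurable_fun setT (fun a : env I => (a \o f) : env J).
Proof. by apply: measurable_env => j b; exact: measurable_mark. Qed.

(** Comparing weighted images of restrictions covers both the resampling of one mark
    and the independence of a block of marks. *)
Lemma image_env_unique (R : realType) (I : eqType) d1 d2
    (T1 : measurableType d1) (T2 : measurableType d2)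
    (m1 : {measure set T1 -> \bar R}) (m2 : {measure set T2 -> \bar R})
    (D1 : set T1) (D2 : set T2) (f1 : T1 -> env I) (f2 : T2 -> env I) (k1 k2 : R) :
  measurable D1 -> measurable D2 ->
  measurable_fun setT f1 -> measurable_fun setT f2 ->
  (m1 setT < +oo)%E -> 0 <= k1 -> 0 <= k2 ->
  (forall c, uniq (unzip1 c) ->
     k1%:E * m1 (D1 `&` f1 @^-1` cylinder c) =
     k2%:E * m2 (D2 `&` f2 @^-1` cylinder c))%E ->
  forall A, measurable A ->
    (k1%:E * m1 (D1 `&` f1 @^-1` A) = k2%:E * m2 (D2 `&` f2 @^-1` A))%E.
Proof.
move=> mD1 mD2 mf1 mf2 m1oo k10 k20 m12 A mA.
pose n1 := pushforward (mscale (NngNum k10) (mrestr m1 mD1)) f1.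
pose n2 := pushforward (mscale (NngNum k20) (mrestr m2 mD2)) f2.
have e1 B : n1 B = (k1%:E * m1 (D1 `&` f1 @^-1` B))%E.
  by rewrite setIC.
have e2 B : n2 B = (k2%:E * m2 (D2 `&` f2 @^-1` B))%E.
  by rewrite setIC.
rewrite -e1 -e2; apply: env_measure_unique mA.
- rewrite [X in (X < _)%E]e1 preimage_setT setIT.
  have fD1 : m1 D1 \is a fin_num.
    rewrite ge0_fin_numE//; apply: le_lt_trans m1oo.
    by apply: le_measure; rewrite ?inE.
  by rewrite -(fineK fD1) -EFinM ltry.
- by move=> c uc; rewrite [LHS]e1 [RHS]e2; exact: m12.
Qed.

Lemma image_ge0_integral (R : realType) d d1 d2 (U : measurableType d)
    (T1 : measurableType d1) (T2 : measurableType d2)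
    (m1 : {measure set T1 -> \bar R}) (m2 : {measure set T2 -> \bar R})
    (D1 : set T1) (D2 : set T2) (f1 : T1 -> U) (f2 : T2 -> U) (k1 k2 : R)
    (F : U -> \bar R) :
  measurable D1 -> measurable D2 ->
  measurable_fun setT f1 -> measurable_fun setT f2 ->
  0 <= k1 -> 0 <= k2 ->
  (forall A, measurable A ->
    (k1%:E * m1 (D1 `&` f1 @^-1` A) = k2%:E * m2 (D2 `&` f2 @^-1` A))%E) ->
  measurable_fun setT F -> (forall a, (0 <= F a)%E) ->
  (k1%:E * \int[m1]_(x in D1) F (f1 x) = k2%:E * \int[m2]_(x in D2) F (f2 x))%E.
Proof.
move=> mD1 mD2 mf1 mf2 k10 k20 m12 mF F0.
have key d' (T : measurableType d') (m : {measure set T -> \bar R})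
    (D : set T) (mD : measurable D) (f : T -> U) (k : R) (k0 : 0 <= k) :
    measurable_fun setT f ->
    (k%:E * \int[m]_(x in D) F (f x) =
     \int[pushforward (mscale (NngNum k0) (mrestr m mD)) f]_x F x)%E.
  move=> mf; rewrite (@ge0_integral_pushforward _ _ _ _ _ f mf _ setT F)//.
  rewrite preimage_setT ge0_integral_mscale//=; last exact: measurableT_comp.
  congr (_ * _)%E; have Dc0 : mrestr m mD (~` D) = 0 by rewrite /mrestr setICl measure0.
  rewrite (ge0_negligible_integral _ _ _ _ Dc0)//; last 2 first.
  - exact: measurableC.
  - exact: measurableT_comp.
  rewrite setTD setCK; apply: eq_measure_integral => B mB BD.
  by rewrite -[RHS]/(m (B `&` D)) setIidl.
rewrite !key//; apply: eq_measure_integral => A mA _.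
by have := m12 A mA; rewrite setIC [X in _ = (_ * _ X)%E -> _]setIC => H; exact: H.
Qed.

Definition iid_env (R : realType) (I : eqType) (r : bitseq -> R)
    (m : set (env I) -> \bar R) : Prop :=
  forall c : seq (I * bitseq), uniq (unzip1 c) ->
    m (cylinder c) = (\prod_(x <- c) r x.2)%:E.

Section iid.
Context (R : realType) (r : bitseq -> R).
Local Open Scope ereal_scope.

Lemma iid_setT (I : eqType) (m : {measure set (env I) -> \bar R}) :
  iid_env r m -> m setT = 1.
Proof.
move=> /(_ [::] erefl); rewrite big_nil => <-.
by rewrite cylinder_nil.
Qed.

Lemma iid_mark (I : eqType) (m : {measure set (env I) -> \bar R}) i b :
  iid_env r m -> m [set a | a i = b] = (r b)%:E.
Proof.
move=> /(_ [:: (i, b)] erefl); rewrite big_seq1/= => <-.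
by congr (m _); rewrite cylinder_cons cylinder_nil setIT.
Qed.

Lemma iid_unique (I : eqType) (m1 m2 : {measure set (env I) -> \bar R}) A :
  iid_env r m1 -> iid_env r m2 -> measurable A -> m1 A = m2 A.
Proof.
move=> i1 i2; apply: env_measure_unique => [|c uc].
  by rewrite (iid_setT i1) ltry.
by rewrite i1 ?i2.
Qed.

Lemma iid_reindex (I J : eqType) (f : J -> I) (m : {measure set (env I) -> \bar R}) :
  injective f -> iid_env r m ->
  iid_env r (pushforward m (fun a : env I => (a \o f) : env J)).
Proof.
move=> fI im c uc; rewrite /pushforward.
rewrite (_ : _ @^-1` _ = cylinder [seq (f x.1, x.2) | x <- c]).
  rewrite im ?big_map//.
  rewrite (_ : unzip1 _ = map f (unzip1 c)) ?(map_inj_uniq fI)//.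
  by rewrite /unzip1 -!map_comp.
by apply/seteqP; split=> a; rewrite /cylinder /preimage /= all_map.
Qed.

Lemma ge0_integral_reindex (I J : eqType) (f : J -> I)
    (m : {measure set (env I) -> \bar R}) (m' : {measure set (env J) -> \bar R})
    (F : env J -> \bar R) :
  injective f -> iid_env r m -> iid_env r m' ->
  measurable_fun setT F -> (forall a, 0 <= F a) ->
  \int[m]_a F (a \o f) = \int[m']_a F a.
Proof.
move=> fI im im' mF F0.
pose phi (a : env I) : env J := a \o f.
have mphi : measurable_fun setT phi by exact: measurable_reindex.
transitivity (\int[pushforward m phi]_a F a).
  rewrite (@ge0_integral_pushforward _ _ _ _ _ phi mphi m setT F)//.
apply: eq_measure_integral => A mA _.
exact: (iid_unique (iid_reindex fI im) im' mA).
Qed.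

Definition set_mark (I : eqType) (i : I) (b : bitseq) (a : env I) : env I :=
  fun j => if j == i then b else a j.

Lemma measurable_set_mark (I : eqType) (i : I) b :
  measurable_fun setT (set_mark i b).
Proof.
apply: measurable_env => j b'; rewrite /set_mark; case: eqP => _.
  by have [->|n] := eqVneq b b'; [rewrite (_ : [set _ | _] = setT)|
    rewrite (_ : [set _ | _] = set0)] => //; apply/seteqP; split => // a /= /eqP;
    rewrite (negbTE n).
exact: measurable_mark.
Qed.

Hypothesis r0 : forall b, (0 <= r b)%R.

(** Given that the mark [i] is [b], overwriting it with [b'] gives the law given
    that it is [b'], as the other marks are independent of it. Both sides are
    multiplied out to avoid dividing by probabilities that may vanish. *)
Lemma iid_resample (I : eqType) (m : {measure set (env I) -> \bar R}) i b b' A :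
  iid_env r m -> measurable A ->
  (r b')%:E * m ([set a | a i = b] `&` set_mark i b' @^-1` A) =
  (r b)%:E * m ([set a | a i = b'] `&` A).
Proof.
move=> im mA.
have out c : uniq (unzip1 c) -> i \notin unzip1 c ->
    [/\ set_mark i b' @^-1` cylinder c = cylinder c,
    m ([set a | a i = b] `&` cylinder c) = (r b * \prod_(x <- c) r x.2)%:E &
    m ([set a | a i = b'] `&` cylinder c) = (r b' * \prod_(x <- c) r x.2)%:E].
  move=> uc ic; split.
  - apply/funext => a; rewrite /cylinder/preimage/=; congr (is_true _).
    apply: eq_in_all => x xc; rewrite /set_mark; case: (x.1 =P i) => // xi.
    by rewrite -xi (map_f fst xc) in ic.
  - by rewrite -(cylinder_cons (i, b)) im/= ?big_cons ?ic.
  - by rewrite -(cylinder_cons (i, b')) im/= ?big_cons ?ic.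
apply: (@image_env_unique _ _ _ _ _ _ _ _ _ _ _ id) => //.
- exact: measurable_mark.
- exact: measurable_mark.
- exact: measurable_set_mark.
- by rewrite (iid_setT im) ltry.
move=> c uc; rewrite preimage_id.
have [ic|ic] := boolP (i \in unzip1 c); last first.
  have [-> -> ->] := out _ uc ic.
  by rewrite -!EFinM; congr EFin; rewrite mulrCA.
have [x xc xi] := mapP ic.
have cE : cylinder c = [set a : env I | a i = x.2] `&` cylinder (rem x c).
  rewrite xi -cylinder_cons; apply/funext => a; rewrite /cylinder/=.
  by congr (is_true _); exact: perm_all (perm_to_rem xc).
have := perm_uniq (perm_map fst (perm_to_rem xc)).
rewrite [uniq _]uc/= => /esym/andP[]; rewrite -xi => ni urc.
rewrite cE preimage_setI.
have [eb|nb] := eqVneq x.2 b'.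
  rewrite (_ : set_mark i b' @^-1` [set a | a i = x.2] = setT); last first.
    by apply/seteqP; split => // a _; rewrite /preimage/set_mark/= eqxx eb.
  rewrite setTI eb setIA setIid; have [-> -> ->] := out _ urc ni.
  by rewrite -!EFinM; congr EFin; rewrite mulrCA.
rewrite (_ : set_mark i b' @^-1` [set a | a i = x.2] = set0); last first.
  apply/seteqP; split => // a; rewrite /preimage/set_mark/= eqxx => /esym/eqP.
  by rewrite (negbTE nb).
rewrite set0I setI0 setIA (_ : [set a | a i = b'] `&` _ = set0) ?set0I ?measure0 ?mule0//.
by apply/seteqP; split => // a [/= -> /esym/eqP]; rewrite (negbTE nb).
Qed.

Lemma ge0_integral_resample (I : eqType) (m : {measure set (env I) -> \bar R})
    i b b' (F : env I -> \bar R) :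
  iid_env r m -> measurable_fun setT F -> (forall a, 0 <= F a) ->
  (r b')%:E * \int[m]_(a in [set a | a i = b]) F (set_mark i b' a) =
  (r b)%:E * \int[m]_(a in [set a | a i = b']) F a.
Proof.
move=> im mF F0.
apply: (image_ge0_integral (f2 := id)) => //.
- exact: measurable_mark.
- exact: measurable_mark.
- exact: measurable_set_mark.
- by move=> A mA; exact: iid_resample.
Qed.

(** Independence of disjoint blocks: each [f k] embeds the indices [J] in [I], the
    ranges of the [f k] are disjoint and avoid the cylinder [c], so the events
    read in these blocks are independent of each other and of [c]. The blocks
    are replaced one by one by the independent copy [m']. *)
Lemma iid_blocks (I J K : eqType) (m : {measure set (env I) -> \bar R})
    (m' : {measure set (env J) -> \bar R}) (f : K -> J -> I) (A : set (env J))
    (q : R) (c : seq (I * bitseq)) (ks : seq K) :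
  iid_env r m -> iid_env r m' -> measurable A -> m' A = q%:E ->
  (forall k k' j j', f k j = f k' j' -> k = k' /\ j = j') ->
  uniq (unzip1 c) -> uniq ks ->
  (forall k j, k \in ks -> f k j \notin unzip1 c) ->
  m (cylinder c `&` [set a : env I | forall k, k \in ks -> A (a \o f k)]) =
  (\prod_(x <- c) r x.2 * q ^+ size ks)%R%:E.
Proof.
move=> im im' mA Aq fI; elim: ks c => [|k ks IH] c uc uks fc.
  rewrite mulr1 (_ : [set a | _] = setT) ?setIT ?im//.
  by apply/seteqP; split.
have mG : measurable [set a : env I | forall k, k \in ks -> A (a \o f k)].
  elim: (ks) => [|k' ks' IH'].
    by rewrite (_ : [set a | _] = setT)//; apply/seteqP; split.
  rewrite (_ : [set a | _] = [set a : env I | A (a \o f k')] `&`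
     [set a : env I | forall k, k \in ks' -> A (a \o f k)]).
    by apply: measurableI => //; rewrite -[X in measurable X]setTI; apply: measurable_reindex.
  apply/seteqP; split => a /=.
    by move=> H; split=> [|k'' k''s]; apply: H; rewrite inE ?eqxx// k''s orbT.
  by move=> [H1 H2] k''; rewrite inE => /orP[/eqP->//|]; exact: H2.
pose p := (\prod_(x <- c) r x.2 * q ^+ size ks)%R.
have q0 : (0 <= q)%R by rewrite -lee_fin -Aq.
have p0 : (0 <= p)%R.
  by rewrite mulr_ge0 ?exprn_ge0//; apply: prodr_ge0 => x _.
pose D : set (env I) := cylinder c `&` [set a : env I | forall k, k \in ks -> A (a \o f k)].
have mD : measurable D by apply: measurableI => //; exact: measurable_cylinder.
(* The block [k] restricted to [D] has law [p] times [m']: it suffices to check it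
   on the cylinders, where it is the induction hypothesis for a longer [c]. *)
have := @image_env_unique R J _ _ _ _ m m' D setT (fun a => a \o f k) id 1 p.
move=> /(_ mD measurableT (measurable_reindex (f k)) (@measurable_id _ _ _)) H.
rewrite exprSr mulrA -/p EFinM -Aq -[A in RHS](setTI A) -[in RHS](preimage_id A) -{}H//.
- rewrite mul1e; congr (m _); rewrite -setIA; congr setI; apply/seteqP; split => a /=.
    by move=> H; split=> [k' k's|]; apply: H; rewrite inE ?eqxx// k's orbT.
  by move=> [H1 H2] k'; rewrite inE => /orP[/eqP->//|]; exact: H1.
- by rewrite (iid_setT im) ltry.
move=> c' uc'; rewrite mul1e setTI preimage_id im'// -EFinM.
pose c2 := [seq (f k x.1, x.2) | x <- c'].
have uc2 : unzip1 c2 = map (f k) (unzip1 c') by rewrite /unzip1 -!map_comp.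
have -> : cylinder c `&` [set a : env I | forall k, k \in ks -> A (a \o f k)]
   `&` (fun a : env I => a \o f k) @^-1` cylinder c' =
   cylinder (c ++ c2) `&` [set a : env I | forall k, k \in ks -> A (a \o f k)].
  rewrite cylinder_cat setIAC; congr (_ `&` _ `&` _).
  by apply/funext => a; rewrite /cylinder/preimage/= /c2 all_map.
move: uks => /= /andP[kks uks].
rewrite IH//.
- by rewrite big_cat big_map/= /p mulrAC.
- rewrite /unzip1 map_cat cat_uniq -/(unzip1 c) -/(unzip1 c2) uc uc2/=.
  rewrite map_inj_uniq ?uc' ?andbT; last by move=> j j' /fI[].
  by apply/hasPn => _ /mapP[j _ ->]; apply: fc; rewrite inE eqxx.
- move=> k' j k's; rewrite /unzip1 map_cat mem_cat -/(unzip1 c) -/(unzip1 c2) uc2.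
  rewrite negb_or fc ?inE ?k's ?orbT//=; apply/negP => /mapP[j' _ /fI[kk' _]].
  by rewrite -kk' k's in kks.
Qed.

End iid.

(** * Random walk averages *)

Section walk_mean.
Context {R : realFieldType} {V : eqType}.
Implicit Types (nb : V -> seq V) (phi psi : V -> R).

Definition step_mean nb phi x := (\sum_(y <- nb x) phi y) / (size (nb x))%:R.

Fixpoint walk_mean nb n phi x : R :=
  if n is n'.+1 then step_mean nb (walk_mean nb n' phi) x else phi x.

Lemma eq_step_mean nb phi psi x :
  {in nb x, phi =1 psi} -> step_mean nb phi x = step_mean nb psi x.
Proof. by move=> e; rewrite /step_mean (eq_big_seq _ e). Qed.

Lemma walk_meanSr nb n phi x :
  walk_mean nb n.+1 phi x = walk_mean nb n (step_mean nb phi) x.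
Proof.
elim: n x => // n IH x; rewrite [in RHS]/= [in LHS]/=.
by apply: eq_step_mean => y _; exact: IH.
Qed.

Lemma walk_meanD nb n phi psi x :
  walk_mean nb n (fun y => phi y + psi y) x =
  walk_mean nb n phi x + walk_mean nb n psi x.
Proof.
elim: n x => // n IH x; rewrite /= /step_mean -mulrDl -big_split/=.
by congr (_ / _); apply: eq_bigr.
Qed.

Lemma walk_meanZ nb n k phi x :
  walk_mean nb n (fun y => k * phi y) x = k * walk_mean nb n phi x.
Proof.
elim: n x => // n IH x; rewrite /= /step_mean mulrA; congr (_ / _).
by rewrite big_distrr/=; apply: eq_bigr.
Qed.

Lemma eq_walk_mean nb n phi psi x :
  phi =1 psi -> walk_mean nb n phi x = walk_mean nb n psi x.
Proof.
by move=> e; elim: n x => //= n IH x; apply: eq_step_mean => y _.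
Qed.

(** In [n] steps the height [h] grows by at most [n]. *)
Lemma le_walk_mean_near nb (h : V -> nat) n phi psi x :
  (forall y z, z \in nb y -> (h z <= (h y).+1)%N) ->
  (forall y, (h y <= h x + n)%N -> phi y <= psi y) ->
  walk_mean nb n phi x <= walk_mean nb n psi x.
Proof.
move=> hS; elim: n x => [|n IH] x le_phi; first by apply: le_phi; rewrite addn0.
rewrite /= /step_mean ler_wpM2r ?invr_ge0// big_seq [leRHS]big_seq.
apply: ler_sum => y /hS hy; apply: IH => z hz; apply: le_phi.
by apply: leq_trans hz _; rewrite addnS -addSn leq_add2r.
Qed.

Lemma le_walk_mean nb n phi psi x :
  (forall y, phi y <= psi y) -> walk_mean nb n phi x <= walk_mean nb n psi x.
Proof. by move=> le_phi; apply: (@le_walk_mean_near _ (fun=> 0%N)). Qed.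

Lemma walk_mean_ge0 nb n phi x :
  (forall y, 0 <= phi y) -> 0 <= walk_mean nb n phi x.
Proof.
move=> phi0; elim: n x => //= n IH x.
by rewrite /step_mean mulr_ge0 ?invr_ge0// sumr_ge0.
Qed.

Lemma walk_mean_cst nb n k x :
  (forall y, nb y != [::]) -> walk_mean nb n (fun=> k) x = k.
Proof.
move=> nb0; elim: n x => //= n IH x; rewrite /step_mean.
rewrite (eq_bigr (fun=> k)) // big_const_seq count_predT iter_addr_0.
by rewrite -[k *+ _]mulr_natr mulfK// pnatr_eq0 size_eq0.
Qed.

Lemma walk_mean_cst_le nb n k x :
  0 <= k -> walk_mean nb n (fun=> k) x <= k.
Proof.
move=> k0; elim: n x => //= n IH x; rewrite /step_mean.
have [->|nb0] := eqVneq (nb x) [::]; first by rewrite big_nil mul0r.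
rewrite ler_pdivrMr ?ltr0n ?lt0n ?size_eq0// mulr_natr.
rewrite -[leRHS]iter_addr_0 -(count_predT (nb x)) -big_const_seq.
exact: ler_sum.
Qed.

End walk_mean.

(** A local isomorphism of graphs maps the walk to the walk. *)
Lemma walk_mean_morph (R : realFieldType) (V W : eqType) (f : V -> W)
    (nb : V -> seq V) (nb' : W -> seq W) n (phi : W -> R) x :
  (forall y, perm_eq (nb' (f y)) (map f (nb y))) ->
  walk_mean nb' n phi (f x) = walk_mean nb n (phi \o f) x.
Proof.
move=> fnb; elim: n x => // n IH x; rewrite /= /step_mean.
rewrite (perm_size (fnb x)) size_map (perm_big _ (fnb x)) big_map/=.
by congr (_ / _); apply: eq_bigr => y _; exact: IH.
Qed.

(** * Trees given by marks *)

(** The mark of a vertex lists its slots, one for each potential child; the slot of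
    an actual child is [true], and a [false] slot is called free. *)
Definition children (b : bitseq) : seq nat :=
  [seq i <- iota 0 (size b) | nth false b i].

Lemma mem_children b i : (i \in children b) = nth false b i.
Proof.
rewrite mem_filter mem_iota/= add0n.
by case: ltnP => [|/(nth_default false)->]; rewrite ?andbT.
Qed.

Lemma children_uniq b : uniq (children b).
Proof. exact/filter_uniq/iota_uniq. Qed.

Lemma size_children b : size (children b) = count id b.
Proof.
by rewrite size_filter -[in RHS](mkseq_nth false b) /mkseq count_map.
Qed.

Definition tree_nbrs (a : vertex -> bitseq) (x : vertex) : seq vertex :=
  (if x is _ :: u then [:: u] else [::]) ++ [seq i :: x | i <- children (a x)].

(** A vertex [(c, x)] of the pair of trees: [c] tells in which of the two trees
   the word [x] lies, and the two roots are joined by an edge. *)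
Notation vertex2 := (bool * vertex)%type.

Definition origin : vertex2 := (false, [::]).

Definition parent (z : vertex2) : vertex2 :=
  if z.2 is _ :: u then (z.1, u) else (~~ z.1, [::]).

Definition pair_nbrs (a : vertex2 -> bitseq) (z : vertex2) : seq vertex2 :=
  parent z :: [seq (z.1, i :: z.2) | i <- children (a z)].

Definition swap (z : vertex2) : vertex2 := (~~ z.1, z.2).

(** The involution exchanging the second tree with the [i]-th branch of the first
    one at the origin. *)
Definition graft (i : nat) (z : vertex2) : vertex2 :=
  match z with
  | (true, x) => (false, rcons x i)
  | (false, y :: s) => if last y s == i then (true, belast y s) else z
  | (false, [::]) => z
  end.

Lemma swapK : involutive swap. Proof. by case=> c x; rewrite /swap/= negbK. Qed.

Lemma graft_rcons i j x : graft i (false, rcons x j) =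
  if j == i then (true, x) else (false, rcons x j).
Proof. by case: x => [|y s]//=; rewrite last_rcons belast_rcons. Qed.

Lemma graftK i : involutive (graft i).
Proof.
case=> -[] x.
  by rewrite -[graft i (true, x)]/(false, rcons x i) graft_rcons eqxx.
case: (lastP x) => // {}x j; rewrite graft_rcons.
by case: eqP => [->//|/eqP/negbTE ji]; rewrite graft_rcons ji.
Qed.

Lemma size_pair_nbrs a z : size (pair_nbrs a z) = (count id (a z)).+1.
Proof. by rewrite /= size_map size_children. Qed.

Lemma pair_nbrs_swap a z :
  pair_nbrs a (swap z) = map swap (pair_nbrs (a \o swap) z).
Proof.
rewrite /pair_nbrs/= -map_comp; congr cons.
by case: z => c [].
Qed.

Lemma graft_child i k z : z != origin ->
  graft i (z.1, k :: z.2) = ((graft i z).1, k :: (graft i z).2).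
Proof. by case: z => -[] [|y s]//= _; case: ifP. Qed.

Lemma graft_parent i z : z != origin ->
  parent (graft i z) = graft i (parent z).
Proof.
case: z => -[] [|y [|y' s]]//= _; first by case: eqP.
by case: ifP.
Qed.

(** The two exchanged trees both hang from the origin, so no edge is broken; only
    the order of the neighbours of the origin changes. *)
Lemma pair_nbrs_graft a i z : i \in children (a origin) ->
  perm_eq (pair_nbrs a (graft i z)) (map (graft i) (pair_nbrs (a \o graft i) z)).
Proof.
move=> ic; have [->|zo] := eqVneq z origin; last first.
  rewrite /pair_nbrs/= graft_parent// -map_comp.
  rewrite (eq_map (g := graft i \o (fun k => (z.1, k :: z.2))))// => k.
  exact: esym (graft_child i k zo).
have inj : injective (graft i) by exact: inv_inj (graftK i).
have u b : uniq ((true, [::]) :: [seq (false, [:: k]) | k <- children b]).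
  rewrite /= map_inj_uniq ?children_uniq ?andbT; last by move=> ? ? [].
  by apply/mapP => -[].
rewrite -[graft i origin]/origin /pair_nbrs -[(a \o _) origin]/(a origin).
rewrite -[parent _]/(true, [::]) -[origin.1]/false -[origin.2]/(Nil nat).
set s := _ :: _; have us : uniq s by exact: u.
have ugs : uniq (map (graft i) s) by rewrite map_inj_uniq.
rewrite perm_sym; apply: uniq_perm => //.
apply: (uniq_min_size ugs _ _).2; last by rewrite size_map.
move=> _ /mapP[z' + ->]; rewrite {1}/s inE => /orP[/eqP->|/mapP[k kc ->]].
  by rewrite inE; apply/orP; right; apply/mapP; exists i.
rewrite [graft _ _]/=; case: eqP => _; first by rewrite mem_head.
by rewrite inE; apply/orP; right; apply/mapP; exists k.
Qed.

(** The edge from the origin along which the walk moves: to the other root, or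
    to a child of the origin.  Seen from the new position, the pair of trees is
    again a pair of trees, [a \o move m]. *)
Definition move (m : option nat) (z : vertex2) : vertex2 :=
  if m is Some i then graft i (swap z) else swap z.

Definition moves (b : bitseq) : seq (option nat) :=
  None :: [seq Some i | i <- children b].

Lemma move_inj m : injective (move m).
Proof.
case: m => [i|] /=; last exact: inv_inj swapK.
exact: inj_comp (inv_inj (graftK i)) (inv_inj swapK).
Qed.

Lemma pair_nbrs_move a m z : m \in moves (a origin) ->
  perm_eq (pair_nbrs a (move m z)) (map (move m) (pair_nbrs (a \o move m) z)).
Proof.
case: m => [i|] mo; last by rewrite pair_nbrs_swap.
have ic : i \in children (a origin).
  by move: mo; rewrite inE => /orP[//|/mapP[j jc [->]]].
apply: perm_trans (pair_nbrs_graft _ ic) _.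
by rewrite pair_nbrs_swap -map_comp.
Qed.

Lemma pair_nbrs_origin a :
  pair_nbrs a origin = [seq move m origin | m <- moves (a origin)].
Proof. by rewrite /pair_nbrs /moves/= -map_comp. Qed.

(** Why a walk seen from its new position can undo the move. *)
Lemma move_back m : move m (true, [::]) = origin.
Proof. by case: m. Qed.

(** The graph distance to the origin: the second tree is one edge further. *)
Definition dist (z : vertex2) : nat := (size z.2 + z.1)%N.

(** Where to read, in a pair of trees, the vertices of the single tree in which the
    second tree hangs from the slot [i] of the first root. *)
Definition insertion (i : nat) (x : vertex) : vertex2 := graft i (false, x).

Lemma insertion_inj i : injective (insertion i).
Proof. by move=> x y /(inv_inj (graftK i)) []. Qed.

Lemma dist_insertion i x : dist (insertion i x) = size x.
Proof.
case: (lastP x) => // {}x j; rewrite /insertion graft_rcons size_rcons.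
by case: eqP => _; rewrite /dist/= ?size_rcons; lia.
Qed.

Lemma dist_move m z : (dist (move m z) <= (dist z).+1)%N /\
  (dist z <= (dist (move m z)).+1)%N.
Proof.
case: m z => [i|] [[] x]; try by rewrite /dist/=; lia.
  by rewrite -[move _ _]/(insertion i x) dist_insertion /dist/=; lia.
by rewrite /dist/= size_rcons; lia.
Qed.

(** Filling the free slot [i] with the second tree replaces the joining edge by an
    edge to a child, hence does not change the graph around the walker. *)
Lemma pair_nbrs_insertion a (t : vertex -> bitseq) i x :
  (forall y, y != [::] -> t y = a (insertion i y)) ->
  ~~ nth false (a origin) i ->
  (forall j, nth false (t [::]) j = (j == i) || nth false (a origin) j) ->
  perm_eq (pair_nbrs a (insertion i x)) (map (insertion i) (tree_nbrs t x)).
Proof.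
move=> ta ni ti; have [->|x0] := eqVneq x [::].
  rewrite -[insertion i _]/origin /pair_nbrs /tree_nbrs cat0s -map_comp.
  rewrite -[parent _]/(true, [::]) -[origin.1]/false -[origin.2]/(Nil nat).
  rewrite perm_sym; apply: uniq_perm.
  - rewrite map_inj_uniq ?children_uniq//.
    by move=> j k /insertion_inj[].
  - rewrite /= map_inj_uniq ?children_uniq ?andbT; last by move=> ? ? [].
    by apply/mapP => -[].
  move=> z; rewrite inE; apply/mapP/orP => [[j + ->]|].
    rewrite mem_children ti => /orP[/eqP->|aj].
      by left; rewrite /insertion/= eqxx.
    have /negbTE ji : j != i by apply: contraNneq ni => <-.
    right; apply/mapP; exists j; first by rewrite mem_children.
    by rewrite /insertion/= ji.
  move=> [/eqP->|/mapP[j]].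
    by exists i; rewrite ?mem_children ?ti /insertion/= eqxx.
  rewrite mem_children => aj ->; exists j; first by rewrite mem_children ti aj orbT.
  have /negbTE ji : j != i by apply: contraNneq ni => <-.
  by rewrite /insertion/= ji.
have zo : (false, x) != origin by apply: contraNneq x0 => -[->].
rewrite /pair_nbrs /tree_nbrs {1}/insertion graft_parent// ta//.
case: x x0 ta zo => // y s _ _ zo /=; rewrite -map_comp.
rewrite (eq_map (g := insertion i \o (fun k => k :: y :: s)))// => k.
by rewrite -[RHS]/(graft i (false, k :: y :: s)) (graft_child i k zo).
Qed.

(** * Finite trees and full trees *)

Lemma measurable_fibers_set d (T : measurableType d) (C : countType) (h : T -> C)
    (P : C -> T -> Prop) :
  (forall c, measurable [set t | h t = c]) ->
  (forall c, measurable [set t | P c t]) -> measurable [set t | P (h t) t].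
Proof.
move=> mh mP; rewrite (_ : [set t | P (h t) t] =
  \bigcup_c ([set t | h t = c] `&` [set t | P c t])).
  apply: countable_bigcupT_measurable => [|c]; first exact: countableP.
  exact: measurableI.
by apply/seteqP; split => [t Pt|t [c _ [/= <-]]//]; exists (h t).
Qed.

Lemma measurable_forall_in d (T : measurableType d) (K : eqType) (s : seq K)
    (P : K -> T -> Prop) :
  (forall k, measurable [set t | P k t]) ->
  measurable [set t | forall k, k \in s -> P k t].
Proof.
move=> mP; elim: s => [|k s IH].
  by rewrite (_ : [set t | _] = setT)//; apply/seteqP; split.
rewrite (_ : [set t | _] = [set t | P k t] `&` [set t | forall k, k \in s -> P k t]).
  exact: measurableI.
apply/seteqP; split => t /=.
  by move=> H; split=> [|k' k's]; apply: H; rewrite inE ?eqxx// k's orbT.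
by move=> [H1 H2] k'; rewrite inE => /orP[/eqP->//|]; exact: H2.
Qed.

Lemma preimage_reindex_measurable (I J : eqType) (f : J -> I) (A : set (env J)) :
  measurable A -> measurable [set a : env I | A (a \o f)].
Proof.
by move=> mA; rewrite -[X in measurable X]setTI; exact: measurable_reindex.
Qed.

Lemma measurable_walk_mean (R : realType) (I : eqType)
    (F : I -> bitseq -> seq I) (phi : env I -> I -> R) n x :
  (forall y, measurable_fun setT (phi^~ y)) ->
  measurable_fun setT (fun a : env I =>
    walk_mean (fun y => F y (a y)) n (phi a) x).
Proof.
move=> mphi; elim: n x => //= n IH x.
apply: (@measurable_fun_fibers _ _ _ (fun a : env I => a x) _ _ _ (fun b a =>
  (\sum_(y <- F x b) walk_mean (fun y => F y (a y)) n (phi a) y) /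
  (size (F x b))%:R)) => [b|b]; first exact: measurable_mark.
by apply: measurable_funM => //; exact: measurable_sum.
Qed.

Section trees.
Implicit Types t : vertex -> bitseq.

Definition branch t i : vertex -> bitseq := fun v => t (rcons v i).

(** No vertex has height [n]; the root has height [0], whence [False]. *)
Fixpoint extinct n t : Prop :=
  if n is n'.+1 then forall i, i \in children (t [::]) -> extinct n' (branch t i)
  else False.

Lemma extinctS n t : extinct n t -> extinct n.+1 t.
Proof. by elim: n t => //= n IH t H i /H /IH. Qed.

Lemma extinct_le n m t : (n <= m)%N -> extinct n t -> extinct m t.
Proof. by move=> /subnK <-; elim: (m - n)%N => // k IH /IH /extinctS. Qed.

Definition finite_tree t : Prop := exists n, extinct n t.

(** Finiteness is decided by the branches at the root, as they are finitely many:
    this is the recursion behind the extinction equation. *)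
Lemma finite_treeE t : finite_tree t <->
  (forall i, i \in children (t [::]) -> finite_tree (branch t i)).
Proof.
split=> [[[|n]//= H] i it|H]; first by exists n; exact: H.
have [n Hn] : exists n, forall i, i \in children (t [::]) -> extinct n (branch t i).
  elim: (children _) H => [|i s IH] H; first by exists 0%N.
  have [n1 h1] := H i (mem_head _ _).
  have [|n2 h2] := IH; first by move=> j js; apply: H; rewrite inE js orbT.
  exists (maxn n1 n2) => j; rewrite inE => /orP[/eqP->|/h2].
    by apply: extinct_le h1; exact: leq_maxl.
  by apply: extinct_le; exact: leq_maxr.
by exists n.+1.
Qed.

(** No vertex of height less than [n] has a free slot. *)
Fixpoint full n t : Prop :=
  if n is n'.+1 then
    all id (t [::]) /\ forall i, i \in children (t [::]) -> full n' (branch t i)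
  else True.

Definition full_tree t : Prop := forall n, full n t.

Lemma full_treeE t : full_tree t <-> all id (t [::]) /\
  (forall i, i \in children (t [::]) -> full_tree (branch t i)).
Proof.
split=> [H|[t0 H] [//|n]]; last by split=> // i /H.
split=> [|i it n]; first by have [] := H 1%N.
by have [_] := H n.+1; apply.
Qed.

Lemma measurable_recursive_tree (P : bitseq -> (vertex -> bitseq) -> Prop)
    (A : set (env vertex)) : measurable A ->
  (forall b, measurable [set t : env vertex | P b t]) ->
  measurable [set t : env vertex | P (t [::]) t /\
    forall i, i \in children (t [::]) -> A (branch t i)].
Proof.
move=> mA mP; apply: (measurable_fibers_set (h := fun t : env vertex => t [::])
  (P := fun b t => P b t /\ forall i, i \in children b -> A (branch t i))).
  by move=> b; exact: measurable_mark.
move=> b; apply: (@measurableI _ (env vertex) [set t : env vertex | P b t]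
  [set t : env vertex | forall i, i \in children b -> A (branch t i)]) => //.
apply: (@measurable_forall_in _ (env vertex) _ _ (fun i t => A (branch t i))) => i.
exact: preimage_reindex_measurable.
Qed.

Lemma measurable_extinct n : measurable [set t : env vertex | extinct n t].
Proof.
elim: n => [|n IH /=].
  by rewrite (_ : [set _ | _] = set0)//; apply/seteqP; split.
have H := @measurable_recursive_tree (fun _ _ => True) _ IH.
rewrite [X in measurable X](_ : _ = [set t : env vertex | True /\
  forall i, i \in children (t [::]) -> extinct n (branch t i)]).
  apply: H => b; rewrite (_ : [set _ | _] = setT)//.
by apply/seteqP; split => t /= => [|[]].
Qed.

Lemma measurable_finite_tree : measurable [set t : env vertex | finite_tree t].
Proof.
rewrite (_ : [set _ | _] = \bigcup_n [set t : env vertex | extinct n t]).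
  by apply: bigcupT_measurable => n; exact: measurable_extinct.
by apply/seteqP; split => t [n]; exists n.
Qed.

Lemma measurable_full n : measurable [set t : env vertex | full n t].
Proof.
elim: n => [|n IH].
  by rewrite (_ : [set _ | _] = setT)//; apply/seteqP; split.
apply: (measurable_recursive_tree (P := fun b _ => all id b)) => // b.
by case: (all id b); [rewrite (_ : [set _ | _] = setT)|
  rewrite (_ : [set _ | _] = set0)] => //; apply/seteqP; split.
Qed.

Lemma measurable_full_tree : measurable [set t : env vertex | full_tree t].
Proof.
rewrite (_ : [set _ | _] = \bigcap_n [set t : env vertex | full n t]).
  by apply: bigcapT_measurable => n; exact: measurable_full.
by apply/seteqP; split => t H n; [move=> _|]; exact: H.
Qed.

End trees.

(** * Pairs of trees *)

Section pairs.
Implicit Types a : vertex2 -> bitseq.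

Definition first_tree a : vertex -> bitseq := fun v => a (false, v).
Definition second_tree a : vertex -> bitseq := fun v => a (true, v).

Definition finite_pair a : Prop :=
  finite_tree (first_tree a) /\ finite_tree (second_tree a).

Lemma branch_graft a i j : branch (first_tree (a \o graft i)) j =
  if j == i then second_tree a else branch (first_tree a) j.
Proof.
apply/funext => v; rewrite -[LHS]/(a (graft i (false, rcons v j))).
by rewrite graft_rcons; case: eqP.
Qed.

Lemma second_graft a i : second_tree (a \o graft i) = branch (first_tree a) i.
Proof. by []. Qed.

Lemma finite_pair_swap a : finite_pair (a \o swap) <-> finite_pair a.
Proof. by rewrite /finite_pair /first_tree /second_tree /=; split=> -[]. Qed.

Lemma finite_pair_graft a i : i \in children (a origin) ->
  finite_pair (a \o graft i) <-> finite_pair a.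
Proof.
move=> ic; rewrite /finite_pair second_graft !(finite_treeE (first_tree _)).
rewrite -[first_tree _ [::]]/(a origin) -[first_tree a [::]]/(a origin).
split=> -[H1 H2]; split.
- move=> j jc; have := H1 j jc; rewrite branch_graft; case: eqP => [->//|//].
- by have := H1 i ic; rewrite branch_graft eqxx.
- by move=> j jc; rewrite branch_graft; case: eqP => // _; exact: H1.
- exact: H1.
Qed.

Lemma finite_pair_move a m : m \in moves (a origin) ->
  finite_pair (a \o move m) <-> finite_pair a.
Proof.
rewrite inE; case: m => [i /orP[//|/mapP[j jc [->]]]|_].
  exact: iff_trans (finite_pair_swap (a \o graft j)) (finite_pair_graft jc).
exact: finite_pair_swap.
Qed.

Lemma measurable_finite_pair : measurable [set a : env vertex2 | finite_pair a].
Proof.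
apply: (@measurableI _ (env vertex2)
  [set a : env vertex2 | finite_tree (first_tree a)]
  [set a : env vertex2 | finite_tree (second_tree a)]).
  exact: (preimage_reindex_measurable (fun v => (false, v)) measurable_finite_tree).
exact: (preimage_reindex_measurable (fun v => (true, v)) measurable_finite_tree).
Qed.

(** Here [b] is meant to be the mark of the origin with its free slot [i] filled. *)
Definition insert_tree (i : nat) (b : bitseq) (a : env vertex2) : env vertex :=
  set_mark [::] b (a \o insertion i).

Lemma finite_insert_tree i b a :
  ~~ nth false (a origin) i ->
  (forall j, nth false b j = (j == i) || nth false (a origin) j) ->
  finite_tree (insert_tree i b a) <-> finite_pair a.
Proof.
move=> ni bi; rewrite /finite_pair finite_treeE (finite_treeE (first_tree a)).
rewrite -[first_tree a [::]]/(a origin).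
have -> : insert_tree i b a [::] = b by rewrite /insert_tree /set_mark eqxx.
have e j : branch (insert_tree i b a) j =
    if j == i then second_tree a else branch (first_tree a) j.
  rewrite -branch_graft; apply/funext => v; rewrite /branch /insert_tree /set_mark.
  by case: v.
split=> [H|[H1 H2] j].
  split=> [j|]; last by have := H i; rewrite mem_children bi eqxx e eqxx; exact.
  rewrite mem_children => aj; have := H j; rewrite mem_children bi aj orbT e.
  have /negbTE -> : j != i by apply: contraNneq ni => <-.
  exact.
rewrite mem_children bi e; case: eqP => [//|_ /= aj]; apply: H1.
by rewrite mem_children.
Qed.

End pairs.

(** * Stationarity and drift of the walk on a pair of trees *)

Lemma sume_const (R : realType) (T : Type) (s : seq T) (x : \bar R) :
  (0 <= x)%E -> (\sum_(k <- s) x = (size s)%:R%:E * x)%E.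
Proof.
move=> x0; elim: s => [|k s IH]; first by rewrite big_nil mul0e.
by rewrite big_cons IH /= -natr1 EFinD ge0_muleDl ?lee_fin// mul1e addeC.
Qed.

(** With [s] children, one neighbour out of [s + 1] is closer to the origin: the
    mean increment of the distance is [(s - 1) / (s + 1) = 1 - 2 / (s + 1)], except
    at the origin, where it is [1]. *)
Lemma pair_drift (R : realFieldType) (a : env vertex2) z :
  step_mean (pair_nbrs a) (fun y => (dist y)%:R) z + 2 / (count id (a z)).+1%:R =
   (dist z)%:R + 1 + 2 / (count id (a origin)).+1%:R * (z == origin)%:R :> R.
Proof.
rewrite /step_mean size_pair_nbrs /pair_nbrs big_cons big_map.
rewrite (eq_bigr (fun=> (dist z).+1%:R)); last first.
  by move=> i _; rewrite /dist/= addSn.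
rewrite big_const_seq count_predT iter_addr_0 size_children.
have s0 (b : bitseq) : (count id b).+1%:R != 0 :> R by rewrite pnatr_eq0.
have [->|zo] := eqVneq z origin.
  rewrite mulr1; congr (_ + _).
  rewrite [parent _]/= /dist/= !add0n -mulr_natr.
  by apply: (mulIf (s0 (a origin))); rewrite mulfVK// -natr1; ring.
rewrite mulr0 addr0.
have -> : (dist (parent z))%:R = (dist z)%:R - 1 :> R.
  have -> : dist z = (dist (parent z)).+1.
    by case: z zo => -[] [|y u] //= _; rewrite /dist/=; lia.
  by rewrite -natr1 addrK.
apply: (mulIf (s0 (a z))); rewrite mulrDl !mulfVK// -!natr1 -mulr_natr; ring.
Qed.

Section stationarity.
Context (R : realType) (r : bitseq -> R) (m : {measure set (env vertex2) -> \bar R}).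
Hypothesis im : iid_env r m.
Local Open Scope ereal_scope.

Lemma integral_mark_graft (F : env vertex2 -> \bar R) b i :
  measurable_fun setT F -> (forall a, 0 <= F a) ->
  \int[m]_(a in [set a | a origin = b]) F (a \o graft i) =
  \int[m]_(a in [set a | a origin = b]) F a.
Proof.
move=> mF F0; rewrite integral_mkcond [RHS]integral_mkcond.
pose G := F \_ [set a : env vertex2 | a origin = b].
transitivity (\int[m]_a G (a \o graft i)).
  apply: eq_integral => a _; rewrite /G /patch.
  by congr (if _ then _ else _); apply/idP/idP => /set_mem h; apply/mem_set.
apply: (ge0_integral_reindex _ im im); first exact: inv_inj (graftK i).
  by apply/(measurable_restrictT _ _).1 => //; [exact: measurable_mark|exact: measurable_funTS].
by move=> a; rewrite /G /patch; case: ifP.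
Qed.

(** The law of a pair of independent trees is invariant under one step of the
    walk: given the number of neighbours, all the branches at the origin,
    including the one behind the joining edge, are exchangeable. *)
Lemma stationary (F : env vertex2 -> \bar R) :
  measurable_fun setT F -> (forall a, 0 <= F a) ->
  \int[m]_a (((size (moves (a origin)))%:R^-1)%:E *
             \sum_(k <- moves (a origin)) F (a \o move k)) = \int[m]_a F a.
Proof.
move=> mF F0.
have mFm k : measurable_fun setT (fun a : env vertex2 => F (a \o move k)).
  exact: measurableT_comp mF (measurable_reindex _).
rewrite -(ge0_integral_reindex (inv_inj swapK) im im mF F0).
apply: (@eq_ge0_integral_fibers _ _ _ (fun a : env vertex2 => a origin)).
- by move=> b; exact: measurable_mark.
- apply: (@measurable_fun_fibers _ _ _ (fun a : env vertex2 => a origin) _ _ _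
    (fun b a => ((size (moves b))%:R^-1)%:E * \sum_(k <- moves b) F (a \o move k))).
    by move=> b; exact: measurable_mark.
  by move=> b; apply: measurable_funeM; exact: emeasurable_sum.
- by move=> a; rewrite mule_ge0 ?lee_fin ?invr_ge0 ?sume_ge0.
- exact: mFm None.
- by move=> a.
move=> b; transitivity (\int[m]_(a in [set a | a origin = b])
    (((size (moves b))%:R^-1)%:E * \sum_(k <- moves b) F (a \o move k))).
  by apply: eq_integral => a /set_mem ->.
have mb := measurable_mark origin b.
rewrite ge0_integralZl_EFin ?invr_ge0//; last 2 first.
- by move=> a _; rewrite sume_ge0.
- by apply: measurable_funTS; exact: emeasurable_sum.
rewrite ge0_integral_sum//; last by move=> k; exact: measurable_funTS.
rewrite (eq_bigr (fun=> \int[m]_(a in [set a | a origin = b]) F (a \o swap))); last first.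
  case=> [i|] _ //.
  exact: (integral_mark_graft (F := fun a => F (a \o swap)) b i (mFm None)).
have X0 : 0 <= \int[m]_(a in [set a | a origin = b]) F (a \o swap) by exact: integral_ge0.
rewrite sume_const// muleA -EFinM mulVf ?mul1e//.
by rewrite pnatr_eq0.
Qed.

Definition infinite_pair : set (env vertex2) := [set a | ~ finite_pair a].

Lemma measurable_infinite_pair : measurable infinite_pair.
Proof. by apply: measurableC; exact: measurable_finite_pair. Qed.

Lemma walk_mean_move a k n (phi : vertex2 -> R) z : k \in moves (a origin) ->
  walk_mean (pair_nbrs a) n phi (move k z) =
  walk_mean (pair_nbrs (a \o move k)) n (phi \o move k) z.
Proof. by move=> ko; apply: walk_mean_morph => y; exact: pair_nbrs_move. Qed.

Lemma measurable_pair_walk_mean (phi : env vertex2 -> vertex2 -> R) n z :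
  (forall y, measurable_fun setT (phi^~ y)) ->
  measurable_fun setT (fun a : env vertex2 => walk_mean (pair_nbrs a) n (phi a) z).
Proof.
exact: (measurable_walk_mean (fun z b => parent z ::
  [seq (z.1, i :: z.2) | i <- children b])).
Qed.

Lemma measurable_mark_fun (f : bitseq -> R) (z : vertex2) :
  measurable_fun setT (fun a : env vertex2 => f (a z)).
Proof.
apply: (@measurable_fun_fibers _ _ _ (fun a : env vertex2 => a z) _ _ _ (fun b _ => f b)).
  by move=> b; exact: measurable_mark.
by move=> b; exact: measurable_cst.
Qed.

(** By stationarity the number of neighbours at time [n] has the law that it has at
    time [0], even on the infinite pairs, which moves preserve. *)
Lemma integral_mark_walk (f : bitseq -> R) n : (forall b, 0 <= f b)%R ->
  \int[m]_(a in infinite_pair)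
     (walk_mean (pair_nbrs a) n (fun z => f (a z)) origin)%:E =
  \int[m]_(a in infinite_pair) (f (a origin))%:E.
Proof.
move=> f0; elim: n => // n IH; rewrite -IH integral_mkcond [RHS]integral_mkcond.
set F := (fun a : env vertex2 => (walk_mean (pair_nbrs a) n _ origin)%:E) \_ infinite_pair.
have mF : measurable_fun setT F.
  apply/(measurable_restrictT _ _).1; first exact: measurable_infinite_pair.
  apply/measurable_funTS/measurable_EFinP.
  apply: (measurable_pair_walk_mean (phi := fun a z => f (a z)) n origin) => z.
  exact: measurable_mark_fun.
have F0 a : 0 <= F a.
  by rewrite /F /patch; case: ifP => // _; rewrite lee_fin walk_mean_ge0.
rewrite -[RHS](stationary mF F0); apply: eq_integral => a _.
rewrite {1}/patch; case: ifPn => [/set_mem ainf|/negP ainf]; last first.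
  rewrite big_seq big1 ?mule0// => k ko; rewrite /F /patch ifN//.
  apply/negP => /set_mem H; apply: ainf; apply/mem_set => Fa; apply: H.
  by apply/(finite_pair_move ko).
rewrite /= /step_mean pair_nbrs_origin size_map big_map mulrC EFinM -sumEFin.
congr (_ * _); first by rewrite size_map /= size_map.
rewrite big_seq [RHS]big_seq; apply: eq_bigr => k ko.
rewrite /F /patch ifT; last first.
  by apply/mem_set => /(finite_pair_move ko).
by rewrite walk_mean_move.
Qed.

Definition mean_dist n := \int[m]_(a in infinite_pair)
  (walk_mean (pair_nbrs a) n (fun z => (dist z)%:R) origin)%:E.

Definition mean_returns n := \int[m]_(a in infinite_pair)
  (2 / (count id (a origin)).+1%:R *
   walk_mean (pair_nbrs a) n (fun z => (z == origin)%:R) origin)%:E.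

(** Sum of the drifts: integrate [pair_drift] along the walk and replace the mark at
    time [n] by the mark of the origin. *)
Lemma drift_identity n :
  mean_dist n.+1 + \int[m]_(a in infinite_pair) (2 / (count id (a origin)).+1%:R)%:E =
  mean_dist n + m infinite_pair + mean_returns n.
Proof.
rewrite /mean_dist /mean_returns.
have minf := measurable_infinite_pair.
have f0 b : (0 <= 2 / (count id b).+1%:R :> R)%R by rewrite divr_ge0.
rewrite -(integral_mark_walk (f := fun b => 2 / (count id b).+1%:R)%R n)//.
rewrite -[m infinite_pair]mul1e -(integral_cst m minf 1).
have mW (phi : env vertex2 -> vertex2 -> R) : (forall y, measurable_fun setT (phi^~ y)) ->
    measurable_fun infinite_pair
      (fun a : env vertex2 => (walk_mean (pair_nbrs a) n (phi a) origin)%:E).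
  move=> mphi; apply/measurable_funTS/measurable_EFinP.
  exact: measurable_pair_walk_mean.
have mJ k : measurable_fun infinite_pair
    (fun a : env vertex2 => (walk_mean (pair_nbrs a) k (fun z => (dist z)%:R) origin)%:E : \bar R).
  apply/measurable_funTS/measurable_EFinP.
  exact: (measurable_pair_walk_mean (phi := fun _ z => (dist z)%:R)).
have W0 a k (phi : vertex2 -> R) : (forall y, 0 <= phi y)%R ->
    0 <= (walk_mean (pair_nbrs a) k phi origin)%:E.
  by move=> phi0; rewrite lee_fin walk_mean_ge0.
have mret : measurable_fun infinite_pair (fun a : env vertex2 => (2 / (count id (a origin)).+1%:R *
   walk_mean (pair_nbrs a) n (fun z => (z == origin)%:R) origin)%:E : \bar R).
  apply/measurable_funTS/measurable_EFinP/measurable_funM.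
    exact: (measurable_mark_fun (fun b => 2 / (count id b).+1%:R)%R).
  exact: (measurable_pair_walk_mean (phi := fun _ z => (z == origin)%:R)).
rewrite -(ge0_integralD _ minf _ (mJ n.+1)); last 3 first.
- by move=> a _; apply: W0.
- by move=> a _; apply: W0.
- by apply: mW => y; exact: (measurable_mark_fun (fun b => 2 / (count id b).+1%:R)%R).
rewrite -(ge0_integralD _ minf _ (mJ n)); last 3 first.
- by move=> a _; apply: W0.
- by [].
- exact: measurable_cst.
rewrite -(ge0_integralD _ minf _ _ _ mret); last 3 first.
- by move=> a _; rewrite adde_ge0//; apply: W0.
- by apply: emeasurable_funD => //; exact: mJ.
- by move=> a _; rewrite lee_fin mulr_ge0 ?walk_mean_ge0.
apply: eq_integral => a _; rewrite -!EFinD; congr EFin.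
rewrite walk_meanSr -walk_meanD (eq_walk_mean _ _ _ (pair_drift R a)).
by rewrite !walk_meanD walk_mean_cst// walk_meanZ.
Qed.

End stationarity.

(** * Sets on which bounded functions vanish in mean *)

Section vanishing.
Context d (T : measurableType d) (R : realType) (m : {measure set T -> \bar R}).
Context (y : nat -> T -> R) (c : R).
Hypothesis m1 : (m setT = 1)%E.
Hypothesis my : forall n, measurable_fun setT (y n).
Hypothesis y0 : forall n t, 0 <= y n t.
Hypothesis yc : forall n t, y n t <= c.
Local Open Scope ereal_scope.

Definition vanishing (H : set T) : Prop := forall e : R, (0 < e)%R ->
  \forall n \near \oo, \int[m]_(t in H) (y n t)%:E <= e%:E.

Let mEy H n : measurable_fun H (fun t => (y n t)%:E).
Proof. exact/measurable_funTS/measurable_EFinP. Qed.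

Lemma integral_bounded_le H n : measurable H -> \int[m]_(t in H) (y n t)%:E <= c%:E * m H.
Proof.
move=> mH; rewrite -integral_cst//; apply: ge0_le_integral => //.
- by move=> t _; rewrite lee_fin.
- by move=> t _; rewrite lee_fin.
Qed.

Lemma vanishing_sub H H' : measurable H -> measurable H' -> H `<=` H' ->
  vanishing H' -> vanishing H.
Proof.
move=> mH mH' HH' van e e0; near=> n.
apply: (@le_trans _ _ (\int[m]_(t in H') (y n t)%:E)); last by near: n; exact: van.
by apply: ge0_subset_integral => // t _; rewrite lee_fin.
Unshelve. all: by end_near. Qed.

Lemma vanishing_null H : measurable H -> m H = 0 -> vanishing H.
Proof.
move=> mH mH0 e e0; near=> n; apply: le_trans (integral_bounded_le _ mH) _.
by rewrite mH0 mule0 lee_fin ltW.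
Unshelve. all: by end_near. Qed.

Lemma integral_setU_le H H' n : measurable H -> measurable H' ->
  \int[m]_(t in H `|` H') (y n t)%:E <=
  \int[m]_(t in H) (y n t)%:E + \int[m]_(t in H') (y n t)%:E.
Proof.
move=> mH mH'; have -> : H `|` H' = H `|` (H' `\` H).
  by rewrite setDE setUIr setUv setIT.
rewrite ge0_integral_setU//.
- apply: leeD2l; apply: ge0_subset_integral => //; first exact: measurableD.
  by move=> t _; rewrite lee_fin.
- exact: measurableD.
- by move=> t _; rewrite lee_fin.
- by rewrite disj_set2E setDE setICA setICr setI0.
Qed.

Lemma vanishing_setU H H' : measurable H -> measurable H' ->
  vanishing H -> vanishing H' -> vanishing (H `|` H').
Proof.
move=> mH mH' vH vH' e e0; have e20 : (0 < e / 2)%R by rewrite divr_gt0.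
near=> n; apply: le_trans (integral_setU_le _ mH mH') _.
rewrite [e in leRHS](splitr e) EFinD; apply: leeD.
  by near: n; exact: vH.
by near: n; exact: vH'.
Unshelve. all: by end_near. Qed.

(** By continuity of the measure, the sets where the bounded functions [y n]
    vanish in mean form a sigma-ideal. *)
Lemma vanishing_bigcup (H : (set T)^nat) : (forall k, measurable (H k)) ->
  (forall k, vanishing (H k)) -> vanishing (\bigcup_k H k).
Proof.
move=> mH vH; pose U K := \bigcup_(k < K) H k.
have mU K : measurable (U K) by apply: bigcup_measurable.
have vU K : vanishing (U K).
  rewrite /U; elim: K => [|K IH].
    by rewrite bigcup_mkord big_ord0; apply: vanishing_null.
  rewrite bigcup_mkord big_ord_recr/= -bigcup_mkord.
  exact: vanishing_setU (mU K) (mH K) IH (vH K).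
pose V := \bigcup_k H k; have mV : measurable V by exact: bigcupT_measurable.
have V0 : \bigcap_K (V `\` U K) = set0.
  by apply/seteqP; split => // t /[dup] /(_ 0%N I) [[k _ Hk] _] /(_ k.+1 I) [_]; case; exists k => /=.
have : m (V `\` U K) @[K --> \oo] --> m (\bigcap_K (V `\` U K)).
  apply: nonincreasing_cvg_mu.
  - apply: (@le_lt_trans _ _ (m setT)); last by rewrite m1 ltry.
    by apply: le_measure; rewrite ?inE//; exact: measurableD.
  - by move=> K; exact: measurableD.
  - by rewrite V0.
  - move=> i j ij; apply/subsetPset; apply: setDS => t [k /= ki Hk].
    by exists k => //=; exact: leq_trans ki ij.
rewrite V0 measure0 => mV0 e e0.
have c0 : (0 < `|c| + 1)%R by rewrite ltr_wpDl.
have e20 : (0 < e / 2)%R by rewrite divr_gt0.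
have [K _ /(_ K (leqnn _)) HK] : \forall K \near \oo,
    m (V `\` U K) < (e / 2 / (`|c| + 1))%:E.
  have : (0 < e / 2 / (`|c| + 1))%R by rewrite divr_gt0.
  move/(cvgr_lt _ (fine_cvg mV0)); apply: filterS => K /=; rewrite -lte_fin fineK//.
  rewrite ge0_fin_numE//; apply: (@le_lt_trans _ _ (m setT)); last by rewrite m1 ltry.
  by apply: le_measure; rewrite ?inE//; exact: measurableD.
have VE : V = U K `|` (V `\` U K).
  by rewrite setDE setUIr setUv setIT setUidr// => t [k _ Hk]; exists k.
near=> n; rewrite -/V {1}VE.
apply: le_trans (integral_setU_le _ (mU K) (measurableD mV (mU K))) _.
rewrite [e in leRHS](splitr e) EFinD; apply: leeD; first by near: n; exact: vU.
apply: le_trans (integral_bounded_le _ (measurableD mV (mU K))) _.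
apply: (@le_trans _ _ ((`|c| + 1)%:E * m (V `\` U K))).
  by apply: lee_wpmul2r => //; rewrite lee_fin (le_trans (ler_norm c))// lerDl.
apply: (@le_trans _ _ ((`|c| + 1)%:E * (e / 2 / (`|c| + 1))%:E)).
  by apply: lee_wpmul2l; [rewrite lee_fin ltW|exact: ltW].
by rewrite -EFinM mulrC divfK// gt_eqF.
Unshelve. all: by end_near. Qed.

Lemma vanishing_bigcup_countable (C : countType) (H : C -> set T) :
  (forall k, measurable (H k)) -> (forall k, vanishing (H k)) ->
  vanishing (\bigcup_k H k).
Proof.
move=> mH vH; pose G n := if @unpickle C n is Some k then H k else set0.
have -> : \bigcup_k H k = \bigcup_n G n.
  apply/seteqP; split => t [k _ Hk].
    by exists (pickle k) => //; rewrite /G pickleK.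
  by move: Hk; rewrite /G; case: unpickle => // k' Hk'; exists k'.
apply: vanishing_bigcup => n; rewrite /G; case: unpickle => //.
exact: vanishing_null.
Qed.
End vanishing.

(** * Transfer of the speed from one tree to a pair of trees *)

Section transfer.
Context (R : realType) (r : bitseq -> R) (v : R).
Context (mt : {measure set (env vertex) -> \bar R}).
Context (mp : {measure set (env vertex2) -> \bar R}).
Hypothesis r0 : forall b, 0 <= r b.
Hypothesis imt : iid_env r mt.
Hypothesis imp : iid_env r mp.

Definition pair_deviation n (a : vertex2 -> bitseq) : R :=
  walk_mean (pair_nbrs a) n (fun z => `|(dist z)%:R - n%:R * v|) origin.

Definition tree_deviation n (t : vertex -> bitseq) : R :=
  walk_mean (tree_nbrs t) n (fun x => `|(size x)%:R - n%:R * v|) [::].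

Lemma dist_pair_nbrs a y z : z \in pair_nbrs a y -> (dist z <= (dist y).+1)%N.
Proof.
rewrite inE => /orP[/eqP->|/mapP[k _ ->]]; last by rewrite /dist/=; lia.
by case: y => -[] [|k u]; rewrite /dist/=; lia.
Qed.

Lemma size_tree_nbrs t x y : y \in tree_nbrs t x -> (size y <= (size x).+1)%N.
Proof.
rewrite mem_cat => /orP[|/mapP[k _ ->]]//.
by case: x => // k x /[!inE] /eqP -> /=; rewrite ltnW.
Qed.

Lemma deviation_le (k n : nat) : (k <= n)%N ->
  `|k%:R - n%:R * v| <= n%:R * (1 + `|v|) :> R.
Proof.
move=> kn; apply: le_trans (ler_normB _ _) _.
by rewrite normrM !normr_nat mulrDr mulr1 lerD2r ler_nat.
Qed.

Lemma pair_deviation_le n a : pair_deviation n a <= n%:R * (1 + `|v|).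
Proof.
apply: le_trans (_ : walk_mean (pair_nbrs a) n (fun=> n%:R * (1 + `|v|)) origin <= _).
  apply: (le_walk_mean_near (h := dist)) => [y z|z]; first exact: dist_pair_nbrs.
  exact: deviation_le.
by apply: walk_mean_cst_le; rewrite mulr_ge0// addr_ge0.
Qed.

Lemma tree_deviation_le n t : tree_deviation n t <= n%:R * (1 + `|v|).
Proof.
apply: le_trans (_ : walk_mean (tree_nbrs t) n (fun=> n%:R * (1 + `|v|)) [::] <= _).
  apply: (le_walk_mean_near (h := size)) => [y z|z]; first exact: size_tree_nbrs.
  exact: deviation_le.
by apply: walk_mean_cst_le; rewrite mulr_ge0// addr_ge0.
Qed.

(** From the new position, the walk may come back at once to the origin, which
    is one step of the deviation seen from there. *)
Lemma pair_deviation_move n a k : k \in moves (a origin) ->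
  pair_deviation n a <=
  (count id (a (move k origin))).+1%:R * pair_deviation n.+1 (a \o move k) +
  (1 + `|v|).
Proof.
move=> ko; set D := _.+1%:R.
pose psi z : R := `|(dist z)%:R - n.+1%:R * v|.
have psi0 z : 0 <= psi z by exact: normr_ge0.
pose w := walk_mean (pair_nbrs (a \o move k)) n psi.
have w0 z : 0 <= w z by exact: walk_mean_ge0.
have backw : w (true, [::]) <= D * pair_deviation n.+1 (a \o move k).
  rewrite /pair_deviation /= /step_mean -/w size_pair_nbrs -/D mulrC divfK ?pnatr_eq0//.
  rewrite big_cons lerDl sumr_ge0//.
apply: le_trans (_ : w (true, [::]) + (1 + `|v|) <= _); last by rewrite lerD2r.
have nb0 z : pair_nbrs (a \o move k) z != [::] by [].
rewrite /pair_deviation -[X in walk_mean _ _ _ X](move_back k) walk_mean_move//.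
rewrite -(walk_mean_cst (R := R) n (1 + `|v|) (true, [::]) nb0) -walk_meanD.
apply: le_walk_mean => z /=; rewrite /psi.
have [d1 d2] := dist_move k z.
have {}d1 : (dist (move k z))%:R <= (dist z)%:R + 1 :> R by rewrite natr1 ler_nat.
have {}d2 : (dist z)%:R <= (dist (move k z))%:R + 1 :> R by rewrite natr1 ler_nat.
have d12 : `|(dist (move k z))%:R - (dist z)%:R| <= 1 :> R by rewrite ler_norml; lra.
have -> : (dist (move k z))%:R - n%:R * v =
  ((dist z)%:R - n.+1%:R * v) + (((dist (move k z))%:R - (dist z)%:R) + v) :> R.
  by rewrite -natr1; ring.
apply: le_trans (ler_normD _ _) _; rewrite lerD2l.
by apply: le_trans (ler_normD _ _) _; rewrite lerD2r.
Qed.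

(** The graph is the same, up to the labelling, on both sides. *)
Lemma pair_deviation_insert n (a : env vertex2) i b : ~~ nth false (a origin) i ->
  (forall j, nth false b j = (j == i) || nth false (a origin) j) ->
  pair_deviation n a = tree_deviation n (insert_tree i b a).
Proof.
move=> ni bi; rewrite /pair_deviation -[origin]/(insertion i [::]).
rewrite (walk_mean_morph (f := insertion i) (nb := tree_nbrs (insert_tree i b a))).
  by apply: eq_walk_mean => x /=; rewrite dist_insertion.
move=> x; apply: pair_nbrs_insertion => // y y0.
by rewrite /insert_tree /set_mark (negbTE y0).
Qed.

(** Dividing by [n.+1] rather than by [n] avoids a separate case at time [0]. *)
Definition pair_error n (a : env vertex2) : R :=
  \1_infinite_pair a * (pair_deviation n a / n.+1%:R).

Definition infinite_tree : set (env vertex) := [set t | ~ finite_tree t].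

Definition tree_error n (t : env vertex) : R :=
  \1_infinite_tree t * (tree_deviation n t / n.+1%:R).

Lemma measurable_pair_error n : measurable_fun setT (pair_error n).
Proof.
apply: measurable_funM.
  by apply: measurable_indic; exact: measurable_infinite_pair.
apply: measurable_funM => //.
exact: (measurable_pair_walk_mean (phi := fun _ z => `|(dist z)%:R - n%:R * v|)).
Qed.

Lemma measurable_tree_error n : measurable_fun setT (tree_error n).
Proof.
apply: measurable_funM.
  by apply: measurable_indic; apply: measurableC; exact: measurable_finite_tree.
apply: measurable_funM => //.
exact: (measurable_walk_mean (fun x b => (if x is _ :: u then [:: u] else [::]) ++
  [seq i :: x | i <- children b]) (phi := fun _ x => `|(size x)%:R - n%:R * v|)).
Qed.

Lemma indic01 (T : Type) (A : set T) x : (0 <= \1_A x :> R) && (\1_A x <= 1 :> R).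
Proof. by rewrite indicE; case: (_ \in _); rewrite !lexx ler01. Qed.

Lemma pair_error_ge0 n a : 0 <= pair_error n a.
Proof.
have /andP[i0 _] := indic01 infinite_pair a.
by rewrite mulr_ge0 ?divr_ge0// walk_mean_ge0.
Qed.

Lemma tree_error_ge0 n t : 0 <= tree_error n t.
Proof.
have /andP[i0 _] := indic01 infinite_tree t.
by rewrite mulr_ge0 ?divr_ge0// walk_mean_ge0.
Qed.

Let error_le (i x : R) n : 0 <= i <= 1 -> 0 <= x -> x <= n%:R * (1 + `|v|) ->
  i * (x / n.+1%:R) <= 1 + `|v|.
Proof.
move=> /andP[i0 i1] x0 xn; apply: (@le_trans _ _ (1 * (x / n.+1%:R))).
  by rewrite ler_wpM2r// divr_ge0.
rewrite mul1r ler_pdivrMr// mulrC; apply: le_trans xn _.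
by rewrite ler_wpM2r ?addr_ge0// ler_nat.
Qed.

Lemma pair_error_le n a : pair_error n a <= 1 + `|v|.
Proof.
apply: error_le; first exact: indic01.
  exact: walk_mean_ge0.
exact: pair_deviation_le.
Qed.

Lemma tree_error_le n t : tree_error n t <= 1 + `|v|.
Proof.
apply: error_le; first exact: indic01.
  exact: walk_mean_ge0.
exact: tree_deviation_le.
Qed.

Local Open Scope ereal_scope.
Let mp1 : mp setT = 1 := iid_setT imp.
Let mt1 : mt setT = 1 := iid_setT imt.

Local Notation good := (vanishing mp pair_error).

Lemma pair_error_move n a k : k \in moves (a origin) ->
  (pair_error n a <= 2 * (count id (a (move k origin))).+1%:R *
     pair_error n.+1 (a \o move k) + (1 + `|v|) / n.+1%:R)%R.
Proof.
move=> ko; rewrite /pair_error.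
have -> : \1_infinite_pair (a \o move k) = \1_infinite_pair a :> R.
  rewrite !indicE; congr (nat_of_bool _)%:R; apply/idP/idP => /set_mem H; apply/mem_set => F; apply: H.
    by apply/(finite_pair_move ko).
  by move/(finite_pair_move ko): F.
have c0 : (0 <= 1 + `|v| :> R)%R by rewrite addr_ge0.
rewrite indicE; case: (_ \in _); last by rewrite !mul0r mulr0 add0r divr_ge0.
rewrite !mul1r ler_pdivrMr// mulrDl divfK ?pnatr_eq0//.
apply: le_trans (pair_deviation_move n ko) _; rewrite lerD2r.
set D := _.+1%:R; set x := pair_deviation _ _.
have x0 : (0 <= x)%R by exact: walk_mean_ge0.
have -> : (2 * D * (x / n.+2%:R) * n.+1%:R = D * x * (2 * n.+1%:R / n.+2%:R))%R by ring.
apply: ler_peMr; first by rewrite mulr_ge0.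
by rewrite ler_pdivlMr// mul1r -natrM ler_nat; lia.
Qed.

(** If the deviations are negligible on [H], they are so on the pairs that look like
    an element of [H] after one move. The bound [pair_error_move] involves the
    number of neighbours after the move, which is unbounded; slicing according to
    this number costs nothing, by [vanishing_bigcup]. *)
Lemma good_move (H : set (env vertex2)) k : measurable H -> good H ->
  good [set a | k \in moves (a origin) /\ H (a \o move k)].
Proof.
move=> mH gH.
pose S (d : nat) : set (env vertex2) := [set a | count id (a (move k origin)) = d /\
  k \in moves (a origin) /\ H (a \o move k)].
have mHk : measurable [set a : env vertex2 | H (a \o move k)].
  exact: preimage_reindex_measurable.
have mS d : measurable (S d).
  apply: (@measurable_fibers_set _ _ _ (fun a : env vertex2 => a (move k origin))
    (fun b a => count id b = d /\ k \in moves (a origin) /\ H (a \o move k))) => b.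
    exact: measurable_mark.
  have [e|ne] := pselect (count id b = d); last first.
    by rewrite (_ : [set _ | _] = set0)//; apply/seteqP; split => // a [].
  apply: (@measurable_fibers_set _ _ _ (fun a : env vertex2 => a origin)
    (fun b' a => count id b = d /\ k \in moves b' /\ H (a \o move k))) => b'.
    exact: measurable_mark.
  have [e'|ne'] := pselect (k \in moves b'); last first.
    by rewrite (_ : [set _ | _] = set0)//; apply/seteqP; split => // a [_ []].
  rewrite (_ : [set _ | _] = [set a : env vertex2 | H (a \o move k)])//.
  by apply/seteqP; split => // a [_ []].
have -> : [set a | k \in moves (a origin) /\ H (a \o move k)] = \bigcup_d S d.
  apply/seteqP; split => [a H1|a [d _ [_]]//].
  by exists (count id (a (move k origin))).
apply: (vanishing_bigcup mp1 measurable_pair_error pair_error_ge0 pair_error_le mS) => d e e0.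
have e20 : (0 < e / 2)%R by rewrite divr_gt0.
pose D : R := (2 * d.+1%:R)%R.
have D0 : (0 < D)%R by rewrite mulr_gt0.
have mE n : measurable_fun setT (fun a => (pair_error n a)%:E).
  by apply/measurable_EFinP; exact: measurable_pair_error.
have mEk n : measurable_fun setT (fun a : env vertex2 => (pair_error n (a \o move k))%:E).
  exact: measurableT_comp (mE n) (measurable_reindex _).
have eD : (0 < e / 2 / D)%R by rewrite divr_gt0.
near=> n; have n0 : (0 < n.+1%:R :> R)%R by rewrite ltr0n.
apply: (@le_trans _ _ (\int[mp]_(a in S d)
    (D%:E * (pair_error n.+1 (a \o move k))%:E + ((1 + `|v|) / n.+1%:R)%:E))).
  apply: ge0_le_integral => //; first by move=> a _; rewrite lee_fin pair_error_ge0.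
  - exact: measurable_funTS.
  - by apply: emeasurable_funD => //; apply: measurable_funeM; exact: measurable_funTS.
  - move=> a [ad [ko _]]; rewrite -EFinM -EFinD lee_fin -/D.
    by have := pair_error_move n ko; rewrite ad.
rewrite ge0_integralD; [|exact: mS|idtac|idtac|idtac|exact: measurable_cst]; last 3 first.
- by move=> a _; rewrite -EFinM lee_fin mulr_ge0 ?pair_error_ge0 ?ltW.
- by apply: measurable_funeM; exact: measurable_funTS.
- by move=> a _; rewrite lee_fin divr_ge0// addr_ge0.
rewrite [e in leRHS](splitr e) EFinD; apply: leeD; last first.
  rewrite integral_cst//; apply: (@le_trans _ _ (((1 + `|v|) / n.+1%:R)%:E * 1)).
    apply: lee_wpmul2l; first by rewrite lee_fin divr_ge0// addr_ge0.
    by rewrite -mp1; apply: le_measure; rewrite ?inE.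
  rewrite mule1 lee_fin ler_pdivrMr// mulrC -ler_pdivrMr// ltW//.
  apply: (@lt_trans _ _ (n%:R)%R); last by rewrite ltr_nat.
  by near: n; exact: nbhs_infty_gtr.
rewrite ge0_integralZl_EFin; [|exact: mS|idtac|idtac|exact: ltW D0]; last 2 first.
- by move=> a _; rewrite lee_fin pair_error_ge0.
- exact: measurable_funTS.
have -> : (e / 2 = D * (e / 2 / D))%R by rewrite [RHS]mulrC divfK// gt_eqF.
rewrite (EFinM D (e / 2 / D)); apply: lee_wpmul2l; first by rewrite lee_fin ltW.
apply: (@le_trans _ _ (\int[mp]_(a in H) (pair_error n.+1 a)%:E)).
  rewrite integral_mkcond [leRHS]integral_mkcond.
  rewrite -(ge0_integral_reindex (F := (fun a => (pair_error n.+1 a)%:E) \_ H)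
    (@move_inj k) imp imp); last 2 first.
  - by apply/(measurable_restrictT _ _).1 => //; exact: measurable_funTS.
  - by move=> a; rewrite /patch; case: ifP => // _; rewrite lee_fin pair_error_ge0.
  apply: ge0_le_integral => //.
  - by move=> a _; rewrite /patch; case: ifP => // _; rewrite lee_fin pair_error_ge0.
  - by apply/(measurable_restrictT _ _).1 => //; exact: measurable_funTS.
  - apply: (measurableT_comp (f := (fun a => (pair_error n.+1 a)%:E) \_ H)).
      by apply/(measurable_restrictT _ _).1 => //; exact: measurable_funTS.
    exact: measurable_reindex.
  - move=> a _; rewrite /patch; case: ifPn => [/set_mem[_ [_ Ha]]|_].
      by rewrite ifT//; apply/mem_set.
    by case: ifP => // _; rewrite lee_fin pair_error_ge0.
near: n; have [N _ HN] := gH _ eD; exists N => // n Nn; apply: HN.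
exact: leq_trans Nn (leqnSn n).
Unshelve. all: by end_near. Qed.

Hypothesis r_free : forall b i, (i < size b)%N -> ~~ nth false b i ->
  r b <> 0%R -> r (set_nth false b i true) <> 0%R.
Hypothesis tree_vanishing : vanishing mt tree_error setT.

(** When the root mark of the first tree has a free slot, the second tree can be
    moved there; the resulting tree has a law absolutely continuous with respect
    to the law of one tree. *)
Lemma good_free_slot b : ~~ all id b -> good [set a | a origin = b].
Proof.
move=> /allPn[x /(nthP false)[i ib <-] ni].
have mb := measurable_mark origin b.
pose b1 := set_nth false b i true.
have b1E j : nth false b1 j = (j == i) || nth false b j.
  by rewrite /b1 nth_set_nth /=; case: eqP.
have [rb0|rb0] := pselect (r b = 0%R).
  apply: (vanishing_null measurable_pair_error pair_error_ge0 pair_error_le) => //.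
  by rewrite (iid_mark _ _ imp) rb0.
have rb1 := r_free ib ni rb0; rewrite -/b1 in rb1.
have rb1_gt0 : (0 < r b1)%R by rewrite lt_neqAle r0 andbT; apply/eqP => /esym.
have rb_gt0 : (0 < r b)%R by rewrite lt_neqAle r0 andbT; apply/eqP => /esym.
move=> e e0; have e1 : (0 < e * r b1 / r b)%R by rewrite divr_gt0// mulr_gt0.
near=> n.
pose F (t : env vertex) := (tree_error n t)%:E.
have mF : measurable_fun setT F.
  by apply/measurable_EFinP; exact: measurable_tree_error.
have F0 t : 0 <= F t by rewrite lee_fin tree_error_ge0.
pose G := (F \o set_mark [::] b1) \_ [set t : env vertex | t [::] = b].
have mt_b := measurable_mark ([::] : vertex) b.
have mFs : measurable_fun setT (F \o set_mark [::] b1).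
  by apply: measurableT_comp => //; exact: measurable_set_mark.
have mG : measurable_fun setT G.
  by apply/(measurable_restrictT _ _).1 => //; exact: measurable_funTS.
have -> : \int[mp]_(a in [set a | a origin = b]) (pair_error n a)%:E =
    \int[mt]_(t in [set t : env vertex | t [::] = b]) F (set_mark [::] b1 t).
  transitivity (\int[mt]_t G t); last by rewrite [RHS]integral_mkcond.
  rewrite integral_mkcond.
  rewrite -(ge0_integral_reindex (F := G) (@insertion_inj i) imp imt)//; last first.
    by move=> t; rewrite /G /patch; case: ifP => // _; exact: F0.
  apply: eq_integral => a _; rewrite /G /patch.
  rewrite (_ : (a \o insertion i \in _) = (a \in [set a : env vertex2 | a origin = b])); last first.
    by apply/idP/idP => /set_mem H; apply/mem_set.
  case: ifPn => // /set_mem ab; rewrite /F /= -/(insert_tree i b1 a).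
  have ni' : ~~ nth false (a origin) i by rewrite ab.
  have b1E' j : nth false b1 j = (j == i) || nth false (a origin) j by rewrite ab.
  rewrite /pair_error /tree_error (pair_deviation_insert n ni' b1E').
  congr (_ * _)%:E; rewrite !indicE; congr (nat_of_bool _)%:R.
  apply/idP/idP => /set_mem H; apply/mem_set => /= f; apply: H.
    exact/(finite_insert_tree ni' b1E').
  exact/(finite_insert_tree ni' b1E').
suff : (r b1)%:E * \int[mt]_(t in [set t : env vertex | t [::] = b])
    F (set_mark [::] b1 t) <= (r b1)%:E * e%:E.
  by rewrite lee_pmul2l// lte_fin.
rewrite (ge0_integral_resample r0 [::] b b1 imt mF F0).
apply: (@le_trans _ _ ((r b)%:E * (e * r b1 / r b)%:E)); last first.
  by rewrite -!EFinM lee_fin mulrC divfK ?gt_eqF// mulrC.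
apply: lee_wpmul2l; first by rewrite lee_fin.
apply: (@le_trans _ _ (\int[mt]_t F t)).
  by apply: ge0_subset_integral => //; exact: measurable_mark.
by rewrite /F; near: n; exact: tree_vanishing.
Unshelve. all: by end_near. Qed.

(** A free slot within distance [k] of the origin, expressed through the pairs seen
    from the neighbours so that [good_move] applies. *)
Fixpoint free_within (k : nat) : set (env vertex2) :=
  if k is k'.+1 then free_within k' `|`
    \bigcup_m [set a | m \in moves (a origin) /\ free_within k' (a \o move m)]
  else [set a | ~~ all id (a origin)].

Lemma measurable_move_set (H : set (env vertex2)) k : measurable H ->
  measurable [set a : env vertex2 | k \in moves (a origin) /\ H (a \o move k)].
Proof.
move=> mH; apply: (@measurable_fibers_set _ _ _ (fun a : env vertex2 => a origin)
    (fun b a => k \in moves b /\ H (a \o move k))) => b.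
  exact: measurable_mark.
have [e|ne] := pselect (k \in moves b); last first.
  by rewrite (_ : [set _ | _] = set0)//; apply/seteqP; split => // a [].
rewrite (_ : [set _ | _] = [set a : env vertex2 | H (a \o move k)]).
  exact: preimage_reindex_measurable.
by apply/seteqP; split => // a [].
Qed.

Lemma measurable_free_within k : measurable (free_within k).
Proof.
elim: k => [|k IH].
  apply: (measurable_fibers (h := fun a : env vertex2 => a origin) _ (fun b => ~~ all id b)).
  by move=> b; exact: measurable_mark.
apply: measurableU => //; apply: countable_bigcupT_measurable => [|m].
  exact: countableP.
exact: measurable_move_set.
Qed.

Lemma good_free_within k : good (free_within k).
Proof.
elim: k => [|k IH].
  have -> : free_within 0 = \bigcup_b [set a : env vertex2 | a origin = b /\ ~~ all id b].
    by apply/seteqP; split => [a H|a [b _ [/= <-]]//]; exists (a origin).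
  apply: (vanishing_bigcup_countable mp1 measurable_pair_error pair_error_ge0 pair_error_le).
    move=> b; case: (boolP (all id b)) => Hb.
      by rewrite (_ : [set _ | _] = set0)//; apply/seteqP; split => // a [].
    rewrite (_ : [set _ | _] = [set a : env vertex2 | a origin = b]); last first.
      by apply/seteqP; split => // a [].
    exact: measurable_mark.
  move=> b; case: (boolP (all id b)) => Hb.
    rewrite (_ : [set _ | _] = set0); last by apply/seteqP; split => // a [].
    exact: (vanishing_null measurable_pair_error pair_error_ge0 pair_error_le).
  rewrite (_ : [set _ | _] = [set a : env vertex2 | a origin = b]); last first.
    by apply/seteqP; split => // a [].
  exact: good_free_slot.
have mfw := measurable_free_within k.
apply: (vanishing_setU measurable_pair_error pair_error_ge0) => //.
  apply: countable_bigcupT_measurable => [|m]; first exact: countableP.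
  exact: measurable_move_set.
apply: (vanishing_bigcup_countable mp1 measurable_pair_error pair_error_ge0 pair_error_le).
  by move=> m; exact: measurable_move_set.
by move=> m; exact: good_move.
Qed.

(** A descent from the origin into the first tree is a sequence of moves. *)
Lemma full_first_tree a : (forall k, ~ free_within k a) -> full_tree (first_tree a).
Proof.
move=> H n; elim: n a H => //= n IH a H; split.
  by have := H 0%N; rewrite /= => /negP; rewrite negbK.
move=> i ic; apply: (IH (a \o move (Some i))) => k Hk; apply: (H k.+1); right.
exists (Some i) => //; split=> //; rewrite inE; apply/orP; right.
by apply/mapP; exists i.
Qed.

Lemma full_second_tree a : (forall k, ~ free_within k a) -> full_tree (second_tree a).
Proof.
move=> H; apply: (full_first_tree (a := a \o swap)) => k Hk.
by apply: (H k.+1); right; exists None.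
Qed.

Hypothesis full_finite : mt [set t | full_tree t /\ ~ finite_tree t] = 0.

(** An infinite pair contains an infinite tree, hence almost surely a free slot, at
    a finite distance from the origin. *)
Lemma pair_vanishing : vanishing mp pair_error infinite_pair.
Proof.
pose N c := [set a : env vertex2 | full_tree (fun v => a (c, v)) /\
  ~ finite_tree (fun v => a (c, v))].
have mN0 : measurable [set t : env vertex | full_tree t /\ ~ finite_tree t].
  apply: (@measurableI _ (env vertex) [set t : env vertex | full_tree t]
    [set t : env vertex | ~ finite_tree t]); first exact: measurable_full_tree.
  by apply: measurableC; exact: measurable_finite_tree.
have mN c : measurable (N c).
  exact: (preimage_reindex_measurable (fun v => (c, v)) mN0).
have N0 c : mp (N c) = 0.
  have ci : injective (fun v : vertex => (c, v)) by move=> x y [].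
  have := iid_unique (iid_reindex ci imp) imt mN0; rewrite full_finite => H.
  exact: H (measurable_reindex _).
have mU : measurable (\bigcup_k free_within k).
  by apply: bigcupT_measurable => k; exact: measurable_free_within.
apply: (vanishing_sub measurable_pair_error pair_error_ge0
    (H' := (\bigcup_k free_within k) `|` (N false `|` N true))).
- exact: measurable_infinite_pair.
- by apply: measurableU => //; exact: measurableU.
- move=> a infa; have [|nf] := pselect (exists k, free_within k a).
    by move=> [k Hk]; left; exists k.
  have nf' k : ~ free_within k a by move=> Hk; apply: nf; exists k.
  right; have [f1|nf1] := pselect (finite_tree (first_tree a)).
    right; split; first exact: full_second_tree.
    by move=> f2; apply: infa; split.
  by left; split=> //; exact: full_first_tree.
apply: (vanishing_setU measurable_pair_error pair_error_ge0) => //.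
- exact: measurableU.
- apply: (vanishing_bigcup mp1 measurable_pair_error pair_error_ge0 pair_error_le).
    by move=> k; exact: measurable_free_within.
  exact: good_free_within.
- apply: (vanishing_setU measurable_pair_error pair_error_ge0) => //;
  exact: (vanishing_null measurable_pair_error pair_error_ge0 pair_error_le).
Qed.
End transfer.

(** * Geometric sums and the excess of the drift *)

Section geometric.
Context {R : realFieldType}.
Implicit Types (q : R) (k : nat).

Definition geom q k : R := \sum_(j < k) q ^+ j.

Lemma geomE q k : (1 - q) * geom q k = 1 - q ^+ k.
Proof. by rewrite /geom -opprB mulNr -subrX1 opprB. Qed.

(** The remainder of order three in [1 - q] in [excessE]; the division by [k.+1]
    makes it an average of products of geometric sums, hence nonnegative. *)
Definition excess q k : R := (\sum_(j < k.+1) geom q j * geom q (k - j)) / k.+1%:R.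

(** To be integrated against the law of the number [k] of children, where [q] is the
    extinction probability: the mean of [q ^+ k] is [q], so these two terms
    disappear, and the difference between the probability [1 - q ^+ k.+1] that the
    pair is infinite and its part with weight [2 / k.+1] is the last term. *)
Lemma excessE q k : 1 - q ^+ k.+1 + q ^+ k =
  2 / k.+1%:R * (1 - q ^+ k.+1) + q + (1 - q) ^+ 3 * excess q k.
Proof.
have k0 : k.+1%:R != 0 :> R by rewrite pnatr_eq0.
have S : (1 - q) ^+ 2 * \sum_(j < k.+1) geom q j * geom q (k - j) =
    k.+1%:R * (1 + q ^+ k) - 2 * geom q k.+1.
  rewrite big_distrr/= (eq_bigr (fun j : 'I_k.+1 => (1 + q ^+ k) - (q ^+ j + q ^+ (k - j)))).
    rewrite sumrB big_const_ord iter_addr_0 big_split/= mulr_natl; congr (_ - _).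
    rewrite mulr_natl mulr2n; congr (_ + _); rewrite /geom (reindex_inj rev_ord_inj)/=.
    by apply: eq_bigr => j _; rewrite subSS subKn// -ltnS.
  move=> j _; rewrite expr2 mulrACA !geomE mulrBl !mulrBr !mul1r mulr1.
  by rewrite -exprD subnKC -1?ltnS//; ring.
have -> : (1 - q) ^+ 3 * excess q k =
    ((1 - q) * k.+1%:R * (1 + q ^+ k) - 2 * (1 - q ^+ k.+1)) / k.+1%:R.
  rewrite /excess mulrA; congr (_ / _).
  by rewrite exprS -mulrA S -geomE; ring.
rewrite exprS; field.
by rewrite addrC natr1.
Qed.

Lemma geom_ge0 q k : 0 <= q -> 0 <= geom q k.
Proof. by move=> q0; apply: sumr_ge0 => j _; exact: exprn_ge0. Qed.

Lemma excess_ge0 q k : 0 <= q -> 0 <= excess q k.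
Proof.
by move=> q0; rewrite divr_ge0// sumr_ge0// => j _; rewrite mulr_ge0 ?geom_ge0.
Qed.

Lemma geom_le q k : 0 <= q <= 1 -> geom q k <= k%:R.
Proof.
move=> /andP[q0 q1]; rewrite -[k in leRHS]card_ord -sumr_const.
by apply: ler_sum => j _; exact: exprn_ile1.
Qed.

Lemma geom_ge1 q k : 0 <= q -> (0 < k)%N -> 1 <= geom q k.
Proof.
case: k => // k q0 _; rewrite /geom big_ord_recl expr0 lerDl sumr_ge0// => j _.
exact: exprn_ge0.
Qed.

Lemma excess_le q k : 0 <= q <= 1 -> excess q k <= k%:R ^+ 2.
Proof.
move=> q01; have /andP[q0 q1] := q01; rewrite ler_pdivrMr//.
rewrite -[k.+1 in leRHS]card_ord mulr_natr -sumr_const; apply: ler_sum => j _.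
rewrite expr2; apply: ler_pM; rewrite ?geom_ge0//; apply: le_trans (geom_le _ q01) _.
  by rewrite ler_nat -ltnS.
by rewrite ler_nat leq_subr.
Qed.

Lemma excess_gt0 q k : 0 <= q -> (1 < k)%N -> 0 < excess q k.
Proof.
move=> q0 k1; rewrite divr_gt0//.
have k1' : (1 < k.+1)%N by exact: ltnW.
rewrite (bigD1 (Ordinal k1'))//= ltr_pwDl//.
  by rewrite mulr_gt0// (lt_le_trans ltr01)// geom_ge1// subn_gt0.
by rewrite sumr_ge0// => j _; rewrite mulr_ge0 ?geom_ge0.
Qed.

Lemma expr_convex (l y : R) k : 0 <= l <= 1 -> 0 <= y <= 1 ->
  (l * y + (1 - l)) ^+ k <= l * y ^+ k + (1 - l).
Proof.
move=> /andP[l0 l1] /andP[y0 y1]; elim: k => [|k IH].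
  by rewrite !expr0 mulr1 addrCA subrr addr0.
have u0 : 0 <= l * y + (1 - l) by rewrite addr_ge0 ?mulr_ge0 ?subr_ge0.
rewrite exprS; apply: le_trans (ler_wpM2l u0 IH) _.
rewrite -subr_ge0 exprS.
have -> : l * (y * y ^+ k) + (1 - l) - (l * y + (1 - l)) * (l * y ^+ k + (1 - l)) =
   l * (1 - l) * ((1 - y) * (1 - y ^+ k)) by ring.
by rewrite !mulr_ge0 ?subr_ge0// exprn_ile1.
Qed.

End geometric.

(** * The speed is the drift *)

(** The mean displacement [j n] grows by the drift [V] and by the returns [ret n].
    Returns only increase it, so [v * theta] is at least [V] and [v] is positive;
    but then a return at time [n] costs a deviation [n * v], so that [ret n] tends
    to [0] and the increments of [j], hence their averages, tend to [V]. *)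
Lemma speed_from_drift (R : realType) (j ret g : nat -> R) (v theta V : R) :
  0 < V -> 0 <= theta -> j 0%N = 0 -> (forall n, 0 <= ret n) ->
  (forall n, j n.+1 = j n + V + ret n) ->
  (forall n, `|j n - n%:R * v * theta| <= g n) ->
  (forall n, n%:R * `|v| * ret n <= 2 * g n) ->
  g n / n.+1%:R @[n --> \oo] --> 0 -> v * theta = V.
Proof.
move=> V0 th0 j0 ret0 jS jg retg g0.
have g0n n : 0 <= g n by apply: le_trans (jg n).
have jV n : n%:R * V <= j n.
  elim: n => [|n IH]; first by rewrite mul0r j0.
  by rewrite jS -natr1 mulrDl mul1r -[leLHS]addr0 lerD// lerD2r.
have g0' : 2 * (g n / n.+1%:R) @[n --> \oo] --> 0.
  by rewrite -[X in _ --> X](mulr0 2); apply: cvgM => //; exact: cvg_cst.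
have gS : g n.+1 / n.+1%:R @[n --> \oo] --> 0.
  apply: (@squeeze_cvgr _ _ _ _ (cst 0) (fun n => 2 * (g n.+1 / n.+2%:R))).
  - near=> n; rewrite /= divr_ge0//= mulrCA ler_wpM2l// ler_pdivlMr//.
    by rewrite mulrC ler_pdivrMr// -natrM ler_nat; lia.
  - exact: cvg_cst.
  - by move: g0'; rewrite -(cvg_shiftS (fun n => 2 * (g n / n.+1%:R))).
have jn : j n.+1 / n.+1%:R @[n --> \oo] --> v * theta.
  apply/cvgrPdist_le => e e0; move/cvgrPdist_le: gS => /(_ _ e0).
  apply: filterS => n; rewrite sub0r normrN ger0_norm ?divr_ge0// => /(le_trans _); apply.
  have -> : v * theta - j n.+1 / n.+1%:R = (n.+1%:R * v * theta - j n.+1) / n.+1%:R.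
    by rewrite mulrBl -mulrA mulrAC mulfV ?mul1r// pnatr_eq0.
  by rewrite normrM distrC (ger0_norm (x := _^-1)) ?invr_ge0// ler_wpM2r ?invr_ge0.
have VvT : V <= v * theta.
  apply: (cvgr_to_ge jn); near=> n.
  by rewrite ler_pdivlMr// mulrC.
have v0 : 0 < v.
  have : 0 < v * theta by exact: lt_le_trans VvT.
  by apply: contraTT; rewrite -!leNgt => v0; rewrite mulr_le0_ge0.
have ret_cvg : ret n @[n --> \oo] --> 0.
  apply: (@squeeze_cvgr _ _ _ _ (cst 0) (fun n => 2 / v * (2 * (g n / n.+1%:R)))).
  - near=> n; rewrite ret0/=.
    have n0 : (0 < n)%N by near: n; exact: nbhs_infty_gt.
    have -> : 2 / v * (2 * (g n / n.+1%:R)) = 2 * (2 * g n) / (v * n.+1%:R).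
      by field; rewrite nat1r pnatr_eq0 /= lt0r_neq0.
    rewrite ler_pdivlMr ?mulr_gt0//.
    have := retg n; rewrite (gtr0_norm v0) => H.
    apply: (@le_trans _ _ (2 * (n%:R * v * ret n))); last by rewrite ler_wpM2l.
    have -> : 2 * (n%:R * v * ret n) = ret n * (v * (2 * n%:R)) by ring.
    rewrite !ler_wpM2l ?(ltW v0)// -natrM ler_nat; lia.
  - exact: cvg_cst.
  - by rewrite -[X in _ --> X](mulr0 (2 / v)); apply: cvgM => //; exact: cvg_cst.
have incr : (fun n => V + ret n) n @[n --> \oo] --> V.
  by rewrite -[X in _ --> X]addr0; apply: cvgD => //; exact: cvg_cst.
have jn' : j n.+1 / n.+1%:R @[n --> \oo] --> V.
  have := cesaro incr; apply: cvg_trans; apply: near_eq_cvg; near=> n.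
  rewrite /arithmetic_mean /= mulrC; congr (_ / _); rewrite /series/=.
  rewrite (eq_bigr (fun k => j k.+1 - j k)) ?telescope_sumr// ?j0 ?subr0// => k _.
  by rewrite jS; ring.
exact: cvg_unique jn jn'.
Unshelve. all: by end_near. Qed.

(** * Branching *)

Section branching.
Context (R : realType) (r : bitseq -> R).
Context (mt : {measure set (env vertex) -> \bar R}).
Context (mp : {measure set (env vertex2) -> \bar R}).
Hypothesis r0 : forall b, 0 <= r b.
Hypothesis imt : iid_env r mt.
Hypothesis imp : iid_env r mp.
Local Open Scope ereal_scope.
Let mp1 : mp setT = 1 := iid_setT imp.
Let mt1 : mt setT = 1 := iid_setT imt.

Lemma measurable_root_fun (f : bitseq -> R) :
  measurable_fun setT (fun t : env vertex => (f (t [::]))%:E).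
Proof.
apply/measurable_EFinP.
apply: (@measurable_fun_fibers _ _ _ (fun t : env vertex => t [::]) _ _ _ (fun b _ => f b)).
  by move=> b; exact: measurable_mark.
by move=> b; exact: measurable_cst.
Qed.

(** The branches at the root are independent copies of the tree, independent of
    the mark of the root. *)
Lemma branching (A : set (env vertex)) (E : pred bitseq) (q : R) :
  measurable A -> mt A = q%:E ->
  mt [set t : env vertex | E (t [::]) /\ forall i, i \in children (t [::]) -> A (branch t i)] =
  \int[mt]_(t in [set t : env vertex | E (t [::])]) (q ^+ count id (t [::]))%:E.
Proof.
move=> mA Aq; have q0 : (0 <= q)%R by rewrite -lee_fin -Aq.
set S : set (env vertex) := [set t | _].
have mE : measurable [set t : env vertex | E (t [::])].
  apply: (measurable_fibers (h := fun t : env vertex => t [::]) _ (fun b => E b)).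
  by move=> b; exact: measurable_mark.
have mS : measurable S.
  apply: (measurable_recursive_tree (P := fun b _ => E b)) => // b.
  by case: (E b); [rewrite (_ : [set _ | _] = setT)|
    rewrite (_ : [set _ | _] = set0)] => //; apply/seteqP; split.
have mq : measurable_fun setT (fun t : env vertex => (q ^+ count id (t [::]))%:E).
  exact: (measurable_root_fun (fun b => q ^+ count id b)%R).
rewrite -[LHS]mul1e -integral_cst// integral_mkcond [RHS]integral_mkcond.
apply: (@eq_ge0_integral_fibers _ _ _ (fun t : env vertex => t [::])).
- by move=> b; exact: measurable_mark.
- by apply/(measurable_restrictT _ _).1.
- by move=> t; rewrite /patch; case: ifP.
- by apply/(measurable_restrictT _ _).1 => //; exact: measurable_funTS.
- by move=> t; rewrite /patch; case: ifP => // _; rewrite lee_fin exprn_ge0.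
move=> b; have mb := measurable_mark ([::] : vertex) b.
rewrite -!integral_mkcondr integral_cst; last exact: measurableI.
rewrite mul1e; have [Eb|nEb] := boolP (E b); last first.
  rewrite (_ : _ `&` S = set0) ?measure0; last first.
    by apply/seteqP; split => // t [/= tb [+ _]]; rewrite tb (negbTE nEb).
  rewrite (_ : _ `&` [set t : env vertex | E (t [::])] = set0) ?integral_set0//.
  by apply/seteqP; split => // t [/= tb]; rewrite tb (negbTE nEb).
rewrite (_ : _ `&` [set t : env vertex | E (t [::])] = [set t | t [::] = b]); last first.
  by apply/seteqP; split => [t []|t /= tb]//; split => //=; rewrite tb.
rewrite (eq_integral (cst (q ^+ count id b)%:E)); last by move=> t /set_mem /= ->.
rewrite integral_cst// (iid_mark _ _ imt).
have -> : [set t : env vertex | t [::] = b] `&` S = cylinder [:: ([::], b)] `&`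
    [set t : env vertex | forall i, i \in children b -> A (t \o (fun v => rcons v i))].
  rewrite cylinder_cons cylinder_nil setIT; apply/seteqP; split => t [/= tb].
    by rewrite /S/= tb => -[_ H]; split.
  by move=> H; split => //; rewrite /S/= tb; split.
rewrite (iid_blocks r0 imt imt mA Aq) ?children_uniq//.
- by rewrite big_seq1/= mulrC -size_children EFinM.
- move=> i i' v v' /(congr1 rev); rewrite !rev_rcons => -[-> /(congr1 rev)].
  by rewrite !revK.
- by move=> i v _; rewrite inE; case: v.
Qed.

(** Given that the origin has [s] children, the pair is finite when [s + 1]
    independent trees are, the last one being the second tree. *)
Lemma integral_infinite_pair (f : bitseq -> R) (q : R) : (forall b, (0 <= f b)%R) ->
  mt [set t : env vertex | finite_tree t] = q%:E ->
  \int[mp]_(a in infinite_pair) (f (a origin))%:E =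
  \int[mt]_t (f (t [::]) * (1 - q ^+ (count id (t [::])).+1))%:E.
Proof.
move=> f0 Aq; have mA := measurable_finite_tree.
have q0 : (0 <= q)%R by rewrite -lee_fin -Aq.
have q1 : (q <= 1)%R.
  by rewrite -lee_fin -Aq -mt1; apply: le_measure; rewrite ?inE.
have minf := measurable_infinite_pair.
pose g b := (f b * (1 - q ^+ (count id b).+1))%R.
have g0 b : (0 <= g b)%R by rewrite mulr_ge0// subr_ge0 exprn_ile1.
have mg : measurable_fun setT (fun a : env vertex2 => (g (a origin))%:E).
  by apply/measurable_EFinP; exact: measurable_mark_fun.
have mf : measurable_fun setT (fun a : env vertex2 => (f (a origin))%:E).
  by apply/measurable_EFinP; exact: measurable_mark_fun.
have ci : injective (fun v : vertex => (false, v)) by move=> x y [].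
rewrite -(ge0_integral_reindex (F := fun t : env vertex => (g (t [::]))%:E) ci imp imt).
- rewrite integral_mkcond; apply: (@eq_ge0_integral_fibers _ _ _ (fun a : env vertex2 => a origin)).
  + by move=> b; exact: measurable_mark.
  + by apply/(measurable_restrictT _ _).1 => //; exact: measurable_funTS.
  + by move=> a; rewrite /patch; case: ifP => // _; rewrite lee_fin.
  + exact: mg.
  + by move=> a; rewrite lee_fin.
  move=> b; have mb := measurable_mark origin b.
  rewrite -integral_mkcondr.
  rewrite (eq_integral (cst (f b)%:E)); last by move=> a /set_mem [/= ->].
  rewrite integral_cst; last exact: measurableI.
  rewrite [RHS](eq_integral (cst (g b)%:E)); last first.
    by move=> a /set_mem /= ab; rewrite /= -/origin ab.
  rewrite integral_cst// (iid_mark _ _ imp) /g EFinM -muleA; congr (_ * _).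
  have -> : [set a : env vertex2 | a origin = b] `&` infinite_pair =
      [set a : env vertex2 | a origin = b] `\` [set a | finite_pair a] by rewrite setDE.
  have mb_fin : mp [set a | a origin = b] < +oo by rewrite (iid_mark _ _ imp) ltry.
  have -> : mp ([set a : env vertex2 | a origin = b] `\` [set a | finite_pair a]) =
      (r b)%:E - mp ([set a : env vertex2 | a origin = b] `&` [set a | finite_pair a]).
    rewrite -(iid_mark origin b imp).
    exact: (measureD mb measurable_finite_pair mb_fin).
  pose h (k : option nat) (v : vertex) : vertex2 :=
    if k is Some i then (false, rcons v i) else (true, v).
  have -> : [set a : env vertex2 | a origin = b] `&` [set a | finite_pair a] =
      cylinder [:: (origin, b)] `&` [set a : env vertex2 |
        forall k, k \in moves b -> finite_tree (a \o h k)].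
    rewrite cylinder_cons cylinder_nil setIT; apply/seteqP; split => a [/= ab].
      move=> [/finite_treeE H1 H2]; split => // -[i|]; last by [].
      rewrite inE => /orP[//|/mapP[j jb [->]]].
      by apply: (H1 j); rewrite -[first_tree a [::]]/(a origin) ab.
    move=> H; split => //; split; last exact: (H None).
    apply/finite_treeE => i; rewrite -[first_tree a [::]]/(a origin) ab => ib.
    by apply: (H (Some i)); rewrite inE; apply/orP; right; apply/mapP; exists i.
  rewrite (iid_blocks r0 imp imt mA Aq)//.
  + rewrite big_seq1/= size_map size_children -EFinB -EFinM; congr EFin.
    by ring.
  + move=> [i|] [i'|] v v' //= [].
      move=> /(congr1 rev); rewrite !rev_rcons => -[-> /(congr1 rev)].
      by rewrite !revK.
    by move=> ->.
  + rewrite /= map_inj_uniq ?children_uniq ?andbT; last by move=> ? ? [].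
    by apply/mapP => -[].
  + by move=> [i|] v _; rewrite inE //; case: v.
- exact: (measurable_root_fun g).
- by move=> t; rewrite lee_fin.
Qed.


Lemma fine_mt (A : set (env vertex)) : measurable A -> mt A = (fine (mt A))%:E.
Proof.
move=> mA; rewrite fineK// ge0_fin_numE//; apply: (@le_lt_trans _ _ (mt setT)).
  by apply: le_measure; rewrite ?inE.
by rewrite mt1 ltry.
Qed.

(** The probabilities [x] that a tree has no free slot and [y] that moreover it is
    finite are fixed points of the same power series: the sum over the marks
    without free slot. This series is convex and its value at [1] is less than [1],
    so it has only one fixed point in the unit interval. *)
Lemma full_finite_null : (exists2 b, ~~ all id b & r b <> 0%R) ->
  mt [set t : env vertex | full_tree t /\ ~ finite_tree t] = 0.
Proof.
move=> [b0 nb0 rb0].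
have rb0_gt0 : (0 < r b0)%R by rewrite lt_neqAle r0 andbT; apply/eqP => /esym.
pose E : set (env vertex) := [set t | all id (t [::])].
have mE : measurable E.
  apply: (measurable_fibers (h := fun t : env vertex => t [::]) _ (fun b => all id b)).
  by move=> b; exact: measurable_mark.
pose X : set (env vertex) := [set t | full_tree t].
have mX : measurable X by exact: measurable_full_tree.
pose Y : set (env vertex) := X `&` [set t | finite_tree t].
have mY : measurable Y by apply: measurableI => //; exact: measurable_finite_tree.
pose x := fine (mt X); pose y := fine (mt Y); pose P := fine (mt E).
have Xx : mt X = x%:E by exact: fine_mt.
have Yy : mt Y = y%:E by exact: fine_mt.
have EP : mt E = P%:E by exact: fine_mt.
have x_fix : \int[mt]_(t in E) (x ^+ count id (t [::]))%:E = x%:E.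
  rewrite -(branching (all id) mX Xx) -Xx; congr (mt _).
  by apply/seteqP; split => t /full_treeE.
have y_fix : \int[mt]_(t in E) (y ^+ count id (t [::]))%:E = y%:E.
  rewrite -(branching (all id) mY Yy) -Yy; congr (mt _).
  apply/seteqP; split => t /=.
    move=> [t0 H]; split; first by apply/full_treeE; split => // i /H[].
    by apply/finite_treeE => i /H[].
  move=> [/full_treeE[t0 H] /finite_treeE H']; split => // i ti.
  by split; [exact: H|exact: H'].
have P1 : (P < 1)%R.
  have : mt E + mt [set t | t [::] = b0] <= 1.
    rewrite -measureU//; last 2 first.
    - exact: measurable_mark.
    - by apply/seteqP; split => // t [/= + tb]; rewrite /E/= tb (negbTE nb0).
    rewrite -mt1; apply: le_measure; rewrite ?inE//.
    by apply: measurableU => //; exact: measurable_mark.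
  rewrite EP (iid_mark _ _ imt) -EFinD lee_fin => H.
  by apply: lt_le_trans H; rewrite ltrDl.
have xP : (x <= P)%R.
  rewrite -lee_fin -Xx -EP; apply: le_measure; rewrite ?inE// => t /full_treeE[].
  by [].
have y0 : (0 <= y)%R by rewrite -lee_fin -Yy.
have yx : (y <= x)%R.
  by rewrite -lee_fin -Xx -Yy; apply: le_measure; rewrite ?inE//; exact: subIsetl.
suff xy : (x <= y)%R.
  have -> : [set t : env vertex | full_tree t /\ ~ finite_tree t] = X `\` Y.
    apply/seteqP; split => t /= [tX]; first by move=> nf; split => // -[].
    by move=> nY; split => // tf; apply: nY.
  have XY : X `&` Y = Y by apply/setIidPr; exact: subIsetl.
  have -> : mt (X `\` Y) = mt X - mt (X `&` Y) by apply: measureD => //; rewrite [X in X < _]Xx ltry.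
  by rewrite XY Xx Yy -EFinB (le_anti (introT andP (conj xy yx))) subrr.
rewrite leNgt; apply/negP => ltyx.
have x1 : (x < 1)%R by exact: le_lt_trans P1.
have y1 : (y < 1)%R by exact: lt_trans x1.
(* If [y < x < 1], then [x] is a barycentre of the fixed point [y] and of [1], where
   the series is below the diagonal: convexity contradicts [x] being fixed. *)
pose l := ((1 - x) / (1 - y))%R.
have l0 : (0 <= l)%R by rewrite divr_ge0 ?subr_ge0 ?ltW.
have l1 : (l <= 1)%R by rewrite ler_pdivrMr ?subr_gt0// mul1r lerD2l lerN2 ltW.
have xl : x = (l * y + (1 - l))%R.
  rewrite /l; field; rewrite subr_eq0; apply/eqP => e; by rewrite e ltxx in y1.
have mf z : measurable_fun E (fun t : env vertex => (z ^+ count id (t [::]))%:E : \bar R).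
  by apply: measurable_funTS; exact: (measurable_root_fun (fun b => z ^+ count id b)%R).
have : x%:E <= (l * y + (1 - l) * P)%:E.
  rewrite -x_fix.
  apply: (@le_trans _ _ (\int[mt]_(t in E) (l%:E * (y ^+ count id (t [::]))%:E + (1 - l)%:E))).
    apply: ge0_le_integral => //.
    - by move=> t _; rewrite lee_fin exprn_ge0// (le_trans y0).
    - by apply: emeasurable_funD => //; exact: measurable_funeM.
    - move=> t _; rewrite -EFinM -EFinD lee_fin {1}xl.
      by apply: expr_convex; rewrite ?l0 ?l1 ?y0 ?ltW.
  rewrite ge0_integralD; [|exact: mE|idtac|idtac|idtac|exact: measurable_cst]; last 3 first.
  - by move=> t _; rewrite -EFinM lee_fin mulr_ge0// exprn_ge0.
  - exact: measurable_funeM.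
  - by move=> t _; rewrite lee_fin subr_ge0.
  rewrite ge0_integralZl_EFin//; last by move=> t _; rewrite lee_fin exprn_ge0.
  by rewrite y_fix integral_cst// EP -!EFinM -EFinD.
rewrite lee_fin {1}xl lerD2l => H.
have l1' : (l < 1)%R.
  by rewrite ltr_pdivrMr ?subr_gt0// mul1r ltrD2l ltrN2.
have : (0 < (1 - l) * (1 - P))%R by rewrite mulr_gt0 ?subr_gt0.
by rewrite mulrBr mulr1 subr_gt0 ltNge H.
Qed.

End branching.

(** * The speed as a function of the extinction probability *)

Section speed_formula.
Context (R : realType) (r : bitseq -> R) (v : R).
Context (mt : {measure set (env vertex) -> \bar R}).
Context (mp : {measure set (env vertex2) -> \bar R}).
Hypothesis r0 : forall b, 0 <= r b.
Hypothesis imt : iid_env r mt.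
Hypothesis imp : iid_env r mp.
Hypothesis r_free : forall b i, (i < size b)%N -> ~~ nth false b i ->
  r b <> 0 -> r (set_nth false b i true) <> 0.
Hypothesis r_not_full : exists2 b, ~~ all id b & r b <> 0.
Hypothesis v0 : 0 <= v.
Hypothesis tree_vanishing : vanishing mt (tree_error v) setT.
Local Open Scope ereal_scope.
Let mp1 : mp setT = 1 := iid_setT imp.
Let mt1 : mt setT = 1 := iid_setT imt.
Let minf : measurable infinite_pair := measurable_infinite_pair.

Let I n (phi : vertex2 -> R) : \bar R := \int[mp]_(a in infinite_pair)
  (walk_mean (pair_nbrs a) n phi origin)%:E.

Let mW n phi : measurable_fun infinite_pair
  (fun a : env vertex2 => (walk_mean (pair_nbrs a) n phi origin)%:E : \bar R).
Proof.
apply/measurable_funTS/measurable_EFinP.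
exact: (measurable_pair_walk_mean (phi := fun _ => phi)).
Qed.

Let I_ge0 n phi : (forall z, (0 <= phi z)%R) -> 0 <= I n phi.
Proof. by move=> p0; apply: integral_ge0 => a _; rewrite lee_fin walk_mean_ge0. Qed.

Let I_D n phi psi : (forall z, (0 <= phi z)%R) -> (forall z, (0 <= psi z)%R) ->
  I n (fun z => phi z + psi z)%R = I n phi + I n psi.
Proof.
move=> p0 q0; rewrite /I -ge0_integralD//.
- by apply: eq_integral => a _; rewrite walk_meanD.
- by move=> a _; rewrite lee_fin walk_mean_ge0.
- by move=> a _; rewrite lee_fin walk_mean_ge0.
Qed.

Let I_le n phi psi : (forall z, (0 <= phi z)%R) -> (forall z, (phi z <= psi z)%R) ->
  I n phi <= I n psi.
Proof.
move=> p0 pq; apply: ge0_le_integral => //.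
- by move=> a _; rewrite lee_fin walk_mean_ge0.
- by move=> a _; rewrite lee_fin le_walk_mean.
Qed.

Let I_cst n k : (0 <= k)%R -> I n (fun=> k) = k%:E * mp infinite_pair.
Proof.
move=> k0; rewrite -integral_cst//; apply: eq_integral => a _.
by rewrite walk_mean_cst.
Qed.

Let I_Z n k phi : (0 <= k)%R -> (forall z, (0 <= phi z)%R) ->
  I n (fun z => k * phi z)%R = k%:E * I n phi.
Proof.
move=> k0 p0; rewrite /I -ge0_integralZl_EFin//.
- by apply: eq_integral => a _; rewrite walk_meanZ.
- by move=> a _; rewrite lee_fin walk_mean_ge0.
Qed.

Let Theta := mp infinite_pair.
Let kappa := \int[mp]_(a in infinite_pair) (2 / (count id (a origin)).+1%:R)%:E.
Let g n := I n (fun z => `|(dist z)%:R - n%:R * v|)%R.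

Let Theta1 : Theta <= 1.
Proof. by rewrite /Theta -mp1; apply: le_measure; rewrite ?inE. Qed.

Let g_vanish : vanishing mp (pair_error v) infinite_pair.
Proof.
apply: (pair_vanishing r0 imt imp r_free tree_vanishing).
exact: (full_finite_null r0 imt r_not_full).
Qed.

Let gE n : \int[mp]_(a in infinite_pair) (pair_error v n a)%:E = (n.+1%:R^-1)%:E * g n.
Proof.
rewrite /g -ge0_integralZl_EFin//; last by move=> a _; rewrite lee_fin walk_mean_ge0.
apply: eq_integral => a ainf.
by rewrite /pair_error indicE ainf mul1r -EFinM mulrC.
Qed.

Let fin_le (x : \bar R) (k : R) : 0 <= x -> x <= k%:E -> x = (fine x)%:E.
Proof.
by move=> x0 xk; rewrite fineK// ge0_fin_numE//; apply: le_lt_trans xk (ltry _).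
Qed.

Let bounded_fin (f : env vertex2 -> R) (k : R) : (forall a, (0 <= f a <= k)%R) ->
  measurable_fun setT f ->
  0 <= \int[mp]_(a in infinite_pair) (f a)%:E <= k%:E.
Proof.
move=> f01 mf; have f0 a : 0 <= (f a)%:E by rewrite lee_fin; case/andP: (f01 a).
have k0 : (0 <= k)%R by case/andP: (f01 point) => /le_trans H /H.
apply/andP; split; first by apply: integral_ge0.
apply: (@le_trans _ _ (k%:E * mp infinite_pair)); last first.
  by rewrite -[leRHS]mule1; apply: lee_wpmul2l => //; rewrite lee_fin.
rewrite -integral_cst//; apply: ge0_le_integral => //.
  by apply/measurable_funTS/measurable_EFinP.
by move=> a _; rewrite lee_fin; case/andP: (f01 a).
Qed.

Let g_bound n : 0 <= g n <= (n%:R * (1 + `|v|))%:E.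
Proof.
apply: bounded_fin => [a|].
  by rewrite walk_mean_ge0//; exact: pair_deviation_le.
exact: (measurable_pair_walk_mean (phi := fun _ z => `|(dist z)%:R - n%:R * v|)%R).
Qed.

Let J_le n : mean_dist mp n <= (n%:R * v)%:E * Theta + g n.
Proof.
rewrite -[_ * Theta](I_cst n) ?mulr_ge0// -I_D//; last by move=> _; rewrite mulr_ge0.
apply: I_le => // z; rewrite -lerBlDl; exact: ler_norm.
Qed.

Let le_J n : (n%:R * v)%:E * Theta <= mean_dist mp n + g n.
Proof.
rewrite -[_ * Theta](I_cst n) ?mulr_ge0// -I_D//.
apply: I_le => [_|z]; first by rewrite mulr_ge0.
by rewrite -lerBlDl distrC; exact: ler_norm.
Qed.

(** A return to the origin at time [n] is a deviation [n * v]. *)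
Let return_le n : (n%:R * v)%:E * mean_returns mp n <= 2%:E * g n.
Proof.
have nv0 : (0 <= n%:R * v)%R by rewrite mulr_ge0.
apply: (@le_trans _ _ (2%:E * ((n%:R * v)%:E * I n (fun z => (z == origin)%:R)))).
  rewrite muleCA; apply: lee_wpmul2l; first by rewrite lee_fin.
  rewrite -ge0_integralZl_EFin//; last by move=> a _; rewrite lee_fin walk_mean_ge0.
  apply: ge0_le_integral => //.
  - by move=> a _; rewrite lee_fin mulr_ge0 ?walk_mean_ge0.
  - apply/measurable_funTS/measurable_EFinP/measurable_funM.
      exact: (measurable_mark_fun (fun b => 2 / (count id b).+1%:R)%R).
    exact: (measurable_pair_walk_mean (phi := fun _ z => (z == origin)%:R)).
  - exact: measurable_funeM.
  - move=> a _; rewrite -EFinM lee_fin ler_wpM2r ?walk_mean_ge0//.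
    by rewrite ler_pdivrMr// ler_peMr// ler1n.
apply: lee_wpmul2l; first by rewrite lee_fin.
rewrite -I_Z//; apply: I_le => z; first by rewrite mulr_ge0.
have [->|_] := eqVneq z origin; last by rewrite mulr0.
by rewrite mulr1 /dist/= sub0r normrN ler_norm.
Qed.

(** The condition [kappa < Theta] says that the drift is positive; it excludes that
    the walk keeps returning. *)
Lemma speed_is_drift : kappa < Theta -> v%:E * Theta + kappa = Theta.
Proof.
move=> kT; have T0 : 0 <= Theta by exact: measure_ge0.
have TE : Theta = (fine Theta)%:E by exact: (fin_le (k := 1%R) T0 Theta1).
have k01 : 0 <= kappa <= 2%:E.
  apply: bounded_fin => [a|].
    by rewrite divr_ge0//= ler_pdivrMr// ler_peMr// ler1n.
  exact: (measurable_mark_fun (fun b => 2 / (count id b).+1%:R)%R).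
have kE : kappa = (fine kappa)%:E by have /andP[? /fin_le] := k01; apply.
have gfin n : g n = (fine (g n))%:E by have /andP[? /fin_le] := g_bound n; apply.
have J0 n : 0 <= mean_dist mp n by exact: I_ge0.
have JE n : mean_dist mp n = (fine (mean_dist mp n))%:E.
  apply: (fin_le (k := n%:R * v * fine Theta + fine (g n))%R) => //.
  by have := J_le n; rewrite {1}TE {1}gfin -EFinM -EFinD.
have r02 n : 0 <= mean_returns mp n <= 2%:E.
  apply: bounded_fin => [a|].
    rewrite mulr_ge0 ?walk_mean_ge0//= -[leRHS]mulr1 ler_pM ?walk_mean_ge0//.
      by rewrite ler_pdivrMr// ler_peMr// ler1n.
    apply: le_trans (walk_mean_cst_le (pair_nbrs a) n origin ler01).
    by apply: le_walk_mean => z; case: eqP.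
  apply: measurable_funM.
    exact: (measurable_mark_fun (fun b => 2 / (count id b).+1%:R)%R).
  exact: (measurable_pair_walk_mean (phi := fun _ z => (z == origin)%:R)).
have retE n : mean_returns mp n = (fine (mean_returns mp n))%:E.
  by have /andP[? /fin_le] := r02 n; apply.
have key : (v * fine Theta = fine Theta - fine kappa)%R.
  apply: (@speed_from_drift R (fun n => fine (mean_dist mp n))
    (fun n => fine (mean_returns mp n)) (fun n => fine (g n))).
  - by move: kT; rewrite {1}TE {1}kE lte_fin subr_gt0.
  - by rewrite -lee_fin -TE.
  - rewrite /mean_dist integral0_eq// => a _.
  - by move=> n; rewrite -lee_fin -retE; case/andP: (r02 n).
  - move=> n; have := drift_identity imp n; rewrite -/Theta -/kappa.
    rewrite {1}JE (JE n) {1}kE {1}TE {1}retE -!EFinD => -[H].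
    by apply: (addIr (fine kappa)); rewrite H; ring.
  - move=> n; have := le_J n; have := J_le n.
    rewrite (JE n) (gfin n) TE -!EFinM -!EFinD !lee_fin => H1 H2.
    by rewrite ler_norml; apply/andP; split; rewrite ?lerBrDr ?lerBlDl// addrC lerBlDr.
  - move=> n; rewrite (ger0_norm v0) -lee_fin !EFinM -retE -gfin -EFinM; exact: return_le.
  - apply/cvgrPdist_le => e e0; have := g_vanish e0; apply: filterS => n.
    rewrite gE gfin -EFinM lee_fin sub0r normrN ger0_norm; first by rewrite mulrC.
    by rewrite divr_ge0// -lee_fin -gfin; case/andP: (g_bound n).
by rewrite TE kE -EFinM -EFinD key subrK.
Qed.

Let q := fine (mt [set t : env vertex | finite_tree t]).
Let Aq : mt [set t : env vertex | finite_tree t] = q%:E.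
Proof. exact: (fine_mt imt measurable_finite_tree). Qed.

Lemma extinction_fixpoint : \int[mt]_t (q ^+ count id (t [::]))%:E = q%:E.
Proof.
rewrite -[RHS]Aq.
have := branching r0 imt predT measurable_finite_tree Aq.
rewrite (_ : [set t : env vertex | predT (t [::])] = setT); last by apply/seteqP; split.
move=> <-; congr (mt _); apply/seteqP; split => t /=.
  by move=> [_ H]; apply/finite_treeE.
by move=> /finite_treeE H; split => // i ti; exact: H.
Qed.

Let q01 : (0 <= q <= 1)%R.
Proof.
by rewrite -!lee_fin -Aq measure_ge0 -mt1 le_measure ?inE//; exact: measurable_finite_tree.
Qed.

Let mroot (f : bitseq -> R) : measurable_fun setT (fun t : env vertex => (f (t [::]))%:E) :=
  measurable_root_fun f.

Let E := \int[mt]_t (excess q (count id (t [::])))%:E.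

(** As [q ^+ s] has mean [q], the mean of [1 - q ^+ (s + 1)] is [1 - q ^+ 2]. *)
Lemma survival_pair : Theta = (1 - q ^+ 2)%:E.
Proof.
have /andP[q0 q1] := q01.
have -> : Theta = \int[mt]_t (1 * (1 - q ^+ (count id (t [::])).+1))%:E.
  rewrite -(integral_infinite_pair r0 imt imp (f := fun=> 1%R))// integral_cst//.
  by rewrite mul1e.
suff : \int[mt]_t (1 * (1 - q ^+ (count id (t [::])).+1))%:E + (q ^+ 2)%:E = 1.
  by move=> H; rewrite EFinB -H addeK.
have -> : (q ^+ 2)%:E = \int[mt]_t (q%:E * (q ^+ count id (t [::]))%:E).
  rewrite ge0_integralZl_EFin//; last 2 first.
  - by move=> t _; rewrite lee_fin exprn_ge0.
  - exact: (mroot (fun b => q ^+ count id b)%R).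
  by rewrite extinction_fixpoint -EFinM.
rewrite -ge0_integralD//; last 4 first.
- by move=> t _; rewrite lee_fin mul1r subr_ge0 exprn_ile1.
- exact: (mroot (fun b => 1 * (1 - q ^+ (count id b).+1))%R).
- by move=> t _; rewrite -EFinM lee_fin mulr_ge0// exprn_ge0.
- by apply: measurable_funeM; exact: (mroot (fun b => q ^+ count id b)%R).
rewrite (eq_integral (cst 1)) ?integral_cst ?mul1e// => t _.
by rewrite -EFinM -EFinD mul1r -exprS subrK.
Qed.

Lemma drift_excess : Theta = kappa + ((1 - q) ^+ 3)%:E * E.
Proof.
have /andP[q0 q1] := q01.
have q1' : (0 <= 1 - q)%R by rewrite subr_ge0.
have -> : kappa = \int[mt]_t (2 / (count id (t [::])).+1%:R *
    (1 - q ^+ (count id (t [::])).+1))%:E.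
  by rewrite -(integral_infinite_pair r0 imt imp (f := fun b => 2 / (count id b).+1%:R)%R).
have -> : Theta = \int[mt]_t (1 - q ^+ (count id (t [::])).+1)%:E.
  rewrite -[in LHS](mul1e Theta) -(integral_cst mp minf).
  rewrite (integral_infinite_pair r0 imt imp (f := fun=> 1%R) _ Aq)//.
  by apply: eq_integral => t _; rewrite mul1r.
have m1 := mroot (fun b => 1 - q ^+ (count id b).+1)%R.
have m2 := mroot (fun b => 2 / (count id b).+1%:R * (1 - q ^+ (count id b).+1))%R.
have m3 := mroot (fun b => excess q (count id b)).
have m4 := mroot (fun b => q ^+ count id b)%R.
have p1 k : (0 <= 1 - q ^+ k)%R by rewrite subr_ge0 exprn_ile1.
rewrite -[LHS](@addeK _ q%:E)// -[RHS](@addeK _ q%:E)//; congr (_ - _).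
rewrite -[in LHS]extinction_fixpoint -[q%:E in RHS]mule1 -mt1 -(integral_cst mt measurableT q%:E).
rewrite /E -ge0_integralZl_EFin//; last 2 first.
- by move=> t _; rewrite lee_fin excess_ge0.
- by rewrite exprn_ge0.
have p2 (t : env vertex) : 0 <= (2 / (count id (t [::])).+1%:R * (1 - q ^+ (count id (t [::])).+1))%:E.
  by rewrite lee_fin mulr_ge0.
have p3 (t : env vertex) : 0 <= ((1 - q) ^+ 3)%:E * (excess q (count id (t [::])))%:E.
  by rewrite -EFinM lee_fin mulr_ge0 ?exprn_ge0 ?excess_ge0.
have m3' : measurable_fun setT (fun t : env vertex => ((1 - q) ^+ 3)%:E * (excess q (count id (t [::])))%:E).
  exact: measurable_funeM.
rewrite -(ge0_integralD mt measurableT (fun t _ => p2 t) m2 (fun t _ => p3 t) m3').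
rewrite -ge0_integralD//; last 2 first.
- by move=> t _; rewrite lee_fin.
- by move=> t _; rewrite lee_fin exprn_ge0.
rewrite -ge0_integralD//; last 2 first.
- by move=> t _; rewrite adde_ge0.
- exact: emeasurable_funD.
apply: eq_integral => t _; rewrite -!EFinM -!EFinD; congr EFin.
by rewrite excessE addrAC.
Qed.

(** Both sides of the identity of the speed and of the drift are divisible by
    [1 - q]. The drift is finite, being at most the mass of the infinite pairs. *)
Lemma speed_formula : (q < 1)%R -> 0 < E ->
  (v * (1 + q) = (1 - q) ^+ 2 * fine E)%R.
Proof.
move=> q1 E0; have q1' : (0 < 1 - q)%R by rewrite subr_gt0.
have de := drift_excess; have sp := survival_pair.
have k0 : 0 <= kappa by apply: integral_ge0 => a _; rewrite lee_fin divr_ge0.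
have Efin : E \is a fin_num.
  rewrite ge0_fin_numE ?(ltW E0)// ltNge leye_eq; apply/negP => /eqP Eoo.
  move: de; rewrite sp Eoo gt0_muley ?lte_fin ?exprn_gt0// addey//.
  by rewrite gt_eqF// (lt_le_trans _ k0).
have kfin : kappa = (fine kappa)%:E.
  apply: (fin_le (k := (1 - q ^+ 2)%R)) => //; rewrite -sp de leeDl// mule_ge0 ?ltW//.
  by rewrite lte_fin exprn_gt0.
have kT : kappa < Theta.
  rewrite de kfin -(fineK Efin) -EFinM -EFinD lte_fin ltrDl mulr_gt0 ?exprn_gt0//.
  by rewrite -lte_fin fineK.
have := speed_is_drift kT; rewrite {2}de sp kfin -(fineK Efin) -!EFinM -!EFinD => -[H].
have : ((1 - q) * (v * (1 + q)) = (1 - q) * ((1 - q) ^+ 2 * fine E))%R.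
  apply: (addIr (fine kappa)); transitivity (v * (1 - q ^+ 2) + fine kappa)%R; first by ring.
  by rewrite H; ring.
by apply: mulfI; rewrite gt_eqF.
Qed.
End speed_formula.

(** * The marks of the percolated tree *)

Lemma pushforward_measure d1 d2 (T1 : measurableType d1) (T2 : measurableType d2)
    (R : realType) (m : {measure set T1 -> \bar R}) (f : T1 -> T2) :
  measurable_fun setT f ->
  exists m' : {measure set T2 -> \bar R}, m' = pushforward m f :> (set T2 -> \bar R).
Proof.
by move=> mf; refine (ex_intro _ _ (erefl (pushforward m f))); exact: mf.
Qed.

Section environment.
Context d (Omega : measurableType d) (R : realType) (P : probability Omega R).
Context (mu : probability nat R) (p : R).
Context (N : vertex -> {RV P >-> nat}) (B : vertex -> {RV P >-> bool}).
Hypothesis p01 : 0 <= p <= 1.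
Hypothesis gw : gw_percolation mu p N B.

(** The slots of a vertex are its children before percolation, and a slot is free
    when its edge is deleted. *)
Definition environment (omega : Omega) : env vertex :=
  fun u => [seq B (i :: u) omega | i <- iota 0 (N u omega)].

(** The law of the offspring together with the states of the edges below it. *)
Definition mark_law (b : bitseq) : R :=
  fine (mu [set size b]) * \prod_(x <- b) (if x then p else 1 - p).

Lemma mark_law_ge0 b : 0 <= mark_law b.
Proof.
have /andP[p0 p1] := p01; rewrite mulr_ge0 ?fine_ge0//.
by apply: prodr_ge0 => -[] _; rewrite ?subr_ge0.
Qed.

Lemma environmentP omega u b : environment omega u = b <->
  N u omega = size b /\ forall i, (i < size b)%N -> B (i :: u) omega = nth false b i.
Proof.
split=> [<-|[Nb Bb]].
  rewrite size_map size_iota; split => // i iN.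
  by rewrite (nth_map 0%N) ?size_iota// nth_iota.
apply: (@eq_from_nth _ false); first by rewrite size_map size_iota.
move=> i; rewrite size_map size_iota => iN.
by rewrite (nth_map 0%N) ?size_iota// nth_iota// Bb// -Nb.
Qed.

Lemma measurable_N u n : measurable [set omega | N u omega = n].
Proof.
rewrite -[X in measurable X]setTI.
exact: (measurable_funP (N u) measurableT [set n]).
Qed.

Lemma measurable_B u b : measurable [set omega | B u omega = b].
Proof.
rewrite -[X in measurable X]setTI.
exact: (measurable_funP (B u) measurableT [set b]).
Qed.

Lemma measurable_environment : measurable_fun setT environment.
Proof.
apply: measurable_env => u b.
rewrite (_ : [set _ | _] = [set omega | N u omega = size b] `&`
    [set omega | forall i, i \in iota 0 (size b) -> B (i :: u) omega = nth false b i]).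
  apply: measurableI; first exact: measurable_N.
  by apply: (@measurable_forall_in _ Omega nat _ (fun i omega => B (i :: u) omega = nth false b i)) => i; exact: measurable_B.
apply/seteqP; split => omega /=.
  by move=> /environmentP[Nb Bb]; split => // i; rewrite mem_iota => /andP[_]; exact: Bb.
move=> [Nb Bb]; apply/environmentP; split => // i ib.
by apply: Bb; rewrite mem_iota.
Qed.

Lemma P_N u n : P [set omega | N u omega = n] = mu [set n].
Proof. by have [/(_ u) <- _ _] := gw. Qed.

Lemma P_B u b : P [set omega | B u omega = b] = (if b then p else 1 - p)%:E.
Proof.
have [_ /(_ u) H _] := gw.
have -> : P [set omega | B u omega = b] = bernoulli_prob p [set b] by rewrite -H.
rewrite bernoulli_probE// !diracE; case: b.
  by rewrite mem_set// memNset// mule1 mule0 adde0.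
by rewrite memNset// mem_set// mule1 mule0 add0e.
Qed.

(** The marks of distinct vertices involve disjoint sets of offspring numbers and
    edges. *)
Lemma iid_environment : iid_env mark_law (pushforward P environment).
Proof.
move=> c uc; pose b u := nth [::] (unzip2 c) (index u (unzip1 c)).
have bE x : x \in c -> b x.1 = x.2.
  move=> xc; rewrite /b -[x in RHS](nth_index ([::], [::]) xc).
  have ic : (index x c < size c)%N by rewrite index_mem.
  rewrite -(nth_map _ [::])//; congr nth.
  have -> : x.1 = nth [::] (unzip1 c) (index x c).
    by rewrite (nth_map ([::], [::]))// nth_index.
  by rewrite index_uniq// size_map.
pose E (k : vertex + vertex) : set Omega := match k with
  | inl u => [set omega | N u omega = size (b u)]
  | inr (i :: u) => [set omega | B (i :: u) omega = nth false (b u) i]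
  | inr [::] => setT
  end.
pose s : seq (vertex + vertex) := [seq inl u | u <- unzip1 c] ++
  [seq inr (i :: u) | u <- unzip1 c, i <- iota 0 (size (b u))].
have us : uniq s.
  rewrite cat_uniq map_inj_uniq ?uc/=; last by move=> ? ? [].
  apply/andP; split.
    by apply/hasPn => _ /allpairsPdep[u [i [_ _ ->]]]; apply/mapP => -[].
  apply: allpairs_uniq_dep => //; first by move=> u _; exact: iota_uniq.
  by move=> /= [u i] [u' i'] _ _ /= [-> ->].
have [_ _ /(_ s E us)] := gw.
have Es k : k \in s -> (match k with
    | inl u => preimage_set_system setT (N u) measurable
    | inr u => preimage_set_system setT (B u) measurable end) (E k).
  rewrite mem_cat => /orP[/mapP[u _ ->]|/allpairsPdep[u [i [_ _ ->]]]].
    by exists [set size (b u)] => //; rewrite setTI.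
  by exists [set nth false (b u) i] => //; rewrite setTI.
move=> /(_ Es); rewrite big_cat big_map/= big_allpairs_dep/= => H.
rewrite /pushforward; have -> : environment @^-1` cylinder c =
    \bigcap_(k in [set` s]) E k.
  apply/seteqP; split => omega /=.
    move=> /allP H1 k; rewrite /= mem_cat => /orP[/mapP[u /mapP[x xc ->] ->]|
      /allpairsPdep[u [i [/mapP[x xc ->] + ->]]]].
      by have /eqP/environmentP[+ _] := H1 x xc; rewrite /E/= bE.
    have /eqP/environmentP[_] := H1 x xc; rewrite bE// mem_iota => H2 /andP[_ ib].
    by rewrite /E/= bE//; exact: H2.
  move=> H1; apply/allP => x xc; apply/eqP/environmentP.
  have xk : x.1 \in unzip1 c by exact: map_f.
  rewrite -(bE x xc); split.
    by have := H1 (inl x.1); apply; rewrite /= mem_cat map_f.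
  move=> i ib; have := H1 (inr (i :: x.1)); apply.
  rewrite /= mem_cat; apply/orP; right; apply/allpairsPdep.
  by exists x.1, i; rewrite mem_iota.
rewrite H -big_split/= big_map -prodEFin big_seq [RHS]big_seq.
apply: eq_bigr => x xc.
have -> : P (E (inl x.1)) = mu [set size x.2] by rewrite -(bE x xc); exact: P_N.
rewrite /mark_law EFinM fineK ?fin_num_measure//; congr (_ * _)%E.
rewrite (big_nth false) -prodEFin /index_iota subn0 (bE x xc).
by apply: eq_bigr => i _; rewrite -(bE x xc); exact: P_B.
Qed.

(** * The law of the walk on the percolated tree *)

Fixpoint in_tree (a : vertex -> bitseq) (x : vertex) : bool :=
  if x is i :: u then in_tree a u && nth false (a u) i else true.

Lemma nth_environment omega u i :
  nth false (environment omega u) i = (i < N u omega)%N && B (i :: u) omega.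
Proof.
rewrite /environment; case: ltnP => iN.
  by rewrite (nth_map 0%N) ?size_iota// nth_iota.
by rewrite nth_default// size_map size_iota.
Qed.

Section quenched.
Variable omega : Omega.
Local Notation e := (open_edge (N ^~ omega) (B ^~ omega)).
Local Notation a := (environment omega).

Lemma in_tree_gw x : in_tree a x -> gw_tree (N ^~ omega) x.
Proof.
by elim: x => //= i u IH /andP[/IH ->]; rewrite nth_environment => /andP[->].
Qed.

Lemma open_edge_nbrs x z : in_tree a x -> e x z = (z \in tree_nbrs a x).
Proof.
move=> tx; rewrite /open_edge /tree_nbrs mem_cat orbC; congr (_ || _).
  case: x tx => [|i u] /=; first by rewrite in_nil.
  move=> /andP[tu]; rewrite nth_environment => /andP[iN ->].
  by rewrite (in_tree_gw tu) iN !andbT inE eq_sym.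
apply/idP/mapP => [|[i]].
  case: z => [|i z]; first by rewrite andFb.
  case/and3P => /eqP-> /= /andP[_ iN] Bi; exists i => //.
  by rewrite mem_children nth_environment iN.
rewrite mem_children nth_environment => /andP[iN Bi] ->.
by rewrite /= eqxx (in_tree_gw tx) iN Bi.
Qed.

Lemma in_tree_nbrs x z : in_tree a x -> z \in tree_nbrs a x -> in_tree a z.
Proof.
move=> tx; rewrite mem_cat => /orP[|/mapP[i]].
  by case: x tx => // i u /= /andP[tu _]; rewrite inE => /eqP->.
by rewrite mem_children => ai -> /=; rewrite tx.
Qed.

Lemma percolated_treeE : percolated_tree (N ^~ omega) (B ^~ omega) = [set x | in_tree a x].
Proof.
apply/seteqP; split => x /=.
  move=> [s ps ->] {x}; have : in_tree a Defs.root by [].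
  elim: s Defs.root ps => //= y s IH x /andP[xy ys] tx.
  by apply: IH => //; apply: (in_tree_nbrs tx); rewrite -open_edge_nbrs.
elim: x => [_|i u IH /= /andP[tu iu]]; first by exists [::].
have [s ps us] := IH tu; exists (rcons s (i :: u)); last by rewrite last_rcons.
rewrite rcons_path ps -us open_edge_nbrs// mem_cat; apply/orP; right.
by apply/mapP; exists i => //; rewrite mem_children.
Qed.

Lemma tree_nbrs_uniq x : uniq (tree_nbrs a x).
Proof.
rewrite /tree_nbrs cat_uniq map_inj_uniq ?children_uniq; last by move=> ? ? [].
case: x => [|i u]//=; rewrite ?andbT; first by apply/hasPn => ? ?; rewrite in_nil.
apply/hasPn => _ /mapP[j _ ->]; rewrite inE; apply/eqP => /(congr1 size)/eqP.
by rewrite /= (gtn_eqF (leqW (leqnn _))).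
Qed.

Lemma srw_stepE x z : in_tree a x ->
  srw_step R e x z = if z \in tree_nbrs a x then (size (tree_nbrs a x))%:R^-1 else 0.
Proof.
move=> tx; rewrite /srw_step open_edge_nbrs//; case: ifP => // _.
have -> : [set z | e x z] = [set` [fset y in tree_nbrs a x]%fset].
  by apply/seteqP; split => y; rewrite /= in_fset/= open_edge_nbrs.
by rewrite set_fsetK card_fseq undup_id// tree_nbrs_uniq.
Qed.

Section walk_law.
Context d' (W : measurableType d') (Q : {measure set W -> \bar R}) (X : nat -> W -> vertex).
Hypothesis mX : forall n x, measurable (X n @^-1` [set x]).
Hypothesis srw : simple_random_walk e Defs.root Q X.
Hypothesis nbrs0 : forall x, in_tree a x -> tree_nbrs a x != [::].
Local Open Scope ereal_scope.

Let cyl k (x : nat -> vertex) : set W := [set w | forall i, (i <= k)%N -> X i w = x i].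

Let mcyl k x : measurable (cyl k x).
Proof.
rewrite (_ : cyl k x = [set w | forall i, i \in iota 0 k.+1 -> X i w = x i]).
  by apply: (@measurable_forall_in _ W nat _ (fun i w => X i w = x i)) => i; exact: mX.
by apply/seteqP; split => w H i; have := H i; rewrite mem_iota add0n ltnS.
Qed.

Let extend k (x : nat -> vertex) y i := if i == k.+1 then y else x i.

Let cyl_extend k x y : cyl k.+1 (extend k x y) = cyl k x `&` [set w | X k.+1 w = y].
Proof.
apply/seteqP; split => w /=.
  move=> H; split => [i ik|].
    by have := H i (leq_trans ik (leqnSn k)); rewrite /extend ltn_eqF.
  by have := H k.+1 (leqnn _); rewrite /extend eqxx.
move=> [H Xy] i; rewrite leq_eqVlt /extend => /orP[/eqP->|]; first by rewrite eqxx.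
by move=> ik; rewrite ltn_eqF//; exact: H.
Qed.

Let Q_extend k x y : in_tree a (x k) -> y \in tree_nbrs a (x k) ->
  Q (cyl k.+1 (extend k x y)) = Q (cyl k x) * (size (tree_nbrs a (x k)))%:R^-1%:E.
Proof.
move=> tx yx; rewrite /cyl !srw -EFinM; congr EFin.
rewrite big_ord_recr/= mulrA; congr (_ * _ * _)%R.
- apply: eq_bigr => i _; rewrite /extend !ltn_eqF//; first exact: ltn_ord.
  exact: ltnW (ltn_ord i).
- by rewrite /extend eqxx ltn_eqF// srw_stepE// yx.
Qed.

Let mphi (phi : vertex -> R) n : measurable_fun setT (fun w => (phi (X n w))%:E).
Proof.
apply/measurable_EFinP.
by apply: (@measurable_fun_fibers _ _ _ (X n) _ _ _ (fun x _ => phi x)) => x; [exact: mX|exact: measurable_cst].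
Qed.

(* Markov property: the cylinder of the trajectories that follow [x] up to time [k]
   splits according to the position at time [k.+1]. Trajectories which do not move
   to a neighbour form a null set, the masses of the others adding up to the mass
   of the cylinder. *)
Let integral_cyl (phi : vertex -> R) n k x : (forall y, (0 <= phi y)%R) -> in_tree a (x k) ->
  \int[Q]_(w in cyl k x) (phi (X (k + n)%N w))%:E =
  Q (cyl k x) * (walk_mean (tree_nbrs a) n phi (x k))%:E.
Proof.
move=> phi0; elim: n k x => [|n IH] k x tx.
  rewrite (eq_integral (cst (phi (x k))%:E)) ?integral_cst//; first by rewrite muleC.
  by move=> w /set_mem H; rewrite addn0 (H k).
set D := size (tree_nbrs a (x k)).
have D0 : D%:R != 0%R :> R by rewrite pnatr_eq0 size_eq0 nbrs0.
pose F y := cyl k.+1 (extend k x y).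
have mF y : measurable (F y) by exact: mcyl.
have tF : trivIset [set` tree_nbrs a (x k)] F.
  apply/trivIsetP => y z _ _ yz; rewrite /F !cyl_extend; apply/seteqP; split => // w [[_ /= Xy] [_ /= Xz]].
  by move: yz; rewrite -Xy -Xz eqxx.
pose U := \big[setU/set0]_(y <- tree_nbrs a (x k)) F y.
have mU : measurable U by exact: bigsetU_measurable.
have UC : U `<=` cyl k x.
  by rewrite /U -bigcup_seq => w [y _]; rewrite /F cyl_extend => -[].
have QU : Q U = Q (cyl k x).
  rewrite -[LHS]mul1e -integral_cst// (ge0_integral_bigsetU Q mF (tree_nbrs_uniq _) tF)//.
  rewrite (eq_big_seq (fun=> Q (cyl k x) * (D%:R^-1)%:E)); last first.
    by move=> y yx; rewrite integral_cst// mul1e Q_extend.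
  rewrite sume_const; last by rewrite mule_ge0 ?lee_fin ?invr_ge0.
  by rewrite muleCA -EFinM mulfV// mule1.
have Cfin : Q (cyl k x) \is a fin_num by rewrite /cyl srw.
have QR : Q (cyl k x `\` U) = 0.
  rewrite measureD//; last by rewrite ltey_eq Cfin.
  by rewrite (setIidr UC) [X in _ - X]QU subee.
have mf D' : measurable_fun D' (fun w => (phi (X (k + n.+1)%N w))%:E) by exact: measurable_funTS.
have f0 D' w : D' w -> 0 <= (phi (X (k + n.+1)%N w))%:E by rewrite lee_fin.
rewrite (ge0_negligible_integral (measurableD (mcyl k x) mU) (mcyl k x) (mf _) (f0 _) QR).
rewrite setDD (setIidr UC) (ge0_integral_bigsetU Q mF (tree_nbrs_uniq _) tF (mf _) (f0 _)).
rewrite (eq_big_seq (fun y => Q (cyl k x) *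
    ((D%:R^-1)%:E * (walk_mean (tree_nbrs a) n phi y)%:E))); last first.
  move=> y yx; rewrite muleA -(Q_extend tx yx) -[y in walk_mean _ _ _ y](_ : extend k x y k.+1 = y).
    rewrite -IH; first by rewrite addSnnS.
    by rewrite /extend eqxx; exact: in_tree_nbrs yx.
  by rewrite /extend eqxx.
rewrite -ge0_sume_distrr; last first.
  by move=> y _; rewrite -EFinM lee_fin mulr_ge0 ?invr_ge0 ?walk_mean_ge0.
rewrite -ge0_sume_distrr; last by move=> y _; rewrite lee_fin walk_mean_ge0.
by rewrite sumEFin -EFinM mulrC.
Qed.

Lemma walk_lawE (phi : vertex -> R) n : Q setT = 1 -> (forall y, (0 <= phi y)%R) ->
  \int[Q]_w (phi (X n w))%:E = (walk_mean (tree_nbrs a) n phi [::])%:E.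
Proof.
move=> Q1 phi0; have := @integral_cyl phi n 0%N (fun=> [::]) phi0 erefl.
have C1 : Q (cyl 0 (fun=> [::])) = 1.
  by rewrite /cyl srw big_ord0 mulr1 eqxx.
rewrite C1 mul1e add0n => <-.
have CT : Q (setT `\` cyl 0 (fun=> [::])) = 0.
  have -> : Q (setT `\` cyl 0 (fun=> [::])) = Q setT - Q (setT `&` cyl 0 (fun=> [::])).
    by apply: measureD => //; rewrite [X in X < _]Q1 ltry.
  by rewrite setTI Q1 C1 subee.
have f0 w : [set: W] w -> 0 <= (phi (X n w))%:E by rewrite lee_fin.
rewrite (ge0_negligible_integral _ _ (mphi _ _) f0 CT)//; last exact: measurableD.
by rewrite setDD setTI.
Qed.
End walk_law.
End quenched.
End environment.

(** * Vanishing of the mean deviation from the speed *)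

Lemma in_tree_rcons a x i : in_tree a (rcons x i) =
  nth false (a [::]) i && in_tree (branch a i) x.
Proof.
elim: x => [|j x IH] /=; first by rewrite andbT.
by rewrite IH -andbA.
Qed.

(** A finite set of words is bounded in height, and conversely the number of
    vertices of bounded height is finite because each mark is a finite word. *)
Lemma finite_treeP a : finite_tree a <-> finite_set [set x | in_tree a x].
Proof.
split=> [[n]|fin].
  elim: n a => //= n IH a ext.
  apply: (@sub_finite_set _ _ ([set [::]] `|` \bigcup_(i in [set` children (a [::])])
      ((rcons^~ i) @` [set x | in_tree (branch a i) x]))).
    move=> x /=; case: (lastP x) => [_|{}x i]; first by left.
    rewrite in_tree_rcons => /andP[ai xi]; right; exists i => /=.
      by rewrite mem_children.
    by exists x.
  rewrite finite_setU; split => //.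
  apply: bigcup_finite => // i ic; apply: finite_image; apply: IH.
  exact: ext.
have [s sE] := (finite_seqP _).1 fin.
have : forall x, in_tree a x -> (size x < (\max_(x <- s) size x).+1)%N.
  move=> x tx; rewrite ltnS.
  have xs : x \in s by have : [set x | in_tree a x] x by []; rewrite sE.
  by rewrite (big_rem x xs) leq_maxl.
move: (_.+1) => {sE fin s} n.
elim: n a => [|n IH] a H; first by have := H [::] erefl.
suff ext i : i \in children (a [::]) -> finite_tree (branch a i).
  by apply/finite_treeE.
move=> ic; apply: IH => x tx.
have := H (rcons x i); rewrite size_rcons ltnS; apply.
by rewrite in_tree_rcons -mem_children ic.
Qed.

Lemma bounded_convergence0 d (T : measurableType d) (R : realType)
    (m : {measure set T -> \bar R}) (f : nat -> T -> R) (c : R) :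
  m setT = 1%E -> (forall n, measurable_fun setT (f n)) ->
  (forall n t, 0 <= f n t <= c) ->
  {ae m, forall t, f n t @[n --> \oo] --> 0} ->
  (\int[m]_t (f n t)%:E)%E @[n --> \oo] --> 0%E.
Proof.
move=> m1 mf f0c f0.
have := @dominated_convergence _ _ _ m setT measurableT
  (fun n t => (f n t)%:E) (cst 0%E) (cst c%:E).
case.
- by move=> n; apply/measurable_EFinP.
- exact: measurable_cst.
- by apply: filterS f0 => t ft _; apply: cvg_EFin => //; near=> n.
- apply/integrableP; split => //.
  by rewrite integral_cst// m1 mule1 ltry.
- apply: aeW => t n _ /=; rewrite lee_fin ger0_norm; by case/andP: (f0c n t).
by move=> _ _; rewrite integral0.
Unshelve. all: by end_near. Qed.

Section vanishing_of_speed.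
Context d (Omega : measurableType d) (R : realType) (P : probability Omega R).
Context (mu : probability nat R) (p v : R).
Context (N : vertex -> {RV P >-> nat}) (B : vertex -> {RV P >-> bool}).
Hypothesis gw : gw_percolation mu p N B.
Context d' (W : measurableType d') (K : R.-pker Omega ~> W) (X : nat -> W -> vertex).
Let tree omega := percolated_tree (N ^~ omega) (B ^~ omega).
Let S := [set omega | infinite_set (tree omega)].
Hypothesis mX : forall n x, measurable (X n @^-1` [set x]).
Hypothesis srw : forall omega, S omega ->
  simple_random_walk (open_edge (N ^~ omega) (B ^~ omega)) Defs.root (K omega) X.
Hypothesis speed : {ae annealed_law P S K, forall z : Omega * W,
        ((size (X n z.2))%:R / n%:R)%R @[n --> \oo] --> v}.
Hypothesis S_pos : (0 < P S)%E.
Local Open Scope ereal_scope.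
Local Notation marks := (environment N B).

Lemma infinite_percolated_treeE omega : S omega <-> ~ finite_tree (marks omega).
Proof. by rewrite /S/= /tree percolated_treeE finite_treeP. Qed.

Lemma infinite_tree_nbrs omega x : S omega -> in_tree (marks omega) x ->
  tree_nbrs (marks omega) x != [::].
Proof.
move=> /infinite_percolated_treeE inf; case: x => [|i u _]//= _.
apply/negP => /eqP nb; apply: inf; apply/finite_treeE => i ic.
have : [:: i] \in tree_nbrs (marks omega) [::].
  by rewrite /tree_nbrs/=; apply/mapP; exists i.
by rewrite nb.
Qed.

Lemma measurable_S : measurable S.
Proof.
rewrite (_ : S = marks @^-1` [set t | ~ finite_tree t]).
  rewrite -[X in measurable X]setTI; apply: measurable_environment => //.
  by apply: measurableC; exact: measurable_finite_tree.
by apply/seteqP; split => omega /infinite_percolated_treeE.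
Qed.

(** A null set for the annealed law has null sections above almost every infinite
    tree. *)
Lemma quenched_speed : {ae P, forall omega, S omega ->
  {ae K omega, forall w, ((size (X n w))%:R / n%:R)%R @[n --> \oo] --> v}}.
Proof.
have [A [mA A0 subA]] := speed.
have PS : P S \is a fin_num by exact: fin_num_measure measurable_S.
have mf : measurable_fun setT (fun omega => K omega (xsection A omega)).
  by apply: measurable_fun_xsection_finite_kernel; rewrite inE.
have int0 : \int[P]_(omega in S) K omega (xsection A omega) = 0.
  move/eqP: A0; rewrite /annealed_law mule_eq0 => /orP[/eqP//|].
  by rewrite eqe invr_eq0 gt_eqF// fine_gt0// S_pos/= ltey_eq PS.
have : \int[P]_(omega in S) `|K omega (xsection A omega)| = 0.
  by rewrite -[RHS]int0; apply: eq_integral => omega _; rewrite gee0_abs.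
move=> /(ae_eq_integral_abs P measurable_S (measurable_funTS mf)).
apply: filterS => omega KA0 Somega; exists (xsection A omega); split.
- exact: measurable_xsection.
- exact: KA0.
- move=> w /= nw; rewrite /xsection/=; apply/mem_set; apply: subA => /= H; exact: nw.
Qed.

(** Bounded convergence under the law of the walk on a fixed tree. *)
Lemma tree_error_cvg : {ae P, forall omega,
  tree_error v n (marks omega) @[n --> \oo] --> 0%R}.
Proof.
apply: filterS quenched_speed => omega Hspeed.
have [Somega|nS] := pselect (S omega); last first.
  rewrite (_ : (fun n => _) = cst 0%R); first exact: cvg_cst.
  apply/funext => n; rewrite /tree_error indicE memNset ?mul0r//.
  by move=> /infinite_percolated_treeE.
have {}Hspeed := Hspeed Somega.
(* The walk is at height at most [n] at time [n]; the truncation makes the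
   deviation bounded on all vertices. *)
pose phi n (x : vertex) : R :=
  (if (size x <= n)%N then `|(size x)%:R - n%:R * v| / n.+1%:R else 0)%R.
have phi0 n x : (0 <= phi n x)%R by rewrite /phi; case: ifP => // _; rewrite divr_ge0.
have phi1 n x : (phi n x <= 1 + `|v|)%R.
  rewrite /phi; case: ifP => [xn|_]; last by rewrite addr_ge0.
  rewrite ler_pdivrMr//; apply: le_trans (deviation_le v xn) _.
  by rewrite mulrC ler_wpM2l ?addr_ge0// ler_nat.
have e1 n : tree_error v n (marks omega) =
    walk_mean (tree_nbrs (marks omega)) n (phi n) [::].
  rewrite /tree_error indicE mem_set; last exact/infinite_percolated_treeE.
  rewrite mul1r mulrC /tree_deviation -walk_meanZ.
  by apply/eqP; rewrite eq_le; apply/andP; split; apply: (le_walk_mean_near (h := size)) => [y z|y /=];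
    try exact: size_tree_nbrs; rewrite add0n => yn; rewrite /phi yn mulrC.
have e2 n : \int[K omega]_w (phi n (X n w))%:E =
    (walk_mean (tree_nbrs (marks omega)) n (phi n) [::])%:E.
  exact: (walk_lawE mX (srw Somega) (fun x => @infinite_tree_nbrs omega x Somega)
    n (prob_kernel omega) (phi0 n)).
have : \int[K omega]_w (phi n (X n w))%:E @[n --> \oo] --> 0.
  apply: (@bounded_convergence0 _ _ _ (K omega) (fun n w => phi n (X n w)) (1 + `|v|)%R).
  - exact: prob_kernel.
  - move=> n; apply: (@measurable_fun_fibers _ _ _ (X n) _ _ _ (fun x _ => phi n x)) => x.
      exact: mX.
    exact: measurable_cst.
  - by move=> n w; rewrite phi0 phi1.
  apply: filterS Hspeed => w Hw.
  apply: (@squeeze_cvgr _ _ _ _ (cst 0%R) (fun n => `|(size (X n w))%:R / n%:R - v|%R)).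
  - near=> n; rewrite phi0/= /phi; case: ifP => // xn.
    have n0 : (0 < n%:R :> R)%R by rewrite ltr0n; near: n; exact: nbhs_infty_gt.
    have -> : ((size (X n w))%:R - n%:R * v = n%:R * ((size (X n w))%:R / n%:R - v))%R.
      by rewrite mulrBr mulrCA mulfV ?mulr1// gt_eqF.
    rewrite normrM normr_nat ler_pdivrMr// mulrC ler_wpM2l// ler_nat; exact: leqnSn.
  - exact: cvg_cst.
  - by apply/norm_cvg0P; apply/subr_cvg0.
under eq_fun do rewrite e2 -e1.
by move=> /fine_cvg.
Unshelve. all: by end_near. Qed.

(** Bounded convergence again, under the law of the tree. *)
Lemma vanishing_tree_error (mt : {measure set (env vertex) -> \bar R}) :
  mt = pushforward P marks :> (set (env vertex) -> \bar R) ->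
  vanishing mt (tree_error v) setT.
Proof.
move=> mtE.
have menv := measurable_environment N B.
have : \int[P]_omega (tree_error v n (marks omega))%:E @[n --> \oo] --> 0.
  apply: (@bounded_convergence0 _ _ _ P (fun n omega => tree_error v n (marks omega)) (1 + `|v|)%R).
  - exact: probability_setT.
  - by move=> n; exact: (measurableT_comp (measurable_tree_error v n) menv).
  - by move=> n w; rewrite tree_error_ge0 tree_error_le.
  exact: tree_error_cvg.
move=> cvg0 e e0.
have : \forall n \near \oo, \int[P]_omega (tree_error v n (marks omega))%:E < e%:E.
  have := e0; move/(cvgr_lt _ (fine_cvg cvg0)); apply: filterS => n /=.
  rewrite -lte_fin fineK// ge0_fin_numE; last first.
    by apply: integral_ge0 => omega _; rewrite lee_fin tree_error_ge0.
  apply: (@le_lt_trans _ _ (\int[P]_omega (cst (1 + `|v|)%:E) omega)).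
    apply: ge0_le_integral => //.
    - by move=> omega _; rewrite lee_fin tree_error_ge0.
    - apply/measurable_EFinP; exact: (measurableT_comp (measurable_tree_error v n) menv).
    - by move=> omega _; rewrite lee_fin tree_error_le.
  rewrite integral_cst// [X in _ * X](_ : _ = 1) ?mule1 ?ltry//; exact: probability_setT.
apply: filterS => n /ltW; apply: le_trans.
rewrite le_eqVlt; apply/orP; left; apply/eqP.
transitivity (\int[pushforward P marks]_t (tree_error v n t)%:E).
  by apply: eq_measure_integral => A mA _; rewrite mtE.
rewrite (@ge0_integral_pushforward _ _ _ _ _ _ menv P setT (fun t => (tree_error v n t)%:E))//.
- by apply/measurable_EFinP; exact: measurable_tree_error.
- by move=> t _; rewrite lee_fin tree_error_ge0.
Qed.

Lemma speed_ge0 : (0 <= v)%R.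
Proof.
rewrite leNgt; apply/negP => v0.
have lim_neg w : ~ ((size (X n w))%:R / n%:R)%R @[n --> \oo] --> v.
  move=> cvg; suff : (0 <= v)%R by rewrite leNgt v0.
  by apply: (cvgr_to_ge cvg); near=> n; rewrite divr_ge0.
have [A [mA A0 subA]] := quenched_speed.
have : P S <= P A.
  apply: le_measure; rewrite ?inE//; first exact: measurable_S.
  move=> omega Somega; apply: subA => /= H; have [A' [mA' A'0 subA']] := H Somega.
  have : K omega setT <= K omega A'.
    apply: le_measure; rewrite ?inE// => w _; apply: subA' => /=; exact: lim_neg.
  by rewrite A'0 prob_kernel lee_fin ler10.
by rewrite A0 leNgt S_pos.
Unshelve. all: by end_near. Qed.
End vanishing_of_speed.

(** * Thinning of the offspring *)

Lemma eq_ge0_integral_fibers2 (C : countType) (R : realType) d1 d2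
    (T1 : measurableType d1) (T2 : measurableType d2) (h1 : T1 -> C) (h2 : T2 -> C)
    (m1 : {measure set T1 -> \bar R}) (m2 : {measure set T2 -> \bar R})
    (F1 : T1 -> \bar R) (F2 : T2 -> \bar R) :
  (forall c, measurable [set t | h1 t = c]) -> (forall c, measurable [set t | h2 t = c]) ->
  measurable_fun setT F1 -> (forall t, 0 <= F1 t)%E ->
  measurable_fun setT F2 -> (forall t, 0 <= F2 t)%E ->
  (forall c, \int[m1]_(t in [set t | h1 t = c]) F1 t =
             \int[m2]_(t in [set t | h2 t = c]) F2 t)%E ->
  (\int[m1]_t F1 t = \int[m2]_t F2 t)%E.
Proof.
move=> mh1 mh2 mF1 F10 mF2 F20 F12.
rewrite (ge0_integral_fibers mh1)// (ge0_integral_fibers mh2)//.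
apply: eq_eseriesr => k _; have [[c ck]|nk] := pselect (exists c, @pickle C c = k).
  have e (T : Type) (h : T -> C) : [set t | pickle (h t) = k] = [set t | h t = c].
    apply/seteqP; split => t /= => [|->//].
    by rewrite -ck => /(pcan_inj pickleK).
  by rewrite !e.
have e (T : Type) (h : T -> C) : [set t | pickle (h t) = k] = set0.
  by apply/seteqP; split => // t /= e; apply: nk; exists (h t).
by rewrite !e !integral_set0.
Qed.

Section thinning.
Context {R : realFieldType}.
Implicit Types (p x : R) (phi : nat -> R).

(** The mean of [phi (k + s)] when [s] is binomial with parameters [n] and [p]. *)
Fixpoint thinned_mean p n phi k : R :=
  if n is n'.+1 then p * thinned_mean p n' phi k.+1 + (1 - p) * thinned_mean p n' phi k
  else phi k.

Fixpoint bits n : seq bitseq :=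
  if n is n'.+1 then map (cons true) (bits n') ++ map (cons false) (bits n')
  else [:: [::]].

Lemma mem_bits n b : (b \in bits n) = (size b == n).
Proof.
elim: n b => [|n IH] [|x b] //; rewrite mem_cat; first by apply/orP => -[] /mapP[].
case: x; rewrite mem_map ?IH; try by move=> ? ? [].
  by rewrite orbC (_ : _ \in _ = false)//; apply/mapP => -[].
by rewrite (_ : _ \in _ = false)//; apply/mapP => -[].
Qed.

Lemma bits_uniq n : uniq (bits n).
Proof.
elim: n => //= n IH; rewrite cat_uniq !map_inj_uniq ?IH; try by move=> ? ? [].
by rewrite andbT; apply/hasPn => _ /mapP[b _ ->]; apply/mapP => -[].
Qed.

Lemma sum_bits p n phi k :
  \sum_(b <- bits n) (\prod_(x <- b) (if x then p else 1 - p)) * phi (k + count id b)%N =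
  thinned_mean p n phi k.
Proof.
elim: n k => [|n IH] k; first by rewrite big_seq1 big_nil mul1r addn0.
rewrite /= big_cat !big_map/= -!IH !big_distrr/=; congr (_ + _); apply: eq_bigr => b _;
by rewrite big_cons mulrA ?add0n// addnA addn1.
Qed.

Lemma thinned_mean_ge0 p n phi k : 0 <= p <= 1 -> (forall k, 0 <= phi k) ->
  0 <= thinned_mean p n phi k.
Proof.
move=> /andP[p0 p1] phi0; elim: n k => //= n IH k.
by rewrite addr_ge0 ?mulr_ge0 ?subr_ge0.
Qed.

Lemma thinned_mean_expr p n x k :
  thinned_mean p n (fun j => x ^+ j) k = x ^+ k * (1 - p + p * x) ^+ n.
Proof.
elim: n k => [|n IH] k /=; first by rewrite mulr1.
by rewrite !IH !exprS; ring.
Qed.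

Lemma thinned_mean_le p n phi k c : 0 <= p <= 1 ->
  (forall j, (j <= k + n)%N -> phi j <= c) -> thinned_mean p n phi k <= c.
Proof.
move=> /andP[p0 p1]; elim: n k => [|n IH] k le_c /=; first by apply: le_c; rewrite addn0.
have -> : c = p * c + (1 - p) * c by ring.
rewrite lerD// ler_wpM2l ?subr_ge0//; apply: IH => j jk; apply: le_c; lia.
Qed.

Lemma thinned_mean_gt0 p n phi k : 0 < p <= 1 -> (forall k, 0 <= phi k) ->
  0 < phi (k + n)%N -> 0 < thinned_mean p n phi k.
Proof.
move=> /andP[p0 p1] phi0; elim: n k => [|n IH] k /=; first by rewrite addn0.
move=> pk; rewrite ltr_pwDl ?mulr_gt0 ?IH ?addSnnS// mulr_ge0 ?subr_ge0//.
by apply: thinned_mean_ge0; rewrite // ltW.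
Qed.

Lemma thinned_mean_pair p n (k : nat) :
  thinned_mean p n (fun j => j%:R * (j%:R - 1)) k =
  k%:R * (k%:R - 1) + 2 * k%:R * n%:R * p + n%:R * (n%:R - 1) * p ^+ 2.
Proof.
elim: n k => [|n IH] k /=; first by ring.
by rewrite !IH -!natr1; ring.
Qed.

End thinning.

Section mark_expectation.
Context (R : realType) (p : R).
Context d (T : measurableType d) (P : probability T R) (xi : {RV P >-> nat}).
Context (mt : {measure set (env vertex) -> \bar R}).
Hypothesis p01 : 0 < p < 1.
Let r := mark_law (distribution P xi) p.
Hypothesis imt : iid_env r mt.
Local Open Scope ereal_scope.

Let p01' : (0 <= p <= 1)%R. Proof. by have /andP[/ltW -> /ltW ->] := p01. Qed.

Lemma measurable_xi n : measurable [set w | xi w = n].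
Proof.
by rewrite -[X in measurable X]setTI; exact: (measurable_funP xi measurableT [set n]).
Qed.

Lemma measurable_fun_xi (f : nat -> R) : measurable_fun setT (fun w => (f (xi w))%:E).
Proof.
apply/measurable_EFinP.
apply: (@measurable_fun_fibers _ _ _ (xi : T -> nat) _ _ _ (fun n _ => f n)) => n.
  exact: measurable_xi.
exact: measurable_cst.
Qed.

(** The number of open edges below a vertex is a thinning of the offspring. *)
Lemma integral_mark (phi : nat -> R) : (forall k, (0 <= phi k)%R) ->
  \int[mt]_t (phi (count id (t [::])))%:E =
  \int[P]_w (thinned_mean p (xi w) phi 0)%:E.
Proof.
move=> phi0.
apply: (@eq_ge0_integral_fibers2 nat _ _ _ _ _ (fun t : env vertex => size (t [::])) (xi : T -> nat)).
- move=> n; apply: (measurable_fibers (h := fun t : env vertex => t [::]) _ (fun b => size b = n)).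
  by move=> b; exact: measurable_mark.
- exact: measurable_xi.
- exact: (measurable_root_fun (fun b => phi (count id b))).
- by move=> t; rewrite lee_fin.
- exact: (measurable_fun_xi (fun n => thinned_mean p n phi 0)).
- by move=> w; rewrite lee_fin thinned_mean_ge0.
move=> n; rewrite [RHS](eq_integral (cst (thinned_mean p n phi 0)%:E)); last first.
  by move=> w /set_mem /= ->.
rewrite integral_cst; last exact: measurable_xi.
have -> : [set t : env vertex | size (t [::]) = n] =
    \big[setU/set0]_(b <- bits n) [set t : env vertex | t [::] = b].
  rewrite -bigcup_seq; apply/seteqP; split => t /=.
    by move=> tn; exists (t [::]) => //=; rewrite mem_bits tn.
  by move=> [b /=]; rewrite mem_bits => /eqP <- ->.
rewrite (ge0_integral_bigsetU mt (fun b => measurable_mark _ b) (bits_uniq n)); last 3 first.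
- apply/trivIsetP => b b' _ _ bb'; apply/seteqP; split => // t [/= -> /eqP].
  by rewrite (negbTE bb').
- by apply: measurable_funTS; exact: (measurable_root_fun (fun b => phi (count id b))).
- by move=> t _; rewrite lee_fin.
rewrite (eq_big_seq (fun b => (r b * phi (count id b))%:E)); last first.
  move=> b _; rewrite (eq_integral (cst (phi (count id b))%:E)); last by move=> t /set_mem /= ->.
  by rewrite integral_cst ?(iid_mark _ _ imt) -?EFinM 1?mulrC//; exact: measurable_mark.
transitivity ((thinned_mean p n phi 0)%:E * (fine (distribution P xi [set n]))%:E); last first.
  by congr (_ * _); rewrite fineK ?fin_num_measure.
rewrite sumEFin -sum_bits muleC -EFinM big_distrr/=; congr EFin.
apply: eq_big_seq => b; rewrite mem_bits => /eqP bn.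
by rewrite /r /mark_law bn mulrA.
Qed.

(** Opening an edge keeps the probability positive since [p > 0]. *)
Lemma mark_law_free b i : (i < size b)%N -> ~~ nth false b i ->
  r b <> 0%R -> r (set_nth false b i true) <> 0%R.
Proof.
move=> ib _; rewrite /r /mark_law size_set_nth (maxn_idPr ib).
have pr c : (\prod_(x <- c) (if x then p else 1 - p) != 0 :> R)%R.
  have /andP[p0 p1] := p01; rewrite prodf_seq_neq0; apply/allP => -[] _ /=.
    by rewrite gt_eqF.
  by rewrite gt_eqF// subr_gt0.
move=> /eqP; rewrite mulf_eq0 negb_or => /andP[h _]; apply/eqP.
by rewrite mulf_neq0.
Qed.

(** All the edges below a vertex may be closed since [p < 1]. *)
Lemma mark_law_not_full n : (0 < n)%N -> 0 < P [set w | xi w = n] ->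
  exists2 b, ~~ all id b & r b <> 0%R.
Proof.
move=> n0 Pn; exists (nseq n false); first by case: n n0 Pn.
have /andP[p0 p1] := p01; apply/eqP; rewrite /r /mark_law size_nseq mulf_neq0//.
  by rewrite gt_eqF// fine_gt0//= Pn/= ltey_eq fin_num_measure.
rewrite prodf_seq_neq0; apply/allP => x /nseqP[-> _] /=.
by rewrite gt_eqF// subr_gt0.
Qed.

(** By induction, the probability of extinction before any given height is at most
    [1 - x]: the generating function of the number of children is nondecreasing,
    and the hypothesis bounds its value at [1 - x]. *)
Lemma survival x : (0 <= x <= 1)%R ->
  \int[P]_w ((1 - p * x) ^+ xi w)%:E <= (1 - x)%:E ->
  mt [set t : env vertex | finite_tree t] <= (1 - x)%:E.
Proof.
move=> /andP[x0 x1] Hx; have y0 : (0 <= 1 - x)%R by rewrite subr_ge0.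
have r0 : forall b, (0 <= r b)%R by exact: mark_law_ge0.
have ext n : mt [set t : env vertex | extinct n t] <= (1 - x)%:E.
  elim: n => [|n IH].
    by rewrite (_ : [set _ | _] = set0) ?measure0 ?lee_fin//; apply/seteqP; split.
  have mE := measurable_extinct n.
  have := branching r0 imt predT mE (fine_mt imt mE).
  rewrite (_ : [set t : env vertex | predT (t [::])] = setT); last by apply/seteqP; split.
  rewrite (_ : [set t | _] = [set t : env vertex | extinct n.+1 t]); last first.
    by apply/seteqP; split => t /=; [case|].
  move=> ->; set qn := fine _.
  have qn0 : (0 <= qn)%R by exact: fine_ge0.
  have qnx : (qn <= 1 - x)%R by rewrite -lee_fin -(fine_mt imt mE).
  rewrite (integral_mark (phi := fun k => qn ^+ k)%R); last by move=> k; rewrite exprn_ge0.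
  apply: le_trans Hx; apply: ge0_le_integral => //.
  - by move=> w _; rewrite lee_fin thinned_mean_ge0// => k; rewrite exprn_ge0.
  - exact: (measurable_fun_xi (fun n => thinned_mean p n (fun k => qn ^+ k)%R 0)).
  - exact: (measurable_fun_xi (fun n => (1 - p * x) ^+ n)%R).
  - have /andP[p0 p1] := p01'.
    move=> w _; rewrite lee_fin thinned_mean_expr expr0 mul1r lerXn2r// ?nnegrE.
    + by rewrite addr_ge0 ?mulr_ge0// subr_ge0.
    + by rewrite subr_ge0 mulr_ile1.
    + have -> : (1 - p * x = 1 - p + p * (1 - x))%R by ring.
      by rewrite lerD2l ler_wpM2l.
rewrite (_ : [set _ | _] = \bigcup_n [set t : env vertex | extinct n t]); last first.
  by apply/seteqP; split => t [n]; exists n.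
have nd : nondecreasing_seq (fun n => [set t : env vertex | extinct n t]).
  by move=> i j ij; apply/subsetPset => t /=; exact: extinct_le.
have cvg : mt [set t : env vertex | extinct n t] @[n --> \oo] -->
    mt (\bigcup_n [set t : env vertex | extinct n t]).
  apply: nondecreasing_cvg_mu => //; first exact: measurable_extinct.
  exact: bigcupT_measurable measurable_extinct.
by apply: (cvge_le _ cvg); near=> n.
Unshelve. all: by end_near. Qed.
End mark_expectation.

(** * The effective speed as a function of the survival probability *)

(** The index of a vertex of the pair of trees among the words: two disjoint
    families of words carry two independent trees. *)
Definition pair_word (z : vertex2) : vertex := rcons z.2 z.1.

Lemma pair_word_inj : injective pair_word.
Proof. by move=> [c x] [c' x'] /rcons_inj[-> /eqP]; case: c; case: c'. Qed.

(** The witness is the survival probability of the percolated tree. The auxiliary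
    [x] ensures that it is positive, and the offspring [n] that the drift is. *)
Lemma effective_speed_formula (R : realType) d (T : measurableType d)
    (P : probability T R) (xi : {RV P >-> nat}) (p v x : R) (n : nat) :
  0 < p < 1 -> (1 < n)%N -> (0 < P [set w | xi w = n])%E ->
  0 < x <= 1 -> (\int[P]_w ((1 - p * x) ^+ xi w)%:E <= (1 - x)%:E)%E ->
  effective_speed (distribution P xi) p v ->
  exists theta : R, [/\ 0 < theta <= 1,
    (\int[P]_w ((1 - p * theta) ^+ xi w)%:E = (1 - theta)%:E)%E &
    v * (2 - theta) =
    theta ^+ 2 * fine (\int[P]_w (thinned_mean p (xi w) (excess (1 - theta)) 0)%:E)%E].
Proof.
move=> p01 n1 Pn x01 Hx [dO [Om [Pr [N [B [dW [W [K [X]]]]]]]]] /= [gw mX srw speed].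
have p01' : 0 <= p <= 1 by have /andP[/ltW -> /ltW ->] := p01.
have [p0 p1] := andP p01; have [x0 x1] := andP x01.
pose r := mark_law (distribution P xi) p.
have r0 b : 0 <= r b by exact: mark_law_ge0.
have menv := measurable_environment N B.
have [mt mtE] := pushforward_measure Pr menv.
have imt : iid_env r mt by rewrite mtE; exact: iid_environment gw.
have [mp mpE] := pushforward_measure mt (measurable_reindex pair_word).
have imp : iid_env r mp by rewrite mpE; exact: iid_reindex pair_word_inj imt.
pose A : set (env vertex) := [set t | finite_tree t].
have mA : measurable A by exact: measurable_finite_tree.
pose q := fine (mt A).
have Aq : mt A = q%:E by have := fine_mt imt mA.
have q_le : q <= 1 - x.
  rewrite -lee_fin -Aq; apply: (survival p01 imt) => //.
  by rewrite (ltW x0) x1.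
have q1 : q < 1 by apply: le_lt_trans q_le _; rewrite ltrBlDr ltrDl.
have q0 : 0 <= q by exact: fine_ge0.
set S := [set omega | infinite_set _] in srw speed.
have S_pos : (0 < Pr S)%E.
  have -> : Pr S = mt (~` A).
    rewrite mtE /pushforward; congr (Pr _).
    by apply/seteqP; split => omega /(infinite_percolated_treeE N B).
  have : (mt A + mt (~` A) = 1)%E.
    rewrite -(iid_setT imt) -[in RHS](setUv A); apply/esym.
    by apply: measureU => //; [exact: measurableC|exact: setICr].
  rewrite Aq; case: (mt (~` A)) (measure_ge0 mt (~` A)) => [y| |]//.
  by rewrite -EFinD lte_fin => _ [H]; rewrite -(ltrD2l q) addr0 H.
have v0 : 0 <= v by exact: (speed_ge0 speed S_pos).
have van : vanishing mt (tree_error v) setT by exact: (vanishing_tree_error mX srw speed S_pos mtE).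
have rfree b i : (i < size b)%N -> ~~ nth false b i -> r b <> 0 -> r (set_nth false b i true) <> 0.
  exact: mark_law_free.
have rnf := mark_law_not_full p01 (ltnW n1) Pn.
have phi0 k : 0 <= excess q k by exact: excess_ge0.
have EE := integral_mark p01 imt phi0.
have E0 : (0 < \int[mt]_t (excess q (count id (t [::])))%:E)%E.
  rewrite EE; apply: (@lt_le_trans _ _ (\int[P]_(w in [set w | xi w = n])
     (thinned_mean p n (excess q) 0)%:E)%E).
    rewrite integral_cst; last exact: measurable_xi.
    apply: mule_gt0 => //; rewrite lte_fin thinned_mean_gt0// ?p0 ?ltW//.
    by rewrite add0n excess_gt0.
  rewrite (eq_integral (fun w => (thinned_mean p (xi w) (excess q) 0)%:E)); last first.
    by move=> w /set_mem /= ->.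
  apply: ge0_subset_integral => //.
  - exact: measurable_xi.
  - exact: (measurable_fun_xi xi (fun n => thinned_mean p n (excess q) 0)).
  - by move=> w _; rewrite lee_fin thinned_mean_ge0.
have Ev := speed_formula r0 imt imp rfree rnf v0 van q1 E0.
have fix_q := extinction_fixpoint r0 imt.
exists (1 - q); split.
- by rewrite subr_gt0 q1 gerBl.
- have := integral_mark p01 imt (phi := fun k => q ^+ k) (fun k => exprn_ge0 k q0).
  rewrite fix_q => /esym; rewrite -/A -/q opprB addrCA subrr addr0 => <-.
  apply: eq_integral => w _; rewrite thinned_mean_expr expr0 mul1r.
  by congr (_ ^+ _)%:E; ring.
- rewrite (_ : 1 - (1 - q) = q); last by ring.
  rewrite -EE.
  have -> : 2 - (1 - q) = 1 + q by ring.
  exact: Ev.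
Qed.

(** * Expansions of the generating function *)

Section limits.
Context {R : realType}.
Implicit Types (q : R) (k : nat).

Definition geom_sum q k : R := \sum_(j < k) geom q j.

(** Second order expansion of [q ^+ k] at [q = 1], see also [geomE]. *)
Lemma geom_sumE q k : k%:R = geom q k + (1 - q) * geom_sum q k.
Proof.
rewrite /geom_sum big_distrr/= (eq_bigr (fun j : 'I_k => 1 - q ^+ j)) => [|j _].
  by rewrite sumrB sumr_const card_ord /geom addrC subrK.
exact: geomE.
Qed.

Lemma geom_sum_ge0 q k : 0 <= q -> 0 <= geom_sum q k.
Proof. by move=> q0; apply: sumr_ge0 => j _; exact: geom_ge0. Qed.

Lemma geom_sum_le q k : 0 <= q <= 1 -> geom_sum q k <= k%:R ^+ 2.
Proof.
move=> q01; rewrite expr2 mulr_natr.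
apply: (@le_trans _ _ (\sum_(j < k) k%:R)); last by rewrite sumr_const card_ord.
apply: ler_sum => j _; apply: le_trans (geom_le _ q01) _.
by rewrite ler_nat ltnW.
Qed.

Lemma geom_sum_ge1 q k : 0 <= q -> (1 < k)%N -> 1 <= geom_sum q k.
Proof.
move=> q0 k1; rewrite /geom_sum (bigD1 (Ordinal k1))//= -[leLHS]addr0 lerD ?geom_ge1//.
by apply: sumr_ge0 => j _; exact: geom_ge0.
Qed.

Lemma geom1 k : geom 1 k = k%:R :> R.
Proof.
rewrite /geom (eq_bigr (fun=> 1)) => [|j _]; last exact: expr1n.
by rewrite sumr_const card_ord.
Qed.

Lemma geom_sum1 k : geom_sum 1 k = k%:R * (k%:R - 1) / 2 :> R.
Proof.
rewrite /geom_sum (eq_bigr (fun j : 'I_k => (j : nat)%:R)) => [|j _]; last exact: geom1.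
elim: k => [|k IH]; first by rewrite big_ord0 !mul0r.
by rewrite big_ord_recr/= IH -natr1; field.
Qed.

Lemma excess1 k : excess 1 k = 6^-1 * (k%:R * (k%:R - 1)) :> R.
Proof.
have S1 n : \sum_(j < n) (j : nat)%:R = n%:R * (n%:R - 1) / 2 :> R.
  by rewrite -geom_sum1; apply: eq_bigr => j _; rewrite geom1.
have S2 n : \sum_(j < n) (j : nat)%:R ^+ 2 = n%:R * (n%:R - 1) * (2 * n%:R - 1) / 6 :> R.
  elim: n => [|n IH]; first by rewrite big_ord0 !mul0r.
  by rewrite big_ord_recr/= IH -natr1; field.
rewrite /excess (eq_bigr (fun j : 'I_k.+1 => k%:R * (j : nat)%:R - (j : nat)%:R ^+ 2)).
  rewrite sumrB -big_distrr/= S1 S2 -natr1; field.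
  by rewrite natr1 pnatr_eq0.
by move=> j _; rewrite !geom1 natrB ?expr2 -1?ltnS// mulrBr mulrC.
Qed.

Lemma cvg_pow_nat (x : nat -> R) (l : R) k : x n @[n --> \oo] --> l ->
  x n ^+ k @[n --> \oo] --> l ^+ k.
Proof.
by move=> xl; apply: (@continuous_cvg _ _ _ _ _ _ (fun y : R => y ^+ k)) xl; exact: exprn_continuous.
Qed.

Lemma cvg_geom (x : nat -> R) l k : x n @[n --> \oo] --> l ->
  geom (x n) k @[n --> \oo] --> geom l k.
Proof.
move=> xl; rewrite /geom; elim: k => [|k IH].
  by under eq_fun do rewrite big_ord0; rewrite big_ord0; exact: cvg_cst.
under eq_fun do rewrite big_ord_recr/=.
by rewrite big_ord_recr/=; apply: cvgD => //; exact: cvg_pow_nat.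
Qed.

Lemma cvg_sum_ord (f : nat -> nat -> R) (g : nat -> R) k :
  (forall j, f n j @[n --> \oo] --> g j) ->
  \sum_(j < k) f n j @[n --> \oo] --> \sum_(j < k) g j.
Proof.
move=> fg; elim: k => [|k IH].
  by under eq_fun do rewrite big_ord0; rewrite big_ord0; exact: cvg_cst.
by under eq_fun do rewrite big_ord_recr/=; rewrite big_ord_recr/=; exact: cvgD.
Qed.

Lemma cvg_geom_sum (x : nat -> R) l k : x n @[n --> \oo] --> l ->
  geom_sum (x n) k @[n --> \oo] --> geom_sum l k.
Proof.
by move=> xl; apply: (cvg_sum_ord (f := fun n => geom (x n))) => j; exact: cvg_geom.
Qed.

Lemma cvg_excess (x : nat -> R) l k : x n @[n --> \oo] --> l ->
  excess (x n) k @[n --> \oo] --> excess l k.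
Proof.
move=> xl; apply: cvgM; last exact: cvg_cst.
apply: (cvg_sum_ord (f := fun n j => geom (x n) j * geom (x n) (k - j))
  (g := fun j => geom l j * geom l (k - j))) => j.
by apply: cvgM; exact: cvg_geom.
Qed.

Lemma cvg_thinned_mean (p : nat -> R) l (phi : nat -> nat -> R) psi m k :
  p n @[n --> \oo] --> l -> (forall j, phi n j @[n --> \oo] --> psi j) ->
  thinned_mean (p n) m (phi n) k @[n --> \oo] --> thinned_mean l m psi k.
Proof.
move=> pl phipsi; elim: m k => [|m IH] k //=.
by apply: cvgD; apply: cvgM => //; apply: cvgB => //; exact: cvg_cst.
Qed.

End limits.

(** * Moments of the offspring *)

Section moments.
Context (R : realType) d (T : measurableType d) (P : probability T R) (xi : {RV P >-> nat}).
Local Open Scope ereal_scope.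
Local Notation m := (factorial_moment xi).

Definition mean_xi (f : nat -> R) : \bar R := \int[P]_w (f (xi w))%:E.

Lemma factorial_momentE k :
  m k = mean_xi (fun n => \prod_(i < k) (n%:R - i%:R))%R.
Proof. by rewrite /factorial_moment unlock. Qed.

Lemma mean_xi_ge0 f : (forall k, (0 <= f k)%R) -> 0 <= mean_xi f.
Proof. by move=> f0; apply: integral_ge0 => w _; rewrite lee_fin. Qed.

Lemma mean_xi_le f g : (forall k, (0 <= f k)%R) -> (forall k, (f k <= g k)%R) ->
  mean_xi f <= mean_xi g.
Proof.
move=> f0 fg; apply: ge0_le_integral => //; try exact: measurable_fun_xi.
- by move=> w _; rewrite lee_fin.
- by move=> w _; rewrite lee_fin.
Qed.

Lemma mean_xiD f g : (forall k, (0 <= f k)%R) -> (forall k, (0 <= g k)%R) ->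
  mean_xi (fun k => f k + g k)%R = mean_xi f + mean_xi g.
Proof.
move=> f0 g0; rewrite /mean_xi -ge0_integralD//; try exact: measurable_fun_xi.
- by move=> w _; rewrite lee_fin.
- by move=> w _; rewrite lee_fin.
Qed.

Lemma mean_xiZ (c : R) f : (0 <= c)%R -> (forall k, (0 <= f k)%R) ->
  mean_xi (fun k => c * f k)%R = c%:E * mean_xi f.
Proof.
move=> c0 f0; rewrite /mean_xi -ge0_integralZl_EFin//; try exact: measurable_fun_xi.
by move=> w _; rewrite lee_fin.
Qed.

Lemma mean_xi_cst (c : R) : mean_xi (fun=> c) = c%:E.
Proof.
rewrite /mean_xi (integral_cst P measurableT c%:E) -[RHS]mule1.
by congr (_ * _); exact: probability_setT.
Qed.

Hypothesis square : mean_xi (fun k => k%:R ^+ 2)%R < +oo.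

Lemma mean_xi_fin f (c : R) : (0 <= c)%R ->
  (forall k, (0 <= f k <= c + k%:R ^+ 2)%R) -> mean_xi f \is a fin_num.
Proof.
move=> c0 fk; have f0 k : (0 <= f k)%R by case/andP: (fk k).
rewrite ge0_fin_numE ?mean_xi_ge0//.
apply: (@le_lt_trans _ _ (mean_xi (fun k => c + k%:R ^+ 2)%R)).
  by apply: mean_xi_le => // k; case/andP: (fk k).
rewrite mean_xiD//.
by rewrite mean_xi_cst lte_add_pinfty ?ltry.
Qed.

Lemma cvg_mean_xi (f : nat -> nat -> R) (g : nat -> R) :
  (forall n k, (0 <= f n k <= k%:R ^+ 2)%R) ->
  (forall k, f n k @[n --> \oo] --> g k) ->
  fine (mean_xi (f n)) @[n --> \oo] --> fine (mean_xi g).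
Proof.
move=> f01 fg; apply: fine_cvg.
have g01 k : (0 <= g k <= k%:R ^+ 2)%R.
  apply/andP; split; [apply: (cvgr_to_ge (fg k))|apply: (cvgr_to_le (fg k))];
  by near=> n; case/andP: (f01 n k).
rewrite fineK; last by apply: (mean_xi_fin (c := 0%R)) => // k; rewrite add0r.
have := @dominated_convergence _ _ _ P setT measurableT
  (fun n w => (f n (xi w))%:E) (fun w => (g (xi w))%:E) (fun w => ((xi w)%:R ^+ 2)%:E).
case.
- by move=> n; exact: measurable_fun_xi.
- exact: measurable_fun_xi.
- by apply: aeW => w _; apply: (@cvg_EFin _ nat eventually); [near=> n|exact: fg].
- apply/integrableP; split; first exact: (measurable_fun_xi xi (fun k => k%:R ^+ 2)%R).
  rewrite (eq_integral (fun w => ((xi w)%:R ^+ 2)%:E)) => [|w _]; first exact: square.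
  by rewrite gee0_abs// lee_fin sqr_ge0.
- apply: aeW => w n _; rewrite gee0_abs lee_fin; by case/andP: (f01 n (xi w)).
by [].
Unshelve. all: by end_near. Qed.

(** The extinction equation, with [geomE], says that [geom (1 - p * theta)] has mean
    [1 / p]; it remains to take means in [geom_sumE]. *)
Lemma survival_relation (p theta : R) : (0 < p <= 1)%R -> (0 < theta <= 1)%R ->
  mean_xi (fun k => (1 - p * theta) ^+ k)%R = (1 - theta)%:E ->
  (fine (mean_xi (fun k => k%:R)) =
   p^-1 + p * theta * fine (mean_xi (geom_sum (1 - p * theta))))%R.
Proof.
move=> /andP[p0 p1] /andP[t0 t1] fix_theta.
pose t := (p * theta)%R; have t_gt0 : (0 < t)%R by rewrite mulr_gt0.
have t_le1 : (t <= 1)%R by rewrite mulr_ile1 ?(ltW p0) ?(ltW t0).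
have q01 : (0 <= 1 - t <= 1)%R by rewrite subr_ge0 t_le1 gerBl (ltW t_gt0).
have /andP[q0 q1] := q01; rewrite -/t in fix_theta *.
have gfin : mean_xi (geom (1 - t)) \is a fin_num.
  apply: (mean_xi_fin (c := 0%R)) => // k; rewrite geom_ge0// add0r.
  apply: le_trans (geom_le k q01) _; case: k => [|k]; first by rewrite expr0n.
  by rewrite expr2 ler_peMl// ler1n.
have hfin : mean_xi (geom_sum (1 - t)) \is a fin_num.
  apply: (mean_xi_fin (c := 0%R)) => // k.
  by rewrite geom_sum_ge0// add0r geom_sum_le.
have G : (fine (mean_xi (geom (1 - t))) = p^-1)%R.
  have : 1%:E = (1 - theta)%:E + t%:E * mean_xi (geom (1 - t)).
    rewrite -fix_theta -mean_xiZ ?(ltW t_gt0)// => [|k]; last exact: geom_ge0.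
    rewrite -mean_xiD => [|k|k]; last 2 first.
    - exact: exprn_ge0.
    - by rewrite mulr_ge0 ?geom_ge0 ?(ltW t_gt0).
    rewrite -(mean_xi_cst 1); apply: eq_integral => w _; congr EFin.
    by have := geomE (1 - t) (xi w); rewrite (_ : 1 - (1 - t) = t)%R => [->|]; ring.
  rewrite -(fineK gfin) -EFinM -EFinD => -[H].
  have : (t * fine (mean_xi (geom (1 - t))) = theta)%R.
    by apply: (addrI (1 - theta)%R); rewrite -H; ring.
  rewrite /t mulrAC -[RHS]mul1r => /(mulIf (lt0r_neq0 t0)) => H1.
  by apply: (mulfI (lt0r_neq0 p0)); rewrite H1 mulfV// lt0r_neq0.
have -> : mean_xi (fun k => k%:R) = mean_xi (geom (1 - t)) + t%:E * mean_xi (geom_sum (1 - t)).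
  rewrite -mean_xiZ ?(ltW t_gt0)// => [|k]; last exact: geom_sum_ge0.
  rewrite -mean_xiD => [|k|k]; last 2 first.
  - exact: geom_ge0.
  - by rewrite mulr_ge0 ?geom_sum_ge0 ?(ltW t_gt0).
  apply: eq_integral => w _; congr EFin.
  by rewrite {1}(geom_sumE (1 - t) (xi w)) (_ : 1 - (1 - t) = t)%R//; ring.
by rewrite -(fineK gfin) -(fineK hfin) -EFinM -EFinD/= G.
Qed.

Lemma mean_xi_ge_at f n (c : R) : (0 <= c)%R -> (forall k, (0 <= f k)%R) -> (c <= f n)%R ->
  c%:E * P [set w | xi w = n] <= mean_xi f.
Proof.
move=> c0 f0 cf; have mn : measurable [set w | xi w = n] by exact: measurable_xi.
rewrite -(integral_cst P mn c%:E); apply: (@le_trans _ _ (\int[P]_(w in [set w | xi w = n]) (f (xi w))%:E)).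
  apply: ge0_le_integral => //.
  - exact: measurable_funTS (measurable_fun_xi xi f).
  - by move=> w /= ->; rewrite lee_fin.
apply: ge0_subset_integral => //; first exact: measurable_fun_xi.
by move=> w _; rewrite lee_fin.
Qed.

(** Otherwise the offspring would be at most [1]. *)
Lemma offspring_ge2 : 1 < mean_xi (fun k => k%:R) ->
  exists2 n, (1 < n)%N & 0 < P [set w | xi w = n].
Proof.
move=> m1; apply: contrapT => H; move: m1; apply/negP; rewrite -leNgt.
have mn n : measurable [set w | xi w = n] by exact: measurable_xi.
rewrite -[leRHS](mean_xi_cst 1).
apply: (@ge0_le_integral_fibers _ _ _ (xi : T -> nat)) => //.
- exact: (measurable_fun_xi xi (fun k => k%:R)).
move=> n; have [n1|n1] := leqP n 1.
  rewrite (eq_integral (cst n%:R%:E)) => [|w /set_mem /= ->//].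
  by rewrite !integral_cst//; apply: lee_wpmul2r => //; rewrite lee_fin lern1.
have Pn0 : P [set w | xi w = n] = 0.
  apply/eqP; rewrite eq_le measure_ge0 andbT leNgt; apply/negP => Pn.
  by apply: H; exists n.
rewrite (eq_integral (cst n%:R%:E)) => [|w /set_mem /= ->//].
have int0 (c : R) : \int[P]_(w in [set w | xi w = n]) c%:E = 0.
  by rewrite integral_cst// -[RHS](mule0 c%:E); congr (_ * _); exact: Pn0.
by rewrite !int0.
Qed.

End moments.

(** * The critical limit *)

Section supercritical.
Context (R : realType) d (T : measurableType d) (P : probability T R) (xi : {RV P >-> nat}).
Local Notation m := (factorial_moment xi).
Local Notation mean_xi := (mean_xi xi).
Hypothesis m1_gt1 : (1 < m 1%N)%E.
Hypothesis m3_fin : (m 3%N < +oo)%E.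

Lemma factorial_moment1 : m 1%N = mean_xi (fun k => k%:R).
Proof.
rewrite factorial_momentE; apply: eq_integral => w _.
by rewrite big_ord_recl big_ord0 mulr1 subr0.
Qed.

Lemma factorial_moment2 : m 2%N = mean_xi (fun k => k%:R * (k%:R - 1)).
Proof.
rewrite factorial_momentE; apply: eq_integral => w _.
by rewrite !big_ord_recl big_ord0 mulr1 subr0.
Qed.

Lemma factorial_moment3 : m 3%N = mean_xi (fun k => k%:R * (k%:R - 1) * (k%:R - 2)).
Proof.
rewrite factorial_momentE; apply: eq_integral => w _.
by rewrite !big_ord_recl big_ord0 mulr1 subr0/= mulrA.
Qed.

Lemma falling2_ge0 k : 0 <= k%:R * (k%:R - 1) :> R.
Proof.
by case: k => [|k]; rewrite ?mul0r// mulr_ge0// subr_ge0 ler1n.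
Qed.

Lemma falling3_ge0 k : 0 <= k%:R * (k%:R - 1) * (k%:R - 2) :> R.
Proof.
case: k => [|[|k]]; rewrite ?mul0r ?subrr ?mulr0 ?mul0r//.
Qed.

(** The square is bounded by the third falling factorial up to constants: at [0],
    [1] and [2] the latter vanishes and the square is at most [4]. *)
Lemma second_moment_fin : (mean_xi (fun k => k%:R ^+ 2)%R < +oo)%E.
Proof.
apply: (@le_lt_trans _ _ (mean_xi (fun k => 4 + 2 * (k%:R * (k%:R - 1) * (k%:R - 2))))).
  apply: mean_xi_le => k; first exact: sqr_ge0.
  case: k => [|[|k]]; [by rewrite !mul0r mulr0 addr0 expr2 mul0r|by rewrite subrr !(mulr0, mul0r); lra|].
  have : 0 <= k%:R :> R by [].
  rewrite -addn2 natrD; nra.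
rewrite mean_xiD// => [|k]; last by rewrite mulr_ge0// falling3_ge0.
rewrite mean_xiZ => [|//|k]; last exact: falling3_ge0.
by rewrite mean_xi_cst -factorial_moment3 lte_add_pinfty ?ltry// lte_mul_pinfty.
Qed.

Lemma mean_offspring_fin : mean_xi (fun k => k%:R) \is a fin_num.
Proof.
apply: (mean_xi_fin second_moment_fin (c := 0)) => // k.
by rewrite ler0n add0r expr2 -natrM ler_nat; case: k => // k; rewrite leq_pmulr.
Qed.

Lemma mean_falling2_fin : mean_xi (fun k => k%:R * (k%:R - 1)) \is a fin_num.
Proof.
apply: (mean_xi_fin second_moment_fin (c := 0)) => // k.
by rewrite falling2_ge0 add0r expr2 ler_wpM2l// gerBl.
Qed.

Lemma mean_offspring_gt1 : 1 < fine (m 1%N).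
Proof. by rewrite factorial_moment1 -lte_fin fineK ?mean_offspring_fin// -factorial_moment1. Qed.

(** As [k <= 1 + k * (k - 1)] and [m1 > 1]. *)
Lemma mean_falling2_gt0 : 0 < fine (m 2%N).
Proof.
suff : fine (m 1%N) <= 1 + fine (m 2%N) by have := mean_offspring_gt1; lra.
rewrite factorial_moment1 factorial_moment2 -lee_fin EFinD !fineK ?mean_offspring_fin ?mean_falling2_fin//.
rewrite -(mean_xi_cst xi 1) -mean_xiD => [|//|k]; last exact: falling2_ge0.
apply: mean_xi_le => // k; have := sqr_ge0 (k%:R - 1 : R); nra.
Qed.

Lemma mean_xi_expr_le t : 0 <= t <= 1 ->
  (mean_xi (fun k => (1 - t) ^+ k)%R <=
   (1 - t * fine (m 1%N) + t ^+ 2 * fine (mean_xi (fun k => k%:R ^+ 2)))%R%:E)%E.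
Proof.
move=> /andP[t0 t1]; have q01 : 0 <= 1 - t <= 1 by rewrite subr_ge0 t1 gerBl.
have /andP[q0 _] := q01.
have sfin : mean_xi (fun k => k%:R ^+ 2) \is a fin_num.
  by apply: (mean_xi_fin second_moment_fin (c := 0)) => // k; rewrite sqr_ge0 add0r lexx.
rewrite factorial_moment1 EFinD EFinB addeAC !EFinM !fineK ?mean_offspring_fin//.
rewrite leeBrDr ?fin_numM ?mean_offspring_fin//.
rewrite -!mean_xiZ ?sqr_ge0//.
rewrite -(mean_xi_cst xi 1) -!mean_xiD //; last 3 first.
- by move=> k; rewrite mulr_ge0 ?mulr_ge0 ?sqr_ge0.
- by move=> k; exact: exprn_ge0.
- by move=> k; rewrite mulr_ge0.
apply: mean_xi_le => k; first by rewrite addr_ge0 ?mulr_ge0 ?exprn_ge0.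
have := geomE (1 - t) k; have := geom_sumE (1 - t) k.
rewrite (_ : 1 - (1 - t) = t) => [K G|]; last by ring.
have := congr1 ( *%R t) K; rewrite mulrDr G.
have := ler_wpM2l (mulr_ge0 t0 t0) (geom_sum_le k q01); lra.
Qed.

(** The generating function of the number of children has slope [p * m1 > 1] at
    [1], so it is below the diagonal slightly on the left of [1]. *)
Lemma supercritical_survival p : 0 < p < 1 -> 1 < p * fine (m 1%N) ->
  exists2 x, 0 < x <= 1 & (mean_xi (fun k => (1 - p * x) ^+ k)%R <= (1 - x)%:E)%E.
Proof.
move=> /andP[p0 p1] pm; set M := fine (mean_xi (fun k => k%:R ^+ 2)).
have M0 : 0 <= M by apply: fine_ge0; apply: mean_xi_ge0 => k; exact: sqr_ge0.
(* By [mean_xi_expr_le] the condition on [x] follows from [x * M <= p * m1 - 1]; the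
   [+ 1] keeps the denominator positive. *)
pose y := (p * fine (m 1%N) - 1) / (M + 1).
have y0 : 0 < y by rewrite divr_gt0 ?subr_gt0// ltr_wpDl.
have yM : y * (M + 1) = p * fine (m 1%N) - 1 by rewrite divfK// gt_eqF// ltr_wpDl.
have [x [x0 x1 xy]] : exists x, [/\ 0 < x, x <= 1 & x <= y].
  by exists (Num.min 1 y); rewrite lt_min ltr01 y0 !ge_min !lexx orbT.
exists x; first by rewrite x0.
have px1 : p * x <= 1 by rewrite mulr_ile1 ?(ltW p0) ?(ltW p1) ?(ltW x0).
apply: le_trans (mean_xi_expr_le _) _; first by rewrite mulr_ge0 ?(ltW p0) ?(ltW x0).
rewrite lee_fin -/M.
have : x * (M + 1) <= p * fine (m 1%N) - 1 by rewrite -yM ler_wpM2r// addr_ge0.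
have : p ^+ 2 <= 1 by rewrite expr_le1 ?(ltW p0) ?(ltW p1).
move=> pp xM.
have : p ^+ 2 * (x * M) <= x * M by rewrite ler_piMl// mulr_ge0// ltW.
move=> h; have : x * (p ^+ 2 * (x * M)) <= x * (p * fine (m 1%N) - 1).
  by apply: ler_wpM2l; [exact: ltW|nra].
rewrite !expr2; lra.
Qed.

Lemma cvg_mean_geom_sum (q : nat -> R) : (forall n, 0 <= q n <= 1) -> q n @[n --> \oo] --> (1 : R) ->
  fine (mean_xi (geom_sum (q n))) @[n --> \oo] --> fine (m 2%N) / 2.
Proof.
move=> q01 q1; have -> : fine (m 2%N) / 2 = fine (mean_xi (geom_sum 1)).
  rewrite factorial_moment2 mulrC -[_ * _]/(fine (2^-1)%:E * _) -fineM ?mean_falling2_fin//.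
  rewrite -mean_xiZ => [||k]; [|by rewrite invr_ge0|exact: falling2_ge0].
  by congr fine; apply: eq_integral => w _; rewrite geom_sum1 mulrC.
apply: (cvg_mean_xi second_moment_fin) => [n k|k]; last exact: cvg_geom_sum.
by have /andP[q0 _] := q01 n; rewrite geom_sum_ge0// geom_sum_le.
Qed.

Lemma cvg_mean_excess (p q : nat -> R) (l : R) : (forall n, 0 <= p n <= 1) ->
  (forall n, 0 <= q n <= 1) -> p n @[n --> \oo] --> l -> q n @[n --> \oo] --> (1 : R) ->
  fine (mean_xi (fun k => thinned_mean (p n) k (excess (q n)) 0)) @[n --> \oo]
    --> l ^+ 2 * fine (m 2%N) / 6.
Proof.
move=> p01 q01 pl q1.
have -> : l ^+ 2 * fine (m 2%N) / 6 = fine (mean_xi (fun k => thinned_mean l k (excess 1) 0)).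
  rewrite factorial_moment2 mulrAC -[_ * _]/(fine (l ^+ 2 / 6)%:E * _) -fineM ?mean_falling2_fin//.
  rewrite -mean_xiZ => [||k]; [|by rewrite divr_ge0 ?sqr_ge0|exact: falling2_ge0].
  congr fine; apply: eq_integral => w _; congr EFin.
  have scale n k : thinned_mean l n (excess 1) k =
      6^-1 * thinned_mean l n (fun j => j%:R * (j%:R - 1)) k.
    elim: n k => [|n IH] k /=; first exact: excess1.
    by rewrite !IH; ring.
  by rewrite scale thinned_mean_pair; field.
apply: (cvg_mean_xi second_moment_fin) => [n k|k]; last first.
  by apply: cvg_thinned_mean => // j; exact: cvg_excess.
have /andP[q0 _] := q01 n; rewrite thinned_mean_ge0//=; last by move=> j; exact: excess_ge0.
apply: thinned_mean_le => // j jk; apply: le_trans (excess_le _ _) _ => //.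
by rewrite ler_sqr ?nnegrE// ler_nat.
Qed.

End supercritical.

Theorem theorem1p2 (R : realType) (d : measure_display) (T : measurableType d)
    (P : probability T R) (xi : {RV P >-> nat}) (v : R -> R) :
  let m := factorial_moment xi in
  let m1 := fine (m 1%N) in
  let m2 := fine (m 2%N) in
  let p_c := m1^-1 in
  (1 < m 1%N)%E ->
  (m 3%N < +oo)%E ->
  (forall p : R, p_c < p -> p < 1 ->
     effective_speed (distribution P xi) p (v p)) ->
  v p / (p - p_c) ^+ 2 @[p --> p_c^'+] --> m1 ^+ 4 / (3 * m2).
Proof.
move=> m m1 m2 p_c m1_gt1 m3_fin speed.
have square := second_moment_fin m3_fin.
have m1_1 : 1 < m1 by exact: mean_offspring_gt1.
have m2_0 : 0 < m2 by exact: mean_falling2_gt0.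
have pc_0 : 0 < p_c by rewrite invr_gt0 (lt_trans ltr01).
have pc_1 : p_c < 1 by rewrite invf_lt1// (lt_trans ltr01).
have m1pc : m1 * p_c = 1 by rewrite mulfV// gt_eqF// (lt_trans ltr01).
have [N N1 PN] : exists2 n, (1 < n)%N & (0 < P [set w | xi w = n])%E.
  by apply: offspring_ge2; rewrite -factorial_moment1.
pose H (q : R) := fine (mean_xi xi (geom_sum q)).
pose E p q := fine (mean_xi xi (fun k => thinned_mean p k (excess q) 0)).
pose c := fine (P [set w | xi w = N]).
have c_fin : P [set w | xi w = N] \is a fin_num.
  by apply: fin_num_measure; exact: measurable_xi.
have c_0 : 0 < c.
  by apply: fine_gt0; rewrite PN/= ltey_eq c_fin.
have H_ge q : 0 <= q <= 1 -> c <= H q.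
  move=> q01; have /andP[q0 _] := q01.
  have Hfin : mean_xi xi (geom_sum q) \is a fin_num.
    by apply: (mean_xi_fin square (c := 0)) => // k; rewrite geom_sum_ge0// add0r geom_sum_le.
  rewrite -lee_fin (fineK c_fin) (fineK Hfin).
  rewrite -[leLHS]mul1e; apply: mean_xi_ge_at => // [k|]; first exact: geom_sum_ge0.
  exact: geom_sum_ge1.
(* The survival probability; for other values of [p] anything in the unit interval
   would do. *)
have theta_of p : exists theta, [/\ 0 <= theta <= 1,
    p_c < p -> p < 1 -> 0 < theta,
    p_c < p -> p < 1 -> m1 = p^-1 + p * theta * H (1 - p * theta) &
    p_c < p -> p < 1 -> v p * (2 - theta) = theta ^+ 2 * E p (1 - theta)].
  have [/andP[pp p1]|pp] := boolP (p_c < p < 1); last first.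
    by exists 0; rewrite lexx ler01; split=> // p0 p1; rewrite p0 p1 in pp.
  have p0 : 0 < p by exact: lt_trans pp.
  have p01 : 0 < p < 1 by rewrite p0.
  have [x x01 xP] : exists2 x, 0 < x <= 1 & (mean_xi xi (fun k => (1 - p * x) ^+ k)%R <= (1 - x)%:E)%E.
    by apply: supercritical_survival => //; rewrite -/m -/m1 -m1pc mulrC ltr_pM2r ?(lt_trans ltr01).
  have [theta [t01 fix_t vE]] := effective_speed_formula p01 N1 PN x01 xP (speed p pp p1).
  have /andP[t0 t1] := t01; exists theta; split => //; first by rewrite ltW.
  rewrite /m1 /m factorial_moment1 (survival_relation square (p := p) _ t01)//.
  by rewrite p0 ltW.
have [theta thetaP] := choice theta_of.
apply/cvg_at_rightP => u [u_gt u_cvg].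
have u_lt : \forall n \near \oo, u n < 1 by exact: cvgr_lt u_cvg _ pc_1.
(* The sequence is eventually less than [1]. Replacing the other terms by [p_c], with
   survival probability [0], makes the bounds of the dominated convergences hold
   from the start. *)
pose p n := if u n < 1 then u n else p_c.
pose t n := if u n < 1 then u n * theta (u n) else 0.
(* The extinction probability: [t n] is [p n] times the survival probability. *)
pose s n := 1 - t n / p n.
have p_ge n : p_c <= p n by rewrite /p; case: ifP => _ //; exact: ltW.
have p_gt0 n : 0 < p n by exact: lt_le_trans (p_ge n).
have p_le n : p n <= 1 by rewrite /p; case: ifP => [|_]; exact: ltW.
have t_p n : 0 <= t n / p n <= 1.
  rewrite /t /p; case: ifP => _; last by rewrite mul0r lexx ler01.
  rewrite mulrAC mulfV ?mul1r ?gt_eqF//; last exact: lt_trans (u_gt n).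
  by have [] := thetaP (u n).
have t01 n : 0 <= t n <= 1.
  have /andP[h0 h1] := t_p n; rewrite -(divfK (lt0r_neq0 (p_gt0 n)) (t n)).
  have pn0 := ltW (p_gt0 n).
  by apply/andP; split; [exact: mulr_ge0|exact: mulr_ile1].
have p_cvg : p n @[n --> \oo] --> p_c.
  apply: cvg_trans u_cvg; apply: near_eq_cvg.
  by near=> n; rewrite /p ifT//; near: n.
have relation n : u n < 1 -> m1 = (p n)^-1 + t n * H (1 - t n).
  by move=> un; have [_ _ + _] := thetaP (u n); rewrite /p /t un => ->.
(* By [relation] the product [t n * c] is at most [m1 - 1 / p n], which tends to [0]. *)
have t_cvg : t n @[n --> \oo] --> (0 : R).
  apply: (@squeeze_cvgr _ _ _ _ (fun=> 0) (fun n => (m1 - (p n)^-1) / c)); last 2 first.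
  - exact: cvg_cst.
  - rewrite -[X in _ --> X](mul0r c^-1); apply: cvgM; last exact: cvg_cst.
    rewrite -[X in _ --> X](subrr m1); apply: cvgB; first exact: cvg_cst.
    by rewrite -[X in _ --> X]invrK; apply: cvgV => //; rewrite gt_eqF.
  near=> n; have /andP[t0 t1] := t01 n; rewrite t0/= ler_pdivlMr//.
  have un : u n < 1 by near: n.
  rewrite {1}(relation n un) addrAC subrr add0r ler_wpM2l// H_ge//.
  by rewrite subr_ge0 t1 gerBl.
have s_cvg : s n @[n --> \oo] --> (1 : R).
  rewrite -[X in _ --> X]subr0; apply: cvgB; first exact: cvg_cst.
  rewrite -[X in _ --> X](mul0r p_c^-1); apply: cvgM => //.
  by apply: cvgV => //; rewrite gt_eqF.
have H_cvg : H (1 - t n) @[n --> \oo] --> m2 / 2.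
  apply: (cvg_mean_geom_sum m3_fin) => [n|].
    by have /andP[t0 t1] := t01 n; rewrite subr_ge0 t1 gerBl.
  by rewrite -[X in _ --> X]subr0; apply: cvgB => //; exact: cvg_cst.
have E_cvg : E (p n) (s n) @[n --> \oo] --> p_c ^+ 2 * m2 / 6.
  apply: (cvg_mean_excess m3_fin) => // n; first by rewrite p_le ltW.
  by have /andP[t0 t1] := t_p n; rewrite subr_ge0 t1 gerBl.
have limE : m1 ^+ 4 / (3 * m2) = m1 ^+ 2 * (p_c ^+ 2 * m2 / 6) / ((1 + 1) * p_c ^+ 4 * (m2 / 2) ^+ 2).
  by rewrite /p_c; field; rewrite !gt_eqF// (lt_trans ltr01).
rewrite limE.
have lim : m1 ^+ 2 * E (p n) (s n) / ((1 + s n) * p n ^+ 4 * H (1 - t n) ^+ 2) @[n --> \oo] -->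
    m1 ^+ 2 * (p_c ^+ 2 * m2 / 6) / ((1 + 1) * p_c ^+ 4 * (m2 / 2) ^+ 2).
  apply: cvgM; first by apply: cvgM => //; exact: cvg_cst.
  apply: cvgV; first by rewrite !mulf_neq0 ?expf_neq0 ?gt_eqF// ?divr_gt0// addr_gt0.
  apply: cvgM; last exact: (cvg_pow_nat H_cvg).
  by apply: cvgM; [apply: cvgD => //; exact: cvg_cst|exact: (cvg_pow_nat p_cvg)].
apply: cvg_trans lim; apply: near_eq_cvg; near=> n.
have un : u n < 1 by near: n.
have [t01' /(_ (u_gt n) un) t0 _ /(_ (u_gt n) un) vE] := thetaP (u n).
have rel := relation n un.
have /andP[_ t1] := t01'.
have u0 : 0 < u n by exact: lt_trans (u_gt n).
have H0 : 0 < H (1 - t n).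
  by apply: lt_le_trans c_0 (H_ge _ _); have /andP[? ?] := t01 n; rewrite subr_ge0 gerBl; apply/andP.
have pE : p n = u n by rewrite /p un.
have tE : t n = u n * theta (u n) by rewrite /t un.
have sE : s n = 1 - theta (u n) by rewrite /s tE pE mulrAC mulfV ?mul1r ?gt_eqF.
move: rel vE H0; rewrite sE pE; set h := H _ => rel vE h0; rewrite tE in rel.
set e := E _ _ in vE *; set th := theta (u n) in rel t0 t1 vE *.
(* As [m1 * p_c = 1], this is [relation] multiplied by [u n / m1]. *)
have diff : u n - p_c = u n ^+ 2 * th * h / m1.
  have : m1 * (u n - p_c) = u n ^+ 2 * th * h.
    by rewrite mulrBr m1pc {1}rel; field; rewrite gt_eqF.
  by move=> <-; rewrite mulrAC mulfV ?mul1r ?gt_eqF ?(lt_trans ltr01).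
have v_eq : v (u n) = th ^+ 2 * e / (2 - th).
  by rewrite -vE mulfK// subr_eq0 gt_eqF// (le_lt_trans t1)// ltr1n.
rewrite diff v_eq; field.
have th2 : 0 < 2 - th by rewrite subr_gt0 (le_lt_trans t1)// ltr1n.
by rewrite !gt_eqF// (lt_trans ltr01).
Unshelve. all: by end_near. Qed.
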